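(* Let $f \in \mathbb{C}[x_1,\ldots,x_n]_d$ be homogeneous of degree $d$ with $f \trianglelefteq P_{1,2}^{[d]}$. Then one of the following holds: (1) $f \le P_{1,2}^{[d]}$; (2) $f \le \prod_{i=1}^d y_i + y_0^{d-1} y_{d+1}$; (3) $\underline{\mathsf{WR}}(f) = O(d^8)$.
   Context: $P^{[d]}_{1,2} := z_1\cdots z_d + u_1^d + u_2^d$ in $d+2$ variables; $\prod_{i=1}^d y_i + y_0^{d-1}y_{d+1}$ is a polynomial in the $d+2$ variables $y_0,\ldots,y_{d+1}$. For homogeneous $f$ in variables $x_1,\ldots,x_n$ and $g$ in variables $w_1,\ldots,w_N$ of the same degree: $f\le g$ means $f(x)=g(Ax)$ for some $A\in\mathbb{C}^{N\times n}$; $f\trianglelefteq g$ means $f$ lies in the closure of $\{x\mapsto g(Ax): A\in\mathbb{C}^{N\times n}\}$. The border Waring rank $\underline{\mathsf{WR}}(f)$ is the smallest $r$ with $f=\lim_{\varepsilon\to0}\sum_{i=1}^r \ell_i(\varepsilon)^d$ for linear forms $\ell_i$ with coefficients in $\mathbb{C}(\varepsilon)$. $O(d^8)$ means bounded by $Cd^8$ for an absolute constant $C$. *)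

(* Defs.v *)
From HB Require Import structures.
From mathcomp Require Import all_boot all_order all_algebra.
From mathcomp Require Import complex.
From mathcomp Require Import mpoly.
From mathcomp Require Import boolp classical_sets reals topology.

Set Implicit Arguments.
Unset Strict Implicit.
Unset Printing Implicit Defensive.

Import Order.TTheory GRing.Theory Num.Theory.
Import numFieldTopology.Exports.

Local Open Scope classical_set_scope.
Local Open Scope ring_scope.

(* Bundling R[i] as a numClosedFieldType lets it inherit the topology given by
   the complex modulus. *)
Definition CC (R : realType) : numClosedFieldType := R[i]%C.

(* The polynomial g(Ax): the i-th variable of g becomes \sum_j A i j x_j. *)
Definition linsubst (K : comNzRingType) (n N : nat)
    (g : {mpoly K[N]}) (A : 'M[K]_(N, n)) : {mpoly K[n]} :=
  g \mPo [tuple \sum_(j < n) A i j *: 'X_j | i < N].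

Definition projection (K : comNzRingType) (n N : nat)
    (f : {mpoly K[n]}) (g : {mpoly K[N]}) : Prop :=
  exists A : 'M[K]_(N, n), f = linsubst g A.

(* Polynomials are compared coefficientwise.  On the polynomials of degree at
   most d, which form a finite-dimensional space, the topology of pointwise
   convergence of the coefficients is the usual one. *)
Definition coefs (R : realType) (n : nat) (f : {mpoly (CC R)[n]}) :
    prod_topology (fun _ : 'X_{1..n} => CC R) :=
  fun m => f@_m.

Definition degeneration (R : realType) (n N : nat)
    (f : {mpoly (CC R)[n]}) (g : {mpoly (CC R)[N]}) : Prop :=
  closure [set coefs (linsubst g A) | A in [set: 'M[CC R]_(N, n)]] (coefs f).

(* P_{1,2}^[d] = z_1 ... z_d + u_1^d + u_2^d; the variables of index < d are
   the z's, the last two are u_1 and u_2. *)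
Definition P12 (K : comNzRingType) (d : nat) : {mpoly K[d + 2]} :=
  \prod_(i < d) 'X_(lshift 2 i)
    + 'X_(rshift d (0 : 'I_2)) ^+ d + 'X_(rshift d (1 : 'I_2)) ^+ d.

(* y_1 ... y_d + y_0^(d-1) y_(d+1); y_k is the variable of index k < d + 2. *)
Definition prod_plus_tangent (K : comNzRingType) (d : nat) : {mpoly K[d.+2]} :=
  let y (k : nat) : {mpoly K[d.+2]} := 'X_(inord k) in
  \prod_(1 <= i < d.+1) y i + y 0%N ^+ d.-1 * y d.+1.

(* Value at e of a rational function in C(eps).  The representative of the
   fraction need not be reduced; values obtained from two representatives can
   only differ at the finitely many zeros of their denominators. *)
Definition ratfun_eval (K : fieldType) (c : {fraction {poly K}}) (e : K) : K :=
  (\n_(repr c)).[e] / (\d_(repr c)).[e].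

Definition ratfun_mpoly_lim (R : realType) (n : nat)
    (F : {mpoly {fraction {poly CC R}}[n]}) (f : {mpoly (CC R)[n]}) : Prop :=
  forall m : 'X_{1..n},
    ratfun_eval F@_m e @[e --> (0 : CC R)^'] --> (f@_m : CC R).

Definition border_waring_decomp (R : realType) (n d : nat)
    (f : {mpoly (CC R)[n]}) (r : nat) : Prop :=
  exists l : 'I_r -> {mpoly {fraction {poly CC R}}[n]},
    (forall i, l i \is 1.-homog) /\
    ratfun_mpoly_lim (\sum_(i < r) l i ^+ d) f.

(* The degree d is a parameter because the zero polynomial is homogeneous of
   every degree. *)
Definition is_border_waring_rank (R : realType) (n d : nat)
    (f : {mpoly (CC R)[n]}) (r : nat) : Prop :=
  border_waring_decomp d f r /\
  forall s : nat, border_waring_decomp d f s -> (r <= s)%N.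

(* Main.v *)
(** Let K be the ultrapower of C along a free ultrafilter on N; it is a field
    whose finite elements have a standard part. If f is a degeneration of
    P_{1,2}, then f is the standard part of F = l_1 ... l_d + a^d + b^d for
    linear forms l_i, a, b over K.

    Pull out scalars so that l_1 ... l_d = g m_1 ... m_d, where every m_i has a
    nonzero standard part. If g is finite, the product converges and so does
    a^d + b^d. The limit of a^d + b^d is a sum of two d-th powers or, when the two
    forms diverge and cancel, a first-order term s^(d-1) t: cases (1) and (2).

    If g is infinite, split the space, over the valuation ring, into a
    complement and the span u, v of a and b. Since F converges, putting u and v
    equal to constants shows that m_1 ... m_d becomes, up to o(1), constant on
    the complement, and that g times its nonconstant homogeneous parts stays
    finite. By Newton's identities g e_j and g (-1)^(j-1) p_j / j then agree up to
    o(1), p_j being the j-th power sum of the d forms. Interpolating along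
    d + 1 points of the line through u and v recovers g m_1 ... m_d, up to o(1), as
    a combination of products u^x v^e w^j with w linear, and each of these is a
    combination of (d+1)^2 d-th powers. So f is the standard part of a sum of at
    most d (d+1)^5 + 2 d-th powers over K.

    Finally such a sum is turned into a border Waring decomposition. Being
    within 1/(k+1) of f is a semialgebraic condition with parameter 1/(k+1), so
    by quantifier elimination the coefficients can be chosen algebraic over
    C(eps), eps being the class of 1/(k+1). They lie in a finite extension of
    C(eps), whose valuation is discrete; expanding in a uniformizer and truncating
    makes them Laurent polynomials in one variable. *)

From HB Require Import structures.
From mathcomp Require Import all_boot all_order all_algebra.
From mathcomp Require Import generic_quotient ring_quotient fraction.
From mathcomp Require Import separable.
From mathcomp Require ordered_qelim qe_rcf.
From mathcomp Require Import complex polyrcf.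
From mathcomp Require Import mpoly.
From mathcomp Require Import boolp classical_sets functions reals topology normedtype.
From mathcomp Require Import ring lra zify.
Require Import Defs.

Set Implicit Arguments.
Unset Strict Implicit.
Unset Printing Implicit Defensive.

Import Order.TTheory GRing.Theory Num.Theory.
Import numFieldTopology.Exports numFieldNormedType.Exports.

Local Open Scope classical_set_scope.
Local Open Scope ring_scope.

(** * Hypercomplex numbers *)

Section Ultrafilter.

Lemma exists_nonprincipal : exists G : set_system nat, UltraFilter G /\ \oo `<=` G.
Proof. exact: ultraFilterLemma. Qed.

Definition freeU : set_system nat := sval (cid exists_nonprincipal).

Instance freeU_ultra : UltraFilter freeU.
Proof. by rewrite /freeU; case: cid => G []. Qed.

Lemma freeU_oo : \oo `<=` freeU.
Proof. by rewrite /freeU; case: cid => G []. Qed.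

Instance freeU_proper : ProperFilter freeU.
Proof. exact: ultra_proper. Qed.

Lemma freeU_or A B : freeU (A `|` B) -> freeU A \/ freeU B.
Proof.
move=> hAB; have [?|hA] := in_ultra_setVsetC A freeU_ultra; first by left.
right; apply: filterS (filterI hAB hA) => x [[]] //.
Qed.

End Ultrafilter.
#[export] Existing Instance freeU_ultra.
#[export] Existing Instance freeU_proper.

Section Hypercomplex.
Variable R : realType.
Notation C := (CC R).
Notation S := (nat -> C).

Definition null_seq (s : S) : bool := `[< freeU [set k | s k = 0] >].

Lemma null_seqP (s : S) : reflect (freeU [set k | s k = 0]) (s \in (null_seq : {pred S})).
Proof. exact: asboolP. Qed.

Lemma null_seq_idealr : idealr_closed (null_seq : {pred S}).
Proof.
split.
- by apply/null_seqP; apply: filterS filterT => k _.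
- apply/negP => /null_seqP h; apply: (@filter_not_empty _ freeU).
  by apply: filterS h => k /= /eqP; rewrite oner_eq0.
- move=> a u v /null_seqP hu /null_seqP hv; apply/null_seqP.
  apply: filterS (filterI hu hv) => k /= [hu0 hv0].
  by rewrite /GRing.add/= /GRing.mul/= hu0 hv0 mulr0 addr0.
Qed.

HB.instance Definition _ := isIdealr.Build S null_seq null_seq_idealr.

Definition null_ideal : idealr (S : comNzRingType) := null_seq.
(** The ultrapower of the complex numbers, encoded as a quotient of the ring of all sequences so
    that the ring structure is inherited and only inverses remain to be built. *)
Definition hyper := {ideal_quot null_ideal}.
HB.instance Definition _ := GRing.ComNzRing.on hyper.

Definition hcls (s : S) : hyper := (\pi s)%qT.

Lemma hcls_surj (x : hyper) : exists s, hcls s = x.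
Proof. by exists (repr x); rewrite /hcls reprK. Qed.

Lemma hcls_zmod : zmod_morphism hcls.
Proof. by move=> x y; rewrite /hcls !piE. Qed.
HB.instance Definition _ := GRing.isZmodMorphism.Build S hyper hcls hcls_zmod.
Lemma hcls_monoid : monoid_morphism hcls.
Proof. by split => [|x y]; rewrite /hcls !piE. Qed.
HB.instance Definition _ := GRing.isMonoidMorphism.Build S hyper hcls hcls_monoid.

Lemma hcls_eq (s t : S) : hcls s = hcls t <-> freeU [set k | s k = t k].
Proof.
split.
  move/eqP; rewrite /hcls -Quotient.idealrBE => /null_seqP.
  by apply: filterS => k /= /eqP; rewrite /GRing.add/= /GRing.opp/= subr_eq0 => /eqP.
move=> h; apply/eqP; rewrite /hcls -Quotient.idealrBE; apply/null_seqP.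
by apply: filterS h => k /= e; rewrite /GRing.add/= /GRing.opp/= e subrr.
Qed.

Definition hinv (x : hyper) : hyper := hcls (fun k => (repr x k)^-1).

Lemma hinvE s : hinv (hcls s) = hcls (fun k => (s k)^-1).
Proof.
apply/hcls_eq; have /hcls_eq : hcls (repr (hcls s)) = hcls s by rewrite /hcls reprK.
by apply: filterS => k /= ->.
Qed.

(** Here the ultrafilter property enters: a sequence that does not vanish almost everywhere is
    nonzero almost everywhere, so termwise inversion works. *)
Lemma hmulV : forall x : hyper, x != 0 -> hinv x * x = 1.
Proof.
move=> x; have [s <-] := hcls_surj x.
rewrite hinvE -rmorphM -(rmorph0 hcls) -(rmorph1 hcls) => /eqP hs; apply/hcls_eq.
have [h|] := in_ultra_setVsetC [set k | s k = 0] freeU_ultra.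
  by case: hs; apply/hcls_eq.
by apply: filterS => k /= /eqP sk; rewrite /GRing.mul/= mulVf.
Qed.

Lemma hinv0 : hinv 0 = 0.
Proof.
by rewrite -(rmorph0 hcls) hinvE; apply/hcls_eq; apply: filterS filterT => k _ /=; rewrite invr0.
Qed.

HB.instance Definition _ := GRing.ComNzRing_isField.Build hyper hmulV hinv0.

End Hypercomplex.

(* [lim x c]: the element x of the valuation ring has residue c. Elements outside
   the valuation ring are related to no c. *)
Record is_place (C K : fieldType) (iota : {rmorphism C -> K}) (lim : K -> C -> Prop) : Prop :=
  IsPlace {
    place_const : forall c, lim (iota c) c ;
    placeD : forall x y a b, lim x a -> lim y b -> lim (x + y) (a + b) ;
    placeM : forall x y a b, lim x a -> lim y b -> lim (x * y) (a * b) ;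
    place_uniq : forall x a b, lim x a -> lim x b -> a = b ;
    place_dich : forall x, (exists c, lim x c) \/ lim x^-1 0
  }.

Section HyperPlace.
Variable R : realType.
Notation C := (CC R).
Notation K := (hyper R).

Definition hconst (c : C) : K := hcls (fun _ => c).
Lemma hconst_zmod : zmod_morphism hconst.
Proof. by move=> x y; rewrite /hconst -rmorphB. Qed.
HB.instance Definition _ := GRing.isZmodMorphism.Build C K hconst hconst_zmod.
Lemma hconst_monoid : monoid_morphism hconst.
Proof. by split => [|x y]; rewrite /hconst -?rmorphM -?(rmorph1 (@hcls R)). Qed.
HB.instance Definition _ := GRing.isMonoidMorphism.Build C K hconst hconst_monoid.

Lemma seqDE (s t : nat -> C) : s + t = (fun k => s k + t k).
Proof. by []. Qed.
Lemma seqME (s t : nat -> C) : s * t = (fun k => s k * t k).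
Proof. by []. Qed.
Lemma seqXE (s : nat -> C) m : s ^+ m = (fun k => s k ^+ m).
Proof. by elim: m => [|m IH]; apply/funext => k; rewrite ?expr0 // !exprS IH. Qed.

Definition hlim (x : K) (c : C) : Prop :=
  exists s, hcls s = x /\ s k @[k --> freeU] --> c.

Lemma hlimE (s : nat -> C) c : hlim (hcls s) c <-> s k @[k --> freeU] --> c.
Proof.
split => [[t [/hcls_eq st tc]]|sc]; last by exists s.
apply: cvg_trans tc; apply: near_eq_cvg; exact: st.
Qed.

Lemma fmap_ultra (T U : Type) (f : T -> U) (F : set_system T) :
  UltraFilter F -> UltraFilter (f x @[x --> F]).
Proof.
move=> FU; split; first exact: fmap_proper_filter.
move=> G PG FG; apply/seteqP; split => A GA; last exact: FG.
have [//|FnA] := in_ultra_setVsetC (f @^-1` A) FU.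
have GnA : G (~` A) by apply: FG.
case: (@filter_not_empty _ G _).
by apply: filterS (filterI GA GnA) => x [].
Qed.

(** The image of the ultrafilter is an ultrafilter on the compact segment from -B to B, hence it
    converges. *)
Lemma ultra_cvg_bounded (x : nat -> R) (B : R) :
  freeU [set k | `|x k| <= B] -> exists a : R, x k @[k --> freeU] --> a.
Proof.
move=> hB; have := @segment_compact R (- B) B; rewrite compact_ultra.
move=> /(_ _ (fmap_ultra x freeU_ultra)) [].
  by apply: filterS hB => k /=; rewrite ler_norml in_itv.
by move=> a [_ ha]; exists a.
Qed.

Lemma normc_real (x : R) : `|(x%:C)%C| = (`|x|%:C)%C :> C.
Proof. by rewrite normc_def /= expr0n addr0 sqrtr_sqr. Qed.

Lemma cvg_real_complex (x : nat -> R) (a : R) :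
  x k @[k --> freeU] --> a -> (((x k)%:C)%C : C) @[k --> freeU] --> ((a%:C)%C : C).
Proof.
move=> /cvgrPdist_lt xa; apply/cvgrPdist_lt => e e0.
move: (e0); rewrite ltcE => /andP[/eqP ie re].
have {xa} := xa _ re; apply: filterS => k.
by rewrite -rmorphB normc_real ltcE /= ie /= eqxx.
Qed.

Lemma hlim_place : is_place (hconst : {rmorphism C -> K}) hlim.
Proof.
split.
- by move=> c; apply/hlimE; apply: cvg_cst.
- move=> x y a b [s [<- sa]] [t [<- tb]]; rewrite -rmorphD seqDE; apply/hlimE.
  by have := cvgD sa tb; apply.
- move=> x y a b [s [<- sa]] [t [<- tb]]; rewrite -rmorphM seqME; apply/hlimE.
  by have := cvgM sa tb; apply.
- move=> x a b [s [<- sa]] /hlimE sb.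
  exact: (cvg_unique (@norm_hausdorff _ C)) sa sb.
- move=> x; have [s <-] := hcls_surj x.
  (* A sequence bounded almost everywhere has convergent real and imaginary parts. Otherwise, for
     each e, its modulus exceeds 1/e almost everywhere, so the inverse tends to 0. *)
  have [[B hB]|nB] := pselect (exists B : R, freeU [set k | `|s k| <= (B%:C)%C]).
    left; have bR : freeU [set k | `|complex.Re (s k)| <= B].
      apply: filterS hB => k /= h; rewrite -lecR; exact: le_trans (normc_ge_Re _) h.
    have bI : freeU [set k | `|complex.Im (s k)| <= B].
      apply: filterS hB => k /= h; rewrite -lecR; apply: le_trans _ h.
      (* The imaginary part of z is, up to sign, the real part of iz, so the bound for real parts
         applies. *)
      have := normc_ge_Re (s k * 'i%C); rewrite ReiNIm normrN => /le_trans; apply.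
      by rewrite normrM [X in _ * X]normc_def /= expr0n expr1n add0r sqrtr1 mulr1.
    have [a ra] := ultra_cvg_bounded bR; have [b rb] := ultra_cvg_bounded bI.
    exists ((a%:C)%C + 'i%C * (b%:C)%C); apply/hlimE.
    under eq_fun do rewrite (complexE (s _)).
    apply: cvgD; first exact: cvg_real_complex.
    apply: cvgM; [exact: cvg_cst|exact: cvg_real_complex].
  right; rewrite -[(hcls s)^-1]/(hinv _) hinvE; apply/hlimE/cvgr0Pnorm_lt => e e0.
  move: (e0); rewrite ltcE => /andP[/eqP ie re].
  have [h|] := in_ultra_setVsetC [set k | `|s k| <= (((complex.Re e)^-1)%:C)%C] freeU_ultra.
    by case: nB; exists (complex.Re e)^-1.
  apply: filterS => k /= /negP; rewrite -real_ltNge ?normr_real //; last first.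
    by rewrite complex_real.
  have -> : e = ((complex.Re e)%:C)%C by rewrite [LHS]complexE ie mulr0 addr0.
  move=> h; rewrite normfV invf_plt ?posrE.
  - by rewrite -(fmorphV (real_complex R)).
  - by apply: le_lt_trans h; rewrite lecE /= eqxx invr_ge0 ltW.
  - by rewrite ltcE /= eqxx.
Qed.

(** Roots are taken termwise. They serve to absorb scalar coefficients into [d]-th powers. *)
Lemma hyper_root (x : K) (d : nat) : (0 < d)%N -> exists y : K, y ^+ d = x.
Proof.
move=> d0; have [s <-] := hcls_surj x.
exists (hcls (fun k => d.-root (s k))); rewrite -rmorphXn seqXE; apply/hcls_eq.
by apply: filterS filterT => k _ /=; rewrite rootCK.
Qed.

End HyperPlace.

(** * Semialgebraic selection *)

Section SignSelection.
Variable R : rcfType.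

Definition root_of (ps : seq {poly R}) (r : R) : Prop :=
  exists2 p, p \in ps & p != 0 /\ root p r.

(** One kind of point for each cell that the roots cut out of the line: midpoints of two roots (a
    root itself when [r = r']), points beyond an extreme root, and 0 when there is no root. All are
    algebraic over the coefficients. *)
Definition sample_point (ps : seq {poly R}) (x : R) : Prop :=
  x = 0 \/ exists r r', [/\ root_of ps r, root_of ps r' &
    [\/ x = (r + r') / 2, x = r + 1 | x = r - 1]].

Lemma sgr_eq_noroot (p : {poly R}) (a b : R) : a <= b ->
  {in `[a, b], forall x, ~~ root p x} -> Num.sg p.[a] = Num.sg p.[b].
Proof.
move=> ab nr.
have na : p.[a] != 0 by apply: nr; rewrite in_itv /= lexx.
have nb : p.[b] != 0 by apply: nr; rewrite in_itv /= lexx andbT.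
case: (sgrP p.[a]) (na) => [_|ha _|ha _] //; case: (sgrP p.[b]) nb => [_|hb _|hb _] //.
- have [|x xI rx] := @ivt_sign R p a b ab.
    by rewrite (gtr0_sg ha) (ltr0_sg hb) mul1r.
  by have := nr x (subset_itv_oo_cc xI); rewrite rx.
- have [|x xI rx] := @ivt_sign R p a b ab.
    by rewrite (ltr0_sg ha) (gtr0_sg hb) mulr1.
  by have := nr x (subset_itv_oo_cc xI); rewrite rx.
Qed.

(** Signs are constant on a cell, so [x0] can be moved inside its cell to the sample point there. *)
Lemma sgr_sample (ps : seq {poly R}) (x0 : R) :
  exists2 x, sample_point ps x & {in ps, forall p, Num.sg p.[x] = Num.sg p.[x0]}.
Proof.
pose P := \prod_(p <- ps | p != 0) p.
have P0 : P != 0.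
  by rewrite /P; apply: (big_ind (fun q => q != 0)) => //; [exact: oner_neq0|move=> u v; exact: mulf_neq0].
have rP r : root P r -> root_of ps r.
  rewrite /root /P horner_prod prodf_seq_eq0 => /hasP[p pps /andP[p0 pr]].
  by exists p.
have Pr p r : p \in ps -> p != 0 -> root p r -> root P r.
  move=> pps p0 pr; rewrite /root /P horner_prod prodf_seq_eq0.
  by apply/hasP; exists p => //; rewrite p0.
have inR r : (r \in rootsR P) = root P r.
  by rewrite -(roots_on_rootsR P0) in_itv.
have [r0|nr0] := boolP (root P x0).
  exists x0 => //; right; exists x0, x0; split; rewrite ?(rP _ r0)//; [exact: rP|exact: rP|].
  by constructor 1; field.
(* By the intermediate value theorem, no sign changes between two points that no root separates. *)
have key x : (forall r, root P r -> (Num.min x x0 <= r <= Num.max x x0) -> False) ->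
    {in ps, forall p, Num.sg p.[x] = Num.sg p.[x0]}.
  move=> h p pps; have [->|p0] := eqVneq p 0; first by rewrite !horner0.
  have [xx0|xx0] := leP x x0; first (apply: sgr_eq_noroot => //); last (symmetry; apply: sgr_eq_noroot; first exact: ltW).
    move=> r; rewrite in_itv /= => rI; apply/negP => /(Pr _ _ pps p0) /h; apply.
    by rewrite (min_idPl xx0) (max_idPr xx0).
  move=> r; rewrite in_itv /= => rI; apply/negP => /(Pr _ _ pps p0) /h; apply.
  by rewrite (min_idPr (ltW xx0)) (max_idPl (ltW xx0)).
pose L := [seq r <- rootsR P | r < x0].
pose G := [seq r <- rootsR P | r > x0].
have hL : L = [::] \/ exists2 l, (l \in L) & {in L, forall r, r <= l}.
  elim: L => [|a s [->|[l ls hl]]]; first by left.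
    by right; exists a; rewrite ?mem_head // => r; rewrite inE => /eqP ->.
  right; exists (Num.max a l).
    by rewrite inE; case: (leP a l) => _; rewrite ?ls ?eqxx ?orbT.
  move=> r; rewrite inE => /orP[/eqP->|/hl h]; first by rewrite le_max lexx.
  by rewrite le_max h orbT.
have hG : G = [::] \/ exists2 l, (l \in G) & {in G, forall r, l <= r}.
  elim: G => [|a s [->|[l ls hl]]]; first by left.
    by right; exists a; rewrite ?mem_head // => r; rewrite inE => /eqP ->.
  right; exists (Num.min a l).
    by rewrite inE; case: (leP a l) => _; rewrite ?ls ?eqxx ?orbT.
  move=> r; rewrite inE => /orP[/eqP->|/hl h]; first by rewrite ge_min lexx.
  by rewrite ge_min h orbT.
have dich r : root P r -> r \in L \/ r \in G.
  move=> rr; have [rx|rx|rx] := ltgtP r x0; [left|right|].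
  - by rewrite mem_filter rx inR.
  - by rewrite mem_filter rx inR.
  - by move: nr0; rewrite -rx rr.
(* With [l] the largest root below [x0] and [g] the smallest above it, the four cases are: no root
   at all, only [g], only [l], both. *)
case: hL => [L0|[l lL hl]]; case: hG => [G0|[g gG hg]].
- exists 0; first by left.
  by apply: key => r /dich[]; rewrite ?L0 ?G0.
- move: (gG); rewrite mem_filter inR => /andP[xg rg].
  exists (g - 1); first by right; exists g, g; split; [exact: rP|exact: rP|constructor 3].
  apply: key => r /dich[]; rewrite ?L0 // => /hg gr /andP[_].
  rewrite le_max => /orP[]; lra.
- move: (lL); rewrite mem_filter inR => /andP[xl rl].
  exists (l + 1); first by right; exists l, l; split; [exact: rP|exact: rP|constructor 2].
  apply: key => r /dich[]; rewrite ?G0 // => /hl lr /andP[+ _].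
  rewrite ge_min => /orP[]; lra.
- move: (lL); rewrite mem_filter inR => /andP[xl rl].
  move: (gG); rewrite mem_filter inR => /andP[xg rg].
  exists ((l + g) / 2); first by right; exists l, g; split; [exact: rP|exact: rP|constructor 1].
  apply: key => r /dich[/hl lr|/hg gr] /andP[].
    rewrite ge_min => /orP[] + _; lra.
  rewrite le_max => _ /orP[]; lra.
Qed.

End SignSelection.

(** * Terms and formulas of ordered rings *)

Module ord := ordered_qelim.ord.

HB.instance Definition _ (T : eqType) := hasDecEq.Build (GRing.term T) (@ord.term_eqP T).

Lemma set_nth_size (T : Type) (x0 y : T) (s : seq T) :
  set_nth x0 s (size s) y = rcons s y.
Proof. by elim: s => //= a l ->. Qed.

Section TermEval.
Variable R : realDomainType.
Implicit Types (t : GRing.term R) (f : ord.formula R).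

(** Evaluation in an arbitrary ring, so that one term can be read over the reals, over polynomials,
    over sequences and over the ultrapower. The value 0 at [GRing.Inv] is a default; [eval_tev]
    concerns only ring terms. *)
Fixpoint tev (A : comNzRingType) (h : R -> A) (e : nat -> A) t : A :=
  match t with
  | GRing.Var j => e j
  | GRing.Const c => h c
  | GRing.NatConst n => n%:R
  | GRing.Add t1 t2 => tev h e t1 + tev h e t2
  | GRing.Opp t1 => - tev h e t1
  | GRing.NatMul t1 n => tev h e t1 *+ n
  | GRing.Mul t1 t2 => tev h e t1 * tev h e t2
  | GRing.Inv _ => 0
  | GRing.Exp t1 n => tev h e t1 ^+ n
  end.

Lemma tev_morph (A B : comNzRingType) (g : {rmorphism A -> B}) h e t :
  g (tev h e t) = tev (g \o h) (g \o e) t.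
Proof.
elim: t => //= [n|t1 IH1 t2 IH2|t1 IH1|t1 IH1 n|t1 IH1 t2 IH2|t _|t1 IH1 n].
- exact: rmorph_nat.
- by rewrite rmorphD IH1 IH2.
- by rewrite rmorphN IH1.
- by rewrite rmorphMn IH1.
- by rewrite rmorphM IH1 IH2.
- exact: rmorph0.
- by rewrite rmorphXn IH1.
Qed.

Lemma eq_tev (A : comNzRingType) (h h' : R -> A) e e' t :
  h =1 h' -> e =1 e' -> tev h e t = tev h' e' t.
Proof. by move=> eh ee; elim: t => //= [t1 -> t2 ->|t1 ->|t1 ->|t1 -> t2 ->|t1 ->]. Qed.

(** The terms whose signs decide the truth of a quantifier-free formula. *)
Fixpoint ord_terms f : seq (GRing.term R) :=
  match f with
  | ord.Equal t1 t2 | ord.Lt t1 t2 | ord.Le t1 t2 => [:: GRing.Add t1 (GRing.Opp t2)]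
  | ord.And f1 f2 | ord.Or f1 f2 | ord.Implies f1 f2 => ord_terms f1 ++ ord_terms f2
  | ord.Not f1 => ord_terms f1
  | _ => [::]
  end.

Lemma qf_eval_sgr (e e' : seq R) f : ord.rformula f ->
  {in ord_terms f, forall t, Num.sg (GRing.eval e t) = Num.sg (GRing.eval e' t)} ->
  ord.qf_eval e f = ord.qf_eval e' f.
Proof.
elim: f => //=.
- move=> t1 t2 _ /(_ _ (mem_head _ _)) /= h.
  by rewrite -subr_eq0 -sgr_eq0 h sgr_eq0 subr_eq0.
- move=> t1 t2 _ /(_ _ (mem_head _ _)) /= h.
  by rewrite -subr_lt0 -sgr_lt0 h sgr_lt0 subr_lt0.
- move=> t1 t2 _ /(_ _ (mem_head _ _)) /= h.
  by rewrite -subr_le0 -sgr_le0 h sgr_le0 subr_le0.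
- by move=> f1 IH1 f2 IH2 /andP[r1 r2] h; rewrite IH1 ?IH2 // => t ht; apply: h; rewrite mem_cat ht ?orbT.
- by move=> f1 IH1 f2 IH2 /andP[r1 r2] h; rewrite IH1 ?IH2 // => t ht; apply: h; rewrite mem_cat ht ?orbT.
- by move=> f1 IH1 f2 IH2 /andP[r1 r2] h; rewrite IH1 ?IH2 // => t ht; apply: h; rewrite mem_cat ht ?orbT.
- by move=> f1 IH1 r1 h; rewrite IH1.
Qed.

Lemma rterm_ord_terms f t : ord.rformula f -> t \in ord_terms f -> GRing.rterm t.
Proof.
elim: f => //=.
- by move=> t1 t2 /andP[r1 r2]; rewrite inE => /eqP -> /=; rewrite r1 r2.
- by move=> t1 t2 /andP[r1 r2]; rewrite inE => /eqP -> /=; rewrite r1 r2.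
- by move=> t1 t2 /andP[r1 r2]; rewrite inE => /eqP -> /=; rewrite r1 r2.
- by move=> f1 IH1 f2 IH2 /andP[r1 r2]; rewrite mem_cat => /orP[/IH1|/IH2]; apply.
- by move=> f1 IH1 f2 IH2 /andP[r1 r2]; rewrite mem_cat => /orP[/IH1|/IH2]; apply.
- by move=> f1 IH1 f2 IH2 /andP[r1 r2]; rewrite mem_cat => /orP[/IH1|/IH2]; apply.
Qed.

Lemma eval_tev (e : seq R) t : GRing.rterm t -> GRing.eval e t = tev id (nth 0 e) t.
Proof.
elim: t => //=.
- by move=> t1 IH1 t2 IH2 /andP[/IH1 -> /IH2 ->].
- by move=> t1 IH1 /IH1 ->.
- by move=> t1 IH1 n /IH1 ->.
- by move=> t1 IH1 t2 IH2 /andP[/IH1 -> /IH2 ->].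
- by move=> t1 IH1 n /IH1 ->.
Qed.

(** The term as a univariate polynomial in its variable [i], the other variables being specialised
    to [e]. *)
Definition tpoly (A : comNzRingType) (h : R -> A) (e : nat -> A) (i : nat) t : {poly A} :=
  tev (fun c => (h c)%:P) (fun j => if j == i then 'X else (e j)%:P) t.

Lemma horner_tpoly (A : comNzRingType) (h : R -> A) (e : nat -> A) (i : nat) t x :
  (tpoly h e i t).[x] = tev h (fun j => if j == i then x else e j) t.
Proof.
rewrite -[LHS]/(horner_eval x _) tev_morph; apply: eq_tev => [c|j] /=.
  by rewrite /horner_eval hornerC.
by rewrite /horner_eval; case: ifP; rewrite ?hornerX ?hornerC.
Qed.

Lemma map_tpoly (A B : comNzRingType) (g : {rmorphism A -> B}) h e i t :
  map_poly g (tpoly h e i t) = tpoly (g \o h) (g \o e) i t.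
Proof.
rewrite /tpoly tev_morph; apply: eq_tev => [c|j] /=; first exact: map_polyC.
by case: ifP; rewrite ?map_polyX ?map_polyC.
Qed.

End TermEval.

Section Selection.
Variable R : realType.
Notation C := (CC R).
Notation K := (hyper R).
(** [M] will be the set of elements algebraic over C(eps); the selection argument uses its closure
    properties alone. *)
Variable M : K -> Prop.
Hypothesis Mconst : forall c, M (hconst c).
Hypothesis MD : forall x y, M x -> M y -> M (x + y).
Hypothesis MM : forall x y, M x -> M y -> M (x * y).
Hypothesis Mroot : forall (p : {poly K}) u, p != 0 -> root p u -> (forall i, M p`_i) -> M u.

Definition rseq (a : nat -> R) : nat -> C := fun k => ((a k)%:C)%C.
Definition rcls (a : nat -> R) : K := hcls (rseq a).

Definition ev_seq (k : nat) (s : nat -> C) : C := s k.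
Lemma ev_seq_zmod k : zmod_morphism (ev_seq k). Proof. by []. Qed.
HB.instance Definition _ k := GRing.isZmodMorphism.Build (nat -> C) C (ev_seq k) (ev_seq_zmod k).
Lemma ev_seq_monoid k : monoid_morphism (ev_seq k). Proof. by []. Qed.
HB.instance Definition _ k := GRing.isMonoidMorphism.Build (nat -> C) C (ev_seq k) (ev_seq_monoid k).

Lemma M_coef_tpoly (h : R -> K) (e : nat -> K) i t : (forall c, M (h c)) ->
  (forall j, M (e j)) -> forall j, M (tpoly h e i t)`_j.
Proof.
have M0 : M 0 by rewrite -(rmorph0 (@hconst R)); exact: Mconst.
have Mn n : M n%:R by rewrite -(rmorph_nat (@hconst R)); exact: Mconst.
have MC c : M c -> forall j, M (c%:P)`_j by move=> Mc j; rewrite coefC; case: ifP.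
have MS (F : nat -> K) n : (forall j, M (F j)) -> M (\sum_(j < n) F j).
  by move=> FM; elim/big_rec: _ => // j x _; exact: MD.
have MP (p q : {poly K}) : (forall j, M p`_j) -> (forall j, M q`_j) -> forall j, M (p * q)`_j.
  by move=> Mp Mq j; rewrite coefM; elim/big_rec: _ => // k x _; apply: MD; exact: MM.
move=> Mh Me; rewrite /tpoly; elim: t => /=.
- by move=> n j; case: ifP => // _; [rewrite coefX|exact: MC].
- by move=> c j; exact: MC.
- by move=> n; rewrite -polyC_natr; apply: MC.
- by move=> t1 IH1 t2 IH2 j; rewrite coefD; apply: MD.
- move=> t1 IH1 j; rewrite coefN -mulN1r; apply: MM => //.
  by rewrite -(rmorph1 (@hconst R)) -rmorphN; exact: Mconst.
- by move=> t1 IH1 n j; rewrite coefMn -mulr_natl; apply: MM.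
- by move=> t1 IH1 t2 IH2 j; apply: MP.
- by move=> t1 IH1 j; rewrite coef0.
- move=> t1 IH1 n; elim: n => [|n IH] j; last by rewrite exprS; apply: MP.
  by rewrite expr0 -polyC1; apply: MC; exact: (Mn 1%N).
Qed.

(** The polynomials for the various [k] come from one term, so they are the components of a single
    polynomial [PS] over the ring of sequences. Its class [PK] has coefficients in [M] and the class
    of [r] as a root. *)
Lemma M_root_class (e : nat -> nat -> R) (i : nat) t (r : nat -> R) :
  (forall j, M (rcls (e j))) ->
  freeU [set k | let p := tpoly id (e ^~ k) i t in p != 0 /\ root p (r k)] ->
  M (rcls r).
Proof.
move=> Me hU.
pose PS := tpoly (fun c => (fun _ : nat => (c%:C)%C : C)) (rseq \o e) i t.
pose PK := map_poly (@hcls R) PS.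
have PSk k : map_poly (ev_seq k) PS = map_poly (real_complex R) (tpoly id (e ^~ k) i t).
  by rewrite !map_tpoly; apply: eq_tev.
have PKE : PK = tpoly (fun c => hconst (c%:C)%C) (rcls \o e) i t.
  by rewrite /PK map_tpoly; apply: eq_tev.
apply: (@Mroot PK).
(* If [PK] were 0, each of the finitely many coefficients of [PS] would vanish almost everywhere,
   hence all of them at some [k] where the polynomial is nonzero. *)
- apply/eqP => PK0.
  have h j : freeU [set k | (PS`_j) k = 0].
    have : hcls PS`_j = 0 by rewrite -coef_map -/PK PK0 coef0.
    by rewrite -(rmorph0 (@hcls R)) => /hcls_eq.
  have hall n : freeU [set k | forall j, (j < n)%N -> (PS`_j) k = 0].
    elim: n => [|n IH]; first exact: filterS filterT.
    apply: filterS (filterI IH (h n)) => k /= [h1 h2] j.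
    by rewrite ltnS leq_eqVlt => /orP[/eqP->|/h1].
  apply: (@filter_not_empty _ freeU).
  apply: filterS (filterI (hall (size PS)) hU) => k /= [h1 [/eqP h2 _]].
  apply: h2; apply: (map_inj_poly (@complexI R)); first by rewrite rmorph0.
  rewrite -PSk rmorph0; apply/polyP => j; rewrite coef0 coef_map /=.
  have [jl|jl] := ltnP j (size PS); first exact: h1.
  by rewrite nth_default.
- apply/eqP; rewrite /PK /rcls horner_map -(rmorph0 (@hcls R)); apply/hcls_eq.
  apply: filterS hU => k /= [_ /eqP rk].
  have /= e1 := horner_map (ev_seq k) PS (rseq r).
  apply: etrans (esym e1) _; rewrite PSk.
  by rewrite -[ev_seq k _]/((real_complex R) (r k)) horner_map rk rmorph0.
- by rewrite PKE; apply: M_coef_tpoly => [c|j]; [exact: Mconst|exact: Me].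
Qed.

(** Pigeonhole for ultrafilters: it makes the choice of a polynomial from a finite list independent
    of [k]. *)
Lemma ultra_has (T : eqType) (s : seq T) (P : T -> nat -> Prop) :
  freeU [set k | exists2 t, t \in s & P t k] ->
  exists2 t, t \in s & freeU [set k | P t k].
Proof.
elim: s => [|t s IH] h.
  by case: (@filter_not_empty _ freeU); apply: filterS h => k [].
have : freeU ([set k | P t k] `|` [set k | exists2 t, t \in s & P t k]).
  apply: filterS h => k [u]; rewrite inE => /orP[/eqP->|us] Pu; first by left.
  by right; exists u.
case/freeU_or => [ht|/IH[u us hu]]; first by exists t; rewrite ?mem_head.
by exists u; rewrite // inE us orbT.
Qed.

Definition envf (s0 : nat -> R) (E : nat -> nat -> R) (j : nat) : nat -> R :=
  if j is j'.+1 then E j' else s0.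

Lemma qf_of_rformula (f : ord.formula R) : ord.rformula f ->
  exists2 q, ord.rformula q & forall e, ord.holds e f <-> ord.qf_eval e q.
Proof.
move=> rf.
have wf := @qe_rcf.wf_QE_wproj R; have valid := @qe_rcf.valid_QE_wproj R.
pose wp i bc := qe_rcf.qfr_to_formula (@qe_rcf.wproj R i bc).
exists (ord.quantifier_elim wp f).
  by have /andP[] := ord.quantifier_elim_wf wf rf.
by move=> e; apply: rwP; exact: ord.quantifier_elim_rformP.
Qed.

(* The chosen coordinates are, for almost all k, the sample points of
   [sgr_sample]; since only finitely many polynomials occur, the classes of
   these coordinates are roots of polynomials with coefficients in M. *)
Lemma algebraic_selection (m : nat) (f : ord.formula R) (s0 : nat -> R) :
  M (rcls s0) -> ord.rformula f ->
  (forall k, exists2 a : seq R, size a = m & ord.holds (s0 k :: a) f) ->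
  exists E : nat -> nat -> R, [/\ forall j, M (rcls (E j)),
    forall j, (m <= j)%N -> E j = (fun=> 0) &
    freeU [set k | ord.holds (s0 k :: mkseq (E ^~ k) m) f]].
Proof.
move=> Ms0.
have M0 : M (rcls (fun=> 0)).
  by rewrite (_ : rcls _ = hconst 0) //; exact: Mconst.
elim: m f => [|m IH] f rf hf.
  exists (fun _ _ => 0); split => //.
  by apply: filterS filterT => k _ /=; have [[]] := hf k.
(* The last unknown is quantified away; the induction hypothesis selects the others so that a value
   for it still exists. *)
have [|E [ME E0 hE]] := IH (ord.Exists m.+1 f) rf.
  move=> k; have [a sa ha] := hf k; exists (take m a).
    by rewrite size_take sa ltnSn.
  exists (nth 0 a m); move: ha; congr ord.holds => /=; congr (_ :: _).
  have sm : size (take m a) = m by rewrite size_take sa ltnSn.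
  by rewrite -[X in set_nth _ _ X _]sm set_nth_size -take_nth ?sa // take_oversize ?sa.
have [q rq qE] := qf_of_rformula rf.
pose e k := s0 k :: mkseq (E ^~ k) m.
pose ps k := [seq tpoly id (envf s0 E ^~ k) m.+1 t | t <- ord_terms q].
have evE k x t : t \in ord_terms q ->
    GRing.eval (set_nth 0 (e k) m.+1 x) t = (tpoly id (envf s0 E ^~ k) m.+1 t).[x].
  move=> tq; rewrite eval_tev ?(rterm_ord_terms rq tq) // horner_tpoly.
  apply: eq_tev => // j; rewrite nth_set_nth /=; case: eqP => // jm.
  (* Past the end of the list the environment reads 0, which agrees with [E j] because [E0] makes it
     zero from [m] on. *)
  case: j jm => //= j jm; have [jl|jl] := ltnP j m; first by rewrite nth_mkseq.
  by rewrite nth_default ?size_mkseq // E0.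
have ex k : exists x, ord.holds (e k) (ord.Exists m.+1 f) ->
    sample_point (ps k) x /\ ord.holds (set_nth 0 (e k) m.+1 x) f.
  have [[x0 hx0]|nh] := pselect (ord.holds (e k) (ord.Exists m.+1 f)); last by exists 0.
  have [x spx hx] := sgr_sample (ps k) x0; exists x => _; split => //.
  apply/qE; rewrite (qf_eval_sgr (e' := set_nth 0 (e k) m.+1 x0) rq); first exact/qE.
  by move=> t tq; rewrite !evE // hx //; apply: map_f.
have {ex} [x hx] := choice ex.
have envM j : M (rcls (envf s0 E j)) by case: j => /=.
have rootM (r : nat -> R) : freeU [set k | root_of (ps k) (r k)] -> M (rcls r).
  move=> hr; have [|t _] := @ultra_has _ (ord_terms q)
     (fun t k => let p := tpoly id (envf s0 E ^~ k) m.+1 t in p != 0 /\ root p (r k)).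
    by apply: filterS hr => k [_ /mapP[t tq ->] pr]; exists t.
  exact: M_root_class.
have rclsD a b : rcls (fun k => a k + b k) = rcls a + rcls b.
  by rewrite /rcls -rmorphD; congr hcls; apply/funext => k; rewrite /rseq rmorphD.
have rclsM a b : rcls (fun k => a k * b k) = rcls a * rcls b.
  by rewrite /rcls -rmorphM; congr hcls; apply/funext => k; rewrite /rseq rmorphM.
have rclsC c : M (rcls (fun=> c)) by exact: (Mconst (c%:C)%C).
have Mae a b : freeU [set k | a k = b k] -> M (rcls b) -> M (rcls a).
  move=> ab; rewrite (_ : rcls a = rcls b) //; apply/hcls_eq.
  by apply: filterS ab => k /= abk; rewrite /rseq abk.
have Mx : M (rcls x).
  have : freeU ([set k | x k = 0] `|` [set k | exists r : R * R, [/\ root_of (ps k) r.1, root_of (ps k) r.2 &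
    [\/ x k = (r.1 + r.2) / 2, x k = r.1 + 1 | x k = r.1 - 1]]]).
    apply: filterS hE => k hk; have [[h0|[r [r' h]]] _] := hx k hk; first by left.
    by right; exists (r, r').
  case/freeU_or => [h|h]; first exact: Mae h _.
  have [r hr] : exists r : nat -> R * R, freeU [set k | [/\ root_of (ps k) (r k).1, root_of (ps k) (r k).2 &
       [\/ x k = ((r k).1 + (r k).2) / 2, x k = (r k).1 + 1 | x k = (r k).1 - 1]]].
    have /choice[r hr] : forall k, exists r : R * R,
       (exists r : R * R, [/\ root_of (ps k) r.1, root_of (ps k) r.2 &
    [\/ x k = (r.1 + r.2) / 2, x k = r.1 + 1 | x k = r.1 - 1]]) -> [/\ root_of (ps k) r.1, root_of (ps k) r.2 &
    [\/ x k = (r.1 + r.2) / 2, x k = r.1 + 1 | x k = r.1 - 1]].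
      move=> k; have [[r hr]|nr] := pselect (exists r : R * R, [/\ root_of (ps k) r.1, root_of (ps k) r.2 &
    [\/ x k = (r.1 + r.2) / 2, x k = r.1 + 1 | x k = r.1 - 1]]); last by exists (0, 0).
      by exists r.
    by exists r; apply: filterS h => k /hr.
  have M1 : M (rcls (fun k => (r k).1)) by apply: rootM; apply: filterS hr => k [].
  have M2 : M (rcls (fun k => (r k).2)) by apply: rootM; apply: filterS hr => k [].
  (* One of the three shapes of a sample point holds almost everywhere, and each is a ring
     expression in elements of [M]. *)
  have : freeU ([set k | x k = ((r k).1 + (r k).2) * 2^-1] `|` ([set k | x k = (r k).1 + 1] `|` [set k | x k = (r k).1 + (-1)])).
    by apply: filterS hr => k [_ _ [h'|h'|h']]; [left|right; left|right; right].
  case/freeU_or => [h2|/freeU_or[h2|h2]]; apply: Mae h2 _.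
  - by rewrite rclsM rclsD; apply: MM => //; exact: MD.
  - by rewrite rclsD; apply: MD.
  - by rewrite rclsD; apply: MD.
exists (fun j => if j == m then x else E j); split.
- by move=> j; case: eqP.
- by move=> j mj; case: eqP => [jm|_]; [lia|apply: E0; lia].
- apply: filterS hE => k hk; have [_] := hx k hk.
  congr ord.holds; rewrite /= mkseqS eqxx; congr (_ :: _).
  have -> : mkseq (fun j => (if j == m then x else E j) k) m = mkseq (E ^~ k) m.
    by apply/eq_in_map => j; rewrite mem_iota => /andP[_ jm]; case: eqP => // jm'; lia.
  by rewrite -[X in set_nth _ _ X _](size_mkseq (E ^~ k) m) set_nth_size.
Qed.

End Selection.

(** * Linear forms and limits of polynomials *)

Section LinearForms.
Variables (A : comNzRingType) (n : nat).

Definition lform (c : 'I_n -> A) : {mpoly A[n]} := \sum_(j < n) c j *: 'X_j.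

Lemma lform_homog c : lform c \is 1.-homog.
Proof.
by apply: rpred_sum => j _; apply: dhomogZ; rewrite dhomogX /= mdeg1.
Qed.

Lemma mcoeff_lform c m :
  (lform c)@_m = \sum_(j < n) c j * (U_(j)%MM == m)%:R.
Proof. by rewrite /lform raddf_sum; apply: eq_bigr => j _; rewrite /= mcoeffZ mcoeffX. Qed.

Lemma mcoeff_lform1 c j : (lform c)@_U_(j) = c j.
Proof.
rewrite mcoeff_lform (bigD1 j) //= eqxx mulr1 big1 ?addr0 // => i ij.
by rewrite eq_mnm1 (negPf ij) mulr0.
Qed.

Lemma eq_lform c c' : c =1 c' -> lform c = lform c'.
Proof. by move=> e; apply: eq_bigr => j _; rewrite e. Qed.

Lemma lformD c c' : lform (fun j => c j + c' j) = lform c + lform c'.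
Proof. by rewrite /lform -big_split; apply: eq_bigr => j _; rewrite scalerDl. Qed.

Lemma lformZ a c : lform (fun j => a * c j) = a *: lform c.
Proof. by rewrite /lform scaler_sumr; apply: eq_bigr => j _; rewrite scalerA. Qed.

Definition psum (d r : nat) (Z : 'M[A]_(r, n)) : {mpoly A[n]} :=
  \sum_(i < r) (lform (Z i)) ^+ d.

Lemma psum_homog d r (Z : 'M[A]_(r, n)) : psum d Z \is d.-homog.
Proof.
apply: rpred_sum => i _; have := dhomogMn d (lform_homog (Z i)).
by rewrite mul1n.
Qed.

End LinearForms.

Lemma map_lform (A B : comNzRingType) (g : {rmorphism A -> B}) n (c : 'I_n -> A) :
  map_mpoly g (lform c) = lform (g \o c).
Proof.
by rewrite /lform raddf_sum; apply: eq_bigr => j _; rewrite /= map_mpolyZ map_mpolyX.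
Qed.

Lemma map_psum (A B : comNzRingType) (g : {rmorphism A -> B}) n d r (Z : 'M[A]_(r, n)) :
  map_mpoly g (psum d Z) = psum d (map_mx g Z).
Proof.
rewrite /psum raddf_sum; apply: eq_bigr => i _; rewrite /= rmorphXn /= map_lform.
by congr (_ ^+ _); apply: eq_lform => j /=; rewrite mxE.
Qed.

Section Place.
Variables (C K : fieldType) (iota : {rmorphism C -> K}) (lim : K -> C -> Prop).
Hypothesis plc : is_place iota lim.

Let lc := place_const plc.
Let lD := placeD plc.
Let lM := placeM plc.

Lemma place0 : lim 0 0. Proof. by have := lc 0; rewrite rmorph0. Qed.
Lemma place1 : lim 1 1. Proof. by have := lc 1; rewrite rmorph1. Qed.
Lemma placeN x a : lim x a -> lim (- x) (- a).
Proof.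
move=> h; have := lM (lc (-1)) h; rewrite rmorphN rmorph1 !mulN1r; exact.
Qed.
Lemma placeB x y a b : lim x a -> lim y b -> lim (x - y) (a - b).
Proof. by move=> h1 h2; apply: lD => //; apply: placeN. Qed.
Lemma placeX x a k : lim x a -> lim (x ^+ k) (a ^+ k).
Proof.
move=> h; elim: k => [|k IH]; first by rewrite !expr0; exact: place1.
by rewrite !exprS; apply: lM.
Qed.
Lemma place_sum I (r : seq I) (P : pred I) F G :
  (forall i, P i -> lim (F i) (G i)) ->
  lim (\sum_(i <- r | P i) F i) (\sum_(i <- r | P i) G i).
Proof.
move=> h; elim: r => [|i r IH]; first by rewrite !big_nil; exact: place0.
by rewrite !big_cons; case: ifP => // Pi; apply: lD => //; exact: h.
Qed.
Lemma place_inv x a : a != 0 -> lim x a -> lim x^-1 a^-1.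
Proof.
move=> a0 xa; have x0 : x != 0.
  by apply/eqP => x0; move: a0; rewrite (place_uniq plc xa (b := 0)) ?eqxx // x0; exact: place0.
have [[c xc]|h] := place_dich plc x^-1.
  suff -> : a^-1 = c by [].
  have := place_uniq plc (lM xa xc) (b := 1); rewrite divff // => /(_ place1) h.
  by apply: (mulfI a0); rewrite divff.
move: h; rewrite invrK => h.
by move: a0; rewrite (place_uniq plc xa h) eqxx.
Qed.

Lemma place_finite_div x y : (exists c, lim (x / y) c) \/ (exists c, lim (y / x) c).
Proof.
have [[c h]|h] := place_dich plc (x / y); first by left; exists c.
by right; exists 0; move: h; rewrite invf_div.
Qed.

Variable n : nat.
Definition mlim (P : {mpoly K[n]}) (f : {mpoly C[n]}) := forall m, lim P@_m f@_m.

Lemma mlim_uniq P f g : mlim P f -> mlim P g -> f = g.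
Proof. by move=> h1 h2; apply/mpolyP => m; move: (h1 m) (h2 m); apply: (place_uniq plc). Qed.
Lemma mlim_sum I (r : seq I) (Q : pred I) F G :
  (forall i, Q i -> mlim (F i) (G i)) ->
  mlim (\sum_(i <- r | Q i) F i) (\sum_(i <- r | Q i) G i).
Proof. by move=> h m; rewrite !raddf_sum; apply: place_sum => i /h; exact. Qed.
Lemma mlimD P Q f g : mlim P f -> mlim Q g -> mlim (P + Q) (f + g).
Proof. by move=> h1 h2 m; rewrite !mcoeffD; apply: lD. Qed.
Lemma mlimN P f : mlim P f -> mlim (- P) (- f).
Proof. by move=> h1 m; rewrite !mcoeffN; apply: placeN. Qed.
Lemma mlimB P Q f g : mlim P f -> mlim Q g -> mlim (P - Q) (f - g).
Proof. by move=> h1 h2; apply: mlimD => //; apply: mlimN. Qed.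
Lemma mlimM P Q f g : mlim P f -> mlim Q g -> mlim (P * Q) (f * g).
Proof. by move=> h1 h2 m; rewrite !mcoeffM; apply: place_sum => k _; apply: lM. Qed.
Lemma mlimZ a c P f : lim a c -> mlim P f -> mlim (a *: P) (c *: f).
Proof. by move=> h1 h2 m; rewrite !mcoeffZ; apply: lM. Qed.
Lemma mlimC a c : lim a c -> mlim a%:MP c%:MP.
Proof.
by move=> h m; rewrite !mcoeffC; apply: lM => //; case: eqP => _; [exact: place1|exact: place0].
Qed.
Lemma mlim1 : mlim 1 1. Proof. by rewrite -!mpolyC1; exact: mlimC place1. Qed.
Lemma mlim0 : mlim 0 0. Proof. by rewrite -!mpolyC0; exact: mlimC place0. Qed.
Lemma mlimXn P f k : mlim P f -> mlim (P ^+ k) (f ^+ k).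
Proof.
move=> h; elim: k => [|k IH]; first by rewrite !expr0; exact: mlim1.
by rewrite !exprS; apply: mlimM.
Qed.
Lemma mlim_prod I (r : seq I) (Q : pred I) F G :
  (forall i, Q i -> mlim (F i) (G i)) ->
  mlim (\prod_(i <- r | Q i) F i) (\prod_(i <- r | Q i) G i).
Proof.
move=> h; elim: r => [|i r IH]; first by rewrite !big_nil; exact: mlim1.
by rewrite !big_cons; case: ifP => // Qi; apply: mlimM => //; exact: h.
Qed.
Lemma mlim_lform c c' : (forall j, lim (c j) (c' j)) -> mlim (lform c) (lform c').
Proof.
move=> h; apply: mlim_sum => j _; apply: mlimZ => // m; rewrite !mcoeffX.
by case: eqP => _; [exact: place1|exact: place0].
Qed.
End Place.

(** * Selection for sums of powers *)

Section Definable.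
Variable R : realType.
Notation C := (CC R).

(** Definability through closure properties spares writing out the formula that expresses closeness
    of a power sum to [f]. *)
Definition rdef (g : seq R -> R) :=
  exists2 t, GRing.rterm t & forall e, GRing.eval e t = g e.

Lemma rdef_const c : rdef (fun=> c).
Proof. by exists (GRing.Const c). Qed.
Lemma rdef_var j : rdef (fun e => e`_j).
Proof. by exists (GRing.Var _ j). Qed.
Lemma rdefD g h : rdef g -> rdef h -> rdef (fun e => g e + h e).
Proof.
move=> [t rt tE] [u ru uE]; exists (GRing.Add t u); first by rewrite /= rt ru.
by move=> e /=; rewrite tE uE.
Qed.
Lemma rdefN g : rdef g -> rdef (fun e => - g e).
Proof.
by move=> [t rt tE]; exists (GRing.Opp t) => // e /=; rewrite tE.
Qed.
Lemma rdefM g h : rdef g -> rdef h -> rdef (fun e => g e * h e).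
Proof.
move=> [t rt tE] [u ru uE]; exists (GRing.Mul t u); first by rewrite /= rt ru.
by move=> e /=; rewrite tE uE.
Qed.

Definition cdef (g : seq R -> C) :=
  rdef (fun e => complex.Re (g e)) /\ rdef (fun e => complex.Im (g e)).

Lemma ReD (x y : C) : complex.Re (x + y) = complex.Re x + complex.Re y.
Proof. by case: x; case: y. Qed.
Lemma ImD (x y : C) : complex.Im (x + y) = complex.Im x + complex.Im y.
Proof. by case: x; case: y. Qed.
Lemma ReM (x y : C) : complex.Re (x * y) =
  complex.Re x * complex.Re y - complex.Im x * complex.Im y.
Proof. by case: x; case: y. Qed.
Lemma ImM (x y : C) : complex.Im (x * y) =
  complex.Re x * complex.Im y + complex.Im x * complex.Re y.
Proof. by case: x; case: y. Qed.

Lemma eq_rdef g h : g =1 h -> rdef g -> rdef h.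
Proof. by move=> gh [t rt tE]; exists t => // e; rewrite tE gh. Qed.

Lemma cdef_const c : cdef (fun=> c).
Proof. by split; exact: rdef_const. Qed.
Lemma cdefD g h : cdef g -> cdef h -> cdef (fun e => g e + h e).
Proof.
move=> [g1 g2] [h1 h2]; split.
  by apply: eq_rdef (rdefD g1 h1) => e; rewrite ReD.
by apply: eq_rdef (rdefD g2 h2) => e; rewrite ImD.
Qed.
Lemma cdefM g h : cdef g -> cdef h -> cdef (fun e => g e * h e).
Proof.
move=> [g1 g2] [h1 h2]; split.
  by apply: eq_rdef (rdefD (rdefM g1 h1) (rdefN (rdefM g2 h2))) => e; rewrite ReM.
by apply: eq_rdef (rdefD (rdefM g1 h2) (rdefM g2 h1)) => e; rewrite ImM.
Qed.
Lemma eq_cdef g h : g =1 h -> cdef g -> cdef h.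
Proof. by move=> gh [h1 h2]; split; [apply: eq_rdef h1|apply: eq_rdef h2] => e; rewrite gh. Qed.
Lemma cdef_sum I (r : seq I) (P : pred I) (F : I -> seq R -> C) :
  (forall i, cdef (F i)) -> cdef (fun e => \sum_(i <- r | P i) F i e).
Proof.
move=> h; elim: r => [|i r IH].
  by apply: eq_cdef (cdef_const 0) => e; rewrite big_nil.
case Pi : (P i).
  by apply: eq_cdef (cdefD (h i) IH) => e; rewrite big_cons Pi.
by apply: eq_cdef IH => e; rewrite big_cons Pi.
Qed.

Variable n : nat.
Definition pdef (P : seq R -> {mpoly C[n]}) := forall m, cdef (fun e => (P e)@_m).

Lemma pdef_const p : pdef (fun=> p).
Proof. by move=> m; exact: cdef_const. Qed.
Lemma pdefM P Q : pdef P -> pdef Q -> pdef (fun e => P e * Q e).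
Proof.
move=> hP hQ m; apply: eq_cdef => [e|]; first by rewrite mcoeffM.
by apply: cdef_sum => k; apply: cdefM.
Qed.
Lemma pdefX P k : pdef P -> pdef (fun e => P e ^+ k).
Proof.
move=> hP; elim: k => [|k IH] m.
  by apply: eq_cdef (pdef_const 1 m) => e; rewrite expr0.
by apply: eq_cdef (pdefM hP IH m) => e; rewrite exprS.
Qed.
Lemma pdef_sum I (r : seq I) (F : I -> seq R -> {mpoly C[n]}) :
  (forall i, pdef (F i)) -> pdef (fun e => \sum_(i <- r) F i e).
Proof.
move=> h m; apply: eq_cdef => [e|]; first by rewrite raddf_sum.
by apply: cdef_sum => i; apply: h.
Qed.
Lemma pdef_lform (c : 'I_n -> seq R -> C) :
  (forall j, cdef (c j)) -> pdef (fun e => lform (c ^~ e)).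
Proof.
move=> h m; apply: eq_cdef => [e|]; first by rewrite mcoeff_lform.
by apply: cdef_sum => j; apply: cdefM => //; exact: cdef_const.
Qed.

Definition fdef (Q : seq R -> Prop) :=
  exists2 f, ord.rformula f & forall e, ord.holds e f <-> Q e.

Lemma fdef_lt g h : rdef g -> rdef h -> fdef (fun e => g e < h e).
Proof.
move=> [t rt tE] [u ru uE]; exists (ord.Lt t u); first by rewrite /= rt ru.
by move=> e /=; rewrite tE uE.
Qed.

Lemma fdef_all (T : eqType) (s : seq T) (Q : T -> seq R -> Prop) :
  (forall i, fdef (Q i)) -> fdef (fun e => {in s, forall i, Q i e}).
Proof.
move=> h; elim: s => [|i s [f rf fE]]; first by exists (ord.Bool true).
have [g rg gE] := h i; exists (ord.And g f); first by rewrite /= rg rf.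
move=> e /=; rewrite fE gE; split => [[h1 h2] j|h1].
  by rewrite inE => /orP[/eqP->|/h2].
by split => [|j js]; apply: h1; rewrite inE ?eqxx // js orbT.
Qed.

End Definable.

Section PowerSumSelection.
Variable R : realType.
Notation C := (CC R).
Notation K := (hyper R).
Variable M : K -> Prop.
Hypothesis Mconst : forall c, M (hconst c).
Hypothesis MD : forall x y, M x -> M y -> M (x + y).
Hypothesis MM : forall x y, M x -> M y -> M (x * y).
Hypothesis Mroot : forall (p : {poly K}) u, p != 0 -> root p u -> (forall i, M p`_i) -> M u.

Definition inv_seq (k : nat) : R := k.+1%:R^-1.
Hypothesis Meps : M (rcls inv_seq).

(** The squared modulus is polynomial in the real and imaginary parts, so closeness becomes a
    formula of ordered rings. *)
Definition nsq (z : C) : R := complex.Re z ^+ 2 + complex.Im z ^+ 2.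

Lemma nsqE (z : C) : ((nsq z)%:C)%C = `|z| ^+ 2.
Proof. exact: add_Re2_Im2. Qed.

Lemma nsq_lt (c z : C) (e : R) : 0 < e -> `|c - z| < ((Num.min e 1)%:C)%C -> nsq (z - c) < e.
Proof.
move=> e0 hk; have k1 : `|c - z| <= 1.
  by apply: le_trans (ltW hk) _; rewrite -(rmorph1 (real_complex R)) lecR ge_min lexx orbT.
rewrite -ltcR nsqE distrC; apply: le_lt_trans (_ : `|c - z| < _).
  by rewrite ler_iXnr ?normr_ge0 ?k1.
by apply: lt_le_trans hk _; rewrite lecR ge_min lexx.
Qed.

Lemma hlim_nsq (s : nat -> C) c (e : R) : hlim (hcls s) c -> 0 < e ->
  freeU [set k | nsq (s k - c) < e].
Proof.
move=> /hlimE/cvgrPdist_lt h e0.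
have := h (((Num.min e 1)%:C)%C : C).
rewrite ltcR lt_min e0 ltr01 => /(_ isT); apply: filterS => k /=.
exact: nsq_lt.
Qed.

Lemma nsq_hlim (s : nat -> C) c :
  freeU [set k | nsq (s k - c) < inv_seq k] -> hlim (hcls s) c.
Proof.
move=> h; apply/hlimE/cvgrPdist_lt => e e0.
move: (e0); rewrite ltcE => /andP[/eqP ie re].
have -> : e = ((complex.Re e)%:C)%C by rewrite [LHS]complexE ie mulr0 addr0.
have e2 : 0 < complex.Re e ^+ 2 by rewrite exprn_gt0.
have := freeU_oo (near_infty_natSinv_lt (interval_inference.PosNum e2)).
move=> h2; apply: filterS (filterI h h2) => k /= [h3 h4].
rewrite -(ltr_pXn2r (n := 2)) ?nnegrE ?normr_ge0 //; last by rewrite lecE /= eqxx ltW.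
by rewrite distrC -nsqE -rmorphXn ltcR; apply: lt_trans h4.
Qed.

Lemma hcls_map_psum d r n (s : 'I_r -> 'I_n -> nat -> C) m :
  (psum d (\matrix_(i < r, j < n) hcls (s i j)))@_m =
  hcls (fun k => (psum d (\matrix_(i < r, j < n) s i j k))@_m).
Proof.
pose ZS : 'M[(nat -> C)]_(r, n) := \matrix_(i, j) s i j.
have -> : \matrix_(i < r, j < n) hcls (s i j) = map_mx (@hcls R) ZS.
  by apply/matrixP => i j; rewrite !mxE.
rewrite -map_psum mcoeff_map_mpoly; congr hcls; apply/funext => k.
rewrite -[LHS]/(ev_seq k _) -mcoeff_map_mpoly map_psum.
by congr ((psum _ _)@__); apply/matrixP => i j; rewrite !mxE.
Qed.

(* Near-decompositions with error < 1/(k+1) form a definable family in k, so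
   its members can be chosen with coordinates algebraic over C(1/(k+1)). *)
Lemma power_sum_selection d r n (f : {mpoly C[n]}) (Z : 'M[K]_(r, n)) :
  mlim (@hlim R) (psum d Z) f ->
  exists2 Z' : 'M[K]_(r, n), forall i j, M (Z' i j) & mlim (@hlim R) (psum d Z') f.
Proof.
move=> Zf.
have /choice[s sE] : forall ij : 'I_r * 'I_n, exists s, hcls s = Z ij.1 ij.2.
  by move=> ij; exact: hcls_surj.
have ZE : Z = \matrix_(i < r, j < n) hcls (s (i, j)).
  by apply/matrixP => i j; rewrite !mxE sE.
(* A finite list containing every multi-index of degree [d]; the coefficients of [f] and of power
   sums vanish in all other degrees, so finitely many conditions suffice. *)
pose ms := [seq val m | m <- enum {: 'X_{1..n < d.+1}}].
have msP m : mdeg m = d -> m \in ms.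
  move=> md; have mlt : (mdeg m < d.+1)%N by rewrite md.
  by apply/mapP; exists (BMultinom mlt); rewrite ?mem_enum.
have fhom m : mdeg m != d -> f@_m = 0.
  move=> md; apply: (place_uniq (hlim_place R) (Zf m)).
  by rewrite (dhomog_nemf_coeff (psum_homog d Z)) //; exact: place0 (hlim_place R).
(* Some component of a sequence representing [Z] is an honest complex matrix of the required
   accuracy. *)
have approx (k0 : nat) : exists Z0 : 'M[C]_(r, n),
    {in ms, forall m, nsq ((psum d Z0)@_m - f@_m) < inv_seq k0}.
  have k0p : 0 < inv_seq k0 by rewrite invr_gt0 ltr0n.
  have h : freeU [set k | {in ms, forall m,
      nsq ((psum d (\matrix_(i < r, j < n) s (i, j) k))@_m - f@_m) < inv_seq k0}].
    elim: ms {msP} => [|m l IH]; first by apply: filterS filterT.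
    have := Zf m; rewrite ZE (hcls_map_psum d (fun i j => s (i, j))) => /hlim_nsq/(_ k0p) hm.
    apply: filterS (filterI hm IH) => k /= [h1 h2] m'.
    by rewrite inE => /orP[/eqP->|/h2].
  have /filter_ex[k hk] := h; by exists (\matrix_(i, j) s (i, j) k).
pose ix := enum {: 'I_r * 'I_n}.
pose N := size ix.
(* Layout of the environment: slot 0 holds the error bound, then come [N] real parts, then [N]
   imaginary parts. *)
pose Zof (e : seq R) : 'M[C]_(r, n) := \matrix_(i < r, j < n)
   (e`_(index (i, j) ix).+1 +i* e`_(N + index (i, j) ix)%N.+1)%C.
pose Q m (e : seq R) := nsq ((psum d (Zof e))@_m - f@_m) < e`_0.
have Qdef m : fdef (Q m).
  have hc : cdef (fun e => (psum d (Zof e))@_m - f@_m).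
    apply: cdefD; last exact: cdef_const.
    apply: pdef_sum => i; apply: pdefX.
    have := @pdef_lform R n (fun j e => Zof e i j); apply => j.
    by split; apply: eq_rdef (rdef_var _ _) => e; rewrite mxE.
  apply: fdef_lt (rdef_var _ 0); case: hc => h1 h2.
  by apply: eq_rdef (rdefD (rdefM h1 h1) (rdefM h2 h2)) => e; rewrite /nsq !expr2.
have [phi rphi phiE] := fdef_all ms Qdef.
have [|E [ME _ hE]] := algebraic_selection Mconst MD MM Mroot (m := (N + N)%N) Meps rphi.
  move=> k; have [Z0 hZ0] := approx k.
  exists ([seq complex.Re (Z0 p.1 p.2) | p <- ix] ++ [seq complex.Im (Z0 p.1 p.2) | p <- ix]).
    by rewrite size_cat !(size_map _ ix).
  apply/phiE => m /hZ0; rewrite /Q; set e := _ :: _.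
  rewrite (_ : Zof e = Z0) //; apply/matrixP => i j; rewrite mxE /=.
  have il : (index (i, j) ix < N)%N by rewrite index_mem mem_enum.
  rewrite !nth_cat !(size_map _ ix) -/N il ltnNge leq_addr /= addKn.
  rewrite !(@nth_map _ (i, j) _ 0 _ _ ix il) (@nth_index _ (i, j) _ ix) ?mem_enum //=.
  by case: (Z0 i j).
pose Z1 (i : 'I_r) (j : 'I_n) (k : nat) : C :=
  ((E (index (i, j) ix) k) +i* (E (N + index (i, j) ix)%N k))%C.
have il i j : (index (i, j) ix < N)%N by rewrite index_mem mem_enum.
exists (\matrix_(i < r, j < n) hcls (Z1 i j)).
  move=> i j; rewrite mxE.
  rewrite (_ : hcls _ = rcls (E (index (i, j) ix)) + hconst 'i%C * rcls (E (N + index (i, j) ix)%N)).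
    by apply: MD => //; apply: MM => //; exact: Mconst.
  rewrite /rcls /hconst -rmorphM -rmorphD; congr hcls; apply/funext => k.
  by rewrite seqDE seqME /rseq [LHS]complexE.
move=> m; rewrite (hcls_map_psum d Z1).
have [md|md] := eqVneq (mdeg m) d.
  apply: nsq_hlim; apply: filterS hE => k /= /phiE /(_ m (msP m md)).
  rewrite /Q /=; set e := _ :: _; rewrite (_ : Zof e = \matrix_(i, j) Z1 i j k) //.
  apply/matrixP => i j; rewrite !mxE /= !nth_mkseq ?ltn_add2l ?il //.
  by rewrite ltn_addr.
rewrite fhom //; apply/hlimE.
rewrite (_ : (fun k => _) = fun=> 0); first exact: cvg_cst.
by apply/funext => k; rewrite (dhomog_nemf_coeff (psum_homog d _)).
Qed.

End PowerSumSelection.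

(** * Algebraic functions and Laurent curves *)

Section FractionExtension.
Variables (A : idomainType) (K : fieldType) (g : {rmorphism A -> K}).
Hypothesis ginj : injective g.
Local Notation "x %:F" := (@FracField.tofrac A x).

Lemma frac_reprE (x : {fraction A}) : x = (\n_(repr x))%:F / (\d_(repr x))%:F.
Proof.
apply: (canRL (mulfK _)); first by rewrite tofrac_eq0 denom_ratioP.
rewrite -{1}[x]reprK; unlock FracField.tofrac.
rewrite -[LHS]FracField.pi_mul; apply/eqmodP; rewrite /= FracField.equivfE.
rewrite /FracField.mulf !numden_Ratio ?mulr1 ?oner_eq0 ?denom_ratioP //.
by rewrite mulrC.
Qed.

Definition frac_ext (x : {fraction A}) : K := g (\n_(repr x)) / g (\d_(repr x)).

Lemma g_neq0 a : a != 0 -> g a != 0.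
Proof. by move=> a0; rewrite -(rmorph0 g) (inj_eq ginj). Qed.

Lemma frac_extE (a b : A) : b != 0 -> frac_ext (a%:F / b%:F) = g a / g b.
Proof.
move=> b0; set x := _ / _; have /esym/eqP := frac_reprE x.
have d0 := denom_ratioP (repr x).
rewrite /x eqr_div ?tofrac_eq0 // -!rmorphM tofrac_eq => /eqP h.
by apply/eqP; rewrite /frac_ext eqr_div ?g_neq0 // -!rmorphM h.
Qed.

Lemma frac_ext_zmod : zmod_morphism frac_ext.
Proof.
move=> x y; rewrite (frac_reprE x) (frac_reprE y).
move: (denom_ratioP (repr x)) (denom_ratioP (repr y)).
move: (\n_(repr x)) (\d_(repr x)) (\n_(repr y)) (\d_(repr y)) => a b c d b0 d0.
rewrite !frac_extE // -mulNr addf_div ?tofrac_eq0 //.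
rewrite -!(rmorphM, rmorphN, rmorphD) /= frac_extE ?mulf_neq0 //.
by rewrite -mulNr addf_div ?g_neq0 // !(rmorphM, rmorphN, rmorphD).
Qed.
HB.instance Definition _ := GRing.isZmodMorphism.Build {fraction A} K frac_ext frac_ext_zmod.

Lemma frac_ext_monoid : monoid_morphism frac_ext.
Proof.
split.
  by rewrite -[1](divff (oner_neq0 _)) -(rmorph1 (@FracField.tofrac A)) frac_extE ?oner_neq0 // rmorph1 divff // oner_neq0.
move=> x y; rewrite (frac_reprE x) (frac_reprE y).
move: (denom_ratioP (repr x)) (denom_ratioP (repr y)).
move: (\n_(repr x)) (\d_(repr x)) (\n_(repr y)) (\d_(repr y)) => a b c d b0 d0.
rewrite mulf_div -!rmorphM !frac_extE ?mulf_neq0 // mulf_div.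
by rewrite !rmorphM.
Qed.
HB.instance Definition _ := GRing.isMonoidMorphism.Build {fraction A} K frac_ext frac_ext_monoid.

Lemma frac_ext_tofrac a : frac_ext a%:F = g a.
Proof.
rewrite -[a%:F]divr1 -(rmorph1 (@FracField.tofrac A)) frac_extE ?oner_neq0 //.
by rewrite rmorph1 divr1.
Qed.

End FractionExtension.

(** * Primitive elements and degree bounds *)

Section Primitive.
Variables (F K : fieldType) (phi : {rmorphism F -> K}).
Hypothesis char0 : [pchar F] =i pred0.

Definition in_gen (theta z : K) := exists p : {poly F}, z = (map_poly phi p).[theta].

Lemma in_gen_comp t z p : in_gen t z -> exists q : {poly F}, (map_poly phi p).[z] = (map_poly phi q).[t].
Proof.
by move=> [r ->]; exists (p \Po r); rewrite map_comp_poly horner_comp.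
Qed.

Lemma primitive_element (zs : seq K) :
  (forall z, z \in zs -> algebraicOver phi z) ->
  exists2 t, algebraicOver phi t & forall z, z \in zs -> in_gen t z.
Proof.
elim: zs => [_|z zs IH h]; first by exists 0 => //; exact: algebraic0.
have [|t [q q0 qt] ht] := IH; first by move=> u us; apply: h; rewrite inE us orbT.
have [p p0 pz] := h z (mem_head _ _).
have [n [hz ht']] := pchar0_PET p0 pz q0 qt char0.
exists (t *+ n - z).
  apply: algebraic_sub; last by exists p.
  by rewrite -mulr_natl -(rmorph_nat phi); apply: algebraic_mul; [exact: algebraic_id|exists q].
move=> u; rewrite inE => /orP[/eqP->|us].
  by case: hz => r rE; exists r; rewrite rE.
have [r ->] := ht u us; case: ht' => s ts.
by apply: in_gen_comp; exists s.
Qed.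

(** If z = p(t), then p of the companion matrix of [q] has z as an eigenvalue, on the eigenvector of
    t. Its characteristic polynomial gives a degree bound valid for all of F[t] at once. *)
Lemma in_gen_charpoly t (q : {poly F}) z : q \is monic -> root (map_poly phi q) t ->
  in_gen t z -> exists chi : {poly F}, [/\ chi \is monic, size chi = size q & root (map_poly phi chi) z].
Proof.
move=> mq qt [p ->].
pose A := companionmx q.
have sq : (size q).-1.+1 = size q by rewrite prednK // size_poly_gt0 monic_neq0.
have sq1 : (1 < size q)%N.
  rewrite ltnNge; apply/negP => /size1_polyC qc; move: qt mq; rewrite qc.
  rewrite map_polyC rootC fmorph_eq0 => /eqP ->.
  by rewrite monicE lead_coefC eq_sym oner_eq0.
have : root (char_poly (map_mx phi A)) t.
  by rewrite -map_char_poly companionmxK.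
rewrite -eigenvalue_root_char => /eigenvalueP[v vA v0].
have [B vB] : exists B, v *m map_mx phi B = (map_poly phi p).[t] *: v.
  elim/poly_ind: p => [|p c [B vB]].
    by exists 0; rewrite map_mx0 mulmx0 rmorph0 horner0 scale0r.
  exists (B *m A + c%:M); rewrite map_mxD map_mxM mulmxDr mulmxA vB -scalemxAl vA.
  rewrite map_scalar_mx mul_mx_scalar rmorphD rmorphM /= map_polyX map_polyC.
  by rewrite hornerD hornerMX hornerC scalerA -scalerDl.
exists (char_poly B); split.
- exact: char_poly_monic.
- by rewrite size_char_poly.
- by rewrite map_char_poly -eigenvalue_root_char; apply/eigenvalueP; exists v.
Qed.

End Primitive.

Section PlaceUnits.
Variables (C K : fieldType) (iota : {rmorphism C -> K}) (lim : K -> C -> Prop).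
Hypothesis plc : is_place iota lim.

Definition finp (x : K) := exists c, lim x c.
Definition unitp (x : K) := exists2 c, c != 0 & lim x c.

Lemma unitp_fin x : unitp x -> finp x. Proof. by case=> c _ h; exists c. Qed.
Lemma unitp_neq0 x : unitp x -> x != 0.
Proof.
case=> c c0 h; apply/eqP => x0; move: c0.
by rewrite (place_uniq plc h (b := 0)) ?eqxx // x0; exact: place0 plc.
Qed.
Lemma unitp1 : unitp 1. Proof. by exists 1; [exact: oner_neq0|exact: place1 plc]. Qed.
Lemma unitpM x y : unitp x -> unitp y -> unitp (x * y).
Proof.
move=> [a a0 xa] [b b0 yb]; exists (a * b); first exact: mulf_neq0.
exact: placeM plc _ _ _ _ xa yb.
Qed.
Lemma unitpV x : unitp x -> unitp x^-1.
Proof. by move=> [a a0 xa]; exists a^-1; [rewrite invr_eq0|exact: place_inv plc _ _ a0 xa]. Qed.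
Lemma unitpX x k : unitp x -> unitp (x ^+ k).
Proof. by move=> h; elim: k => [|k IH]; rewrite ?expr0 ?exprS; [exact: unitp1|exact: unitpM]. Qed.
Lemma unitpXz x (k : int) : unitp x -> unitp (x ^ k).
Proof. by case: k => k h; [exact: unitpX|exact/unitpV/unitpX]. Qed.
Lemma finpM x y : finp x -> finp y -> finp (x * y).
Proof. by move=> [a xa] [b yb]; exists (a * b); exact: placeM plc _ _ _ _ xa yb. Qed.
Lemma finpX x k : finp x -> finp (x ^+ k).
Proof. by move=> [a h]; exists (a ^+ k); exact: placeX plc _ _ _ h. Qed.

Lemma place_expr_eq0 x k : (0 < k)%N -> lim (x ^+ k) 0 -> lim x 0.
Proof.
move=> k0 h; have [[c xc]|xV] := place_dich plc x.
  have := place_uniq plc (placeX plc k xc) h => /eqP.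
  by rewrite expf_eq0 k0 => /eqP c0; rewrite -c0.
have := placeM plc (placeX plc k xV) h; rewrite mulr0.
have [->|x0] := eqVneq x 0; first by move=> _; exact: place0 plc.
rewrite -exprMn mulVf // expr1n => h1.
by have := place_uniq plc h1 (place1 plc) => /eqP; rewrite eq_sym oner_eq0.
Qed.

Lemma unitp_root x k : (0 < k)%N -> unitp (x ^+ k) -> unitp x.
Proof.
move=> k0 [c c0 h]; have [[a xa]|xV] := place_dich plc x.
  exists a => //; have := place_uniq plc (placeX plc k xa) h => ac.
  by apply/eqP => a0; move: c0; rewrite -ac a0 expr0n eqn0Ngt k0 eqxx.
have := placeM plc (placeX plc k xV) h; rewrite expr0n eqn0Ngt k0 mul0r.
rewrite -exprMn; have [x0|x0] := eqVneq x 0.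
  by move: (unitp_neq0 (ex_intro2 _ _ c c0 h)); rewrite x0 expr0n eqn0Ngt k0 eqxx.
rewrite mulVf // expr1n => h1.
by have := place_uniq plc h1 (place1 plc) => /eqP; rewrite eq_sym oner_eq0.
Qed.

(** Of two elements one divides the other over the valuation ring, so a finite family that is not
    all zero has a member of largest size. *)
Lemma place_max_seq (I : eqType) (s : seq I) (T : I -> K) :
  (forall i, i \in s -> T i = 0) \/
  exists i, [/\ i \in s, T i != 0 & forall j, j \in s -> finp (T j / T i)].
Proof.
elim: s => [|a s [h|[i [is_ Ti h]]]]; first by left.
  have [Ta|Ta] := eqVneq (T a) 0.
    by left => j; rewrite inE => /orP[/eqP->|/h].
  right; exists a; split; rewrite ?mem_head // => j; rewrite inE => /orP[/eqP->|/h ->].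
    by rewrite divff //; exists 1; exact: place1 plc.
  by rewrite mul0r; exists 0; exact: place0 plc.
right; have [hf|hf] := place_finite_div plc (T a) (T i).
  exists i; split => //; first by rewrite inE is_ orbT.
  by move=> j; rewrite inE => /orP[/eqP->|/h].
have [Ta|Ta] := eqVneq (T a) 0.
  exists i; split => //; first by rewrite inE is_ orbT.
  move=> j; rewrite inE => /orP[/eqP->|/h//].
  by rewrite Ta mul0r; exists 0; exact: place0 plc.
exists a; split; rewrite ?mem_head // => j; rewrite inE => /orP[/eqP->|/h hj].
  by rewrite divff //; exists 1; exact: place1 plc.
have -> : T j / T a = (T j / T i) * (T i / T a) by rewrite mulrA divfK.
exact: finpM.
Qed.

Lemma place_max (I : finType) (T : I -> K) :
  (forall i, T i = 0) \/ exists2 i, T i != 0 & forall j, finp (T j / T i).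
Proof.
have [h|[i [_ h1 h2]]] := place_max_seq (enum I) T.
  by left => i; apply: h; rewrite mem_enum.
by right; exists i => // j; apply: h2; rewrite mem_enum.
Qed.

End PlaceUnits.

(** * Orders, uniformizers and expansions over C(eps) *)

Section Laurent.
Variables (C K : fieldType) (iota : {rmorphism C -> K}) (lim : K -> C -> Prop).
Hypothesis plc : is_place iota lim.
Hypothesis charC : [pchar C] =i pred0.
Variable eps : K.
Hypothesis eps0 : eps != 0.
Hypothesis leps : lim eps 0.
Notation finp := (finp lim).
Notation unitp := (unitp lim).
Notation F := {fraction {poly C}}.

Definition evp (x : K) (p : {poly C}) : K := (map_poly iota p).[x].
Lemma evp_zmod x : zmod_morphism (evp x).
Proof. by move=> p q; rewrite /evp rmorphB hornerD hornerN. Qed.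
HB.instance Definition _ x := GRing.isZmodMorphism.Build {poly C} K (evp x) (evp_zmod x).
Lemma evp_monoid x : monoid_morphism (evp x).
Proof. by split => [|p q]; rewrite /evp ?rmorph1 ?hornerC // rmorphM hornerM. Qed.
HB.instance Definition _ x := GRing.isMonoidMorphism.Build {poly C} K (evp x) (evp_monoid x).
Lemma evpX x : evp x 'X = x. Proof. by rewrite /evp map_polyX hornerX. Qed.
Lemma evpC x c : evp x c%:P = iota c. Proof. by rewrite /evp map_polyC hornerC. Qed.

Lemma place_evp x p : lim x 0 -> lim (evp x p) p.[0].
Proof.
move=> hx; elim/poly_ind: p => [|p c IH]; first by rewrite rmorph0 horner0; exact: place0 plc.
rewrite rmorphD rmorphM /= evpX evpC hornerMXaddC.
by apply: placeD plc _ _ _ _ (placeM plc IH hx) (place_const plc c).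
Qed.

Lemma polyX_factor (p : {poly C}) : p != 0 -> exists k q, p = q * 'X^k /\ q.[0] != 0.
Proof.
have [m] := ubnP (size p); elim: m p => // m IH p; rewrite ltnS => sp p0.
have [r|r] := boolP (root p 0); last by exists 0%N, p; rewrite expr0 mulr1.
have [q pq] := factor_theorem _ _ r; rewrite subr0 in pq.
have q0 : q != 0 by apply: contra_neq p0 => q0; rewrite pq q0 mul0r.
have [|k [s [qs s0]]] := IH q _ q0.
  by move: sp; rewrite pq size_mulX.
by exists k.+1, s; rewrite pq qs -mulrA exprSr.
Qed.

(** The order of p(eps) is the multiplicity of 0 as a root of p. In particular eps is transcendental
    over the constants. *)
Lemma evp_unit (p : {poly C}) : p != 0 -> exists k : int, unitp (evp eps p / eps ^ k).
Proof.
move=> /polyX_factor[k [q [-> q0]]]; exists k%:Z.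
rewrite rmorphM rmorphXn /= evpX -exprnP mulfK ?expf_neq0 //.
by exists q.[0] => //; exact: place_evp.
Qed.

Lemma evp_inj : injective (evp eps).
Proof.
move=> p q pq; apply/eqP; rewrite -subr_eq0; apply/eqP.
have [//|/evp_unit[k /(unitp_neq0 plc)]] := eqVneq (p - q) 0.
by rewrite rmorphB /= pq subrr mul0r eqxx.
Qed.

Definition rat_ev : F -> K := @frac_ext _ _ (evp eps).
Lemma rat_ev_zmod : zmod_morphism rat_ev. Proof. exact: (frac_ext_zmod evp_inj). Qed.
HB.instance Definition _ := GRing.isZmodMorphism.Build F K rat_ev rat_ev_zmod.
Lemma rat_ev_monoid : monoid_morphism rat_ev. Proof. exact: (frac_ext_monoid evp_inj). Qed.
HB.instance Definition _ := GRing.isMonoidMorphism.Build F K rat_ev rat_ev_monoid.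

Definition rat_evR : {rmorphism F -> K} := rat_ev.

Lemma rat_ev_tofrac p : rat_ev (@FracField.tofrac _ p) = evp eps p.
Proof. exact: (frac_ext_tofrac evp_inj). Qed.
Lemma rat_ev_const c : rat_ev (@FracField.tofrac _ c%:P) = iota c.
Proof. by rewrite rat_ev_tofrac evpC. Qed.
Lemma rat_ev_X : rat_ev (@FracField.tofrac _ 'X) = eps.
Proof. by rewrite rat_ev_tofrac evpX. Qed.

Lemma rat_ev_unit (a : F) : a != 0 -> exists k : int, unitp (rat_ev a / eps ^ k).
Proof.
move=> a0; rewrite [in rat_ev a](frac_reprE a) fmorph_div /= !rat_ev_tofrac.
have n0 : \n_(repr a) != 0.
  by apply: contra_neq a0 => n0; rewrite (frac_reprE a) n0 rmorph0 mul0r.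
have [k hk] := evp_unit n0; have [l hl] := evp_unit (denom_ratioP (repr a)).
exists (k - l); have := unitpM plc hk (unitpV plc hl).
rewrite expfzDr // -invr_expz; congr unitp.
by rewrite !invfM !invrK; ring.
Qed.

Lemma rat_ev_neq0 a : a != 0 -> rat_ev a != 0.
Proof. by move=> a0; rewrite (fmorph_eq0 (rat_ev : {rmorphism F -> K})). Qed.

Lemma charF : [pchar F] =i pred0.
Proof.
move=> p; rewrite inE /=; apply/negP => /andP[pp].
rewrite -(rmorph_nat (@FracField.tofrac {poly C})) tofrac_eq0.
rewrite -polyC_natr polyC_eq0 => h.
by have := charC p; rewrite !inE pp h.
Qed.

(* Newton polygon: among the terms of a vanishing polynomial expression, two
   have the same order, so a power of the root has integral order. *)
Lemma root_order (chi : {poly F}) (x : K) : chi \is monic -> x != 0 ->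
  root (map_poly rat_ev chi) x ->
  exists k, [/\ (0 < k)%N, (k < size chi)%N & exists m : int, unitp (x ^+ k / eps ^ m)].
Proof.
move=> mchi x0 rx.
pose T (i : 'I_(size chi)) := rat_ev chi`_i * x ^+ i.
have chi0 : chi != 0 by exact: monic_neq0.
have sT : \sum_i T i = 0.
  move/eqP: rx; rewrite horner_coef size_map_poly => h.
  by apply: etrans h; apply: eq_bigr => i _; rewrite coef_map.
have [T0|[i Ti hT]] := place_max plc T.
  have sl : ((size chi).-1 < size chi)%N by rewrite prednK // size_poly_gt0.
  have := T0 (Ordinal sl); rewrite /T /= -lead_coefE (monicP mchi) rmorph1 mul1r => /eqP.
  by rewrite expf_eq0 (negPf x0) andbF.
have /fin_all_exists[c hc] : forall j, exists c, lim (T j / T i) c by exact: hT.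
have ci : c i = 1.
  by have := hc i; rewrite divff // => h; exact: (place_uniq plc h (place1 plc)).
have sc : \sum_j c j = 0.
  have h : lim (\sum_j T j / T i) (\sum_j c j) by apply: (place_sum plc).
  by move: h; rewrite -mulr_suml sT mul0r => h; exact: (place_uniq plc h (place0 plc)).
(* The residues sum to 0 and the [i]-th one is 1, so another term has the same order as the
   largest. *)
have [j ji cj] : exists2 j, j != i & c j != 0.
  have [[j ji cj]|nj] := pselect (exists2 j, j != i & c j != 0); first by exists j.
  have : \sum_j c j = 1.
    rewrite (bigD1 i) //= ci big1 ?addr0 // => j ji.
    by apply/eqP/negPn/negP => cj; apply: nj; exists j.
  by rewrite sc => /eqP; rewrite eq_sym oner_eq0.
have uij : unitp (T j / T i) by exists (c j).
have : exists (a b : 'I_(size chi)), [/\ (a < b)%N, T a != 0 & unitp (T b / T a)].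
  have [lij|lji|eij] := ltngtP i j.
  - by exists i, j.
  - exists j, i; split => //; last by rewrite -invf_div; exact: (unitpV plc).
    by apply: contra_neq (unitp_neq0 plc uij) => ->; rewrite mul0r.
  - by rewrite (val_inj eij) eqxx in ji.
case=> a [b [ab Ta uab]].
have Tb : T b != 0 by apply: contra_neq (unitp_neq0 plc uab) => ->; rewrite mul0r.
have [ca cb] : chi`_a != 0 /\ chi`_b != 0.
  split; [apply: contra_neq Ta|apply: contra_neq Tb]; rewrite /T => ->;
    by rewrite rmorph0 mul0r.
exists (b - a)%N; split; first by rewrite subn_gt0.
  by apply: leq_ltn_trans (leq_subr _ _) (ltn_ord b).
have [k hk] := rat_ev_unit (mulf_neq0 ca (invr_neq0 cb)).
exists k; have := unitpM plc uab hk; rewrite fmorph_div /= /T; congr unitp.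
have ra := rat_ev_neq0 ca; have rb := rat_ev_neq0 cb.
have xb : x ^+ b = x ^+ (b - a) * x ^+ a by rewrite -exprD subnK // ltnW.
have xa0 : x ^+ a != 0 by rewrite expf_neq0.
rewrite xb; have e0 : eps ^ k != 0 by rewrite expfz_neq0.
by field; rewrite ?ra ?rb ?xa0 ?e0.
Qed.

Definition gen_field (t z : K) := exists p q : {poly F},
  (map_poly rat_ev q).[t] != 0 /\ z = (map_poly rat_ev p).[t] / (map_poly rat_ev q).[t].

Lemma gen_field_gen t z : in_gen rat_ev t z -> gen_field t z.
Proof. by move=> [p ->]; exists p, 1; rewrite rmorph1 hornerC oner_neq0 divr1. Qed.

Lemma gen_fieldB t x y : gen_field t x -> gen_field t y -> gen_field t (x - y).
Proof.
move=> [a [b [b0 ->]]] [c [d [d0 ->]]]; exists (a * d - c * b), (b * d).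
rewrite !(rmorphM, rmorphB) /= !(hornerM, hornerD, hornerN) mulf_neq0 //.
by split=> //; field; rewrite b0 d0.
Qed.

Lemma gen_fieldM t x y : gen_field t x -> gen_field t y -> gen_field t (x * y).
Proof.
move=> [a [b [b0 ->]]] [c [d [d0 ->]]]; exists (a * c), (b * d).
by rewrite !rmorphM /= !hornerM mulf_neq0 // mulf_div.
Qed.

Lemma gen_field_rat t a : gen_field t (rat_ev a).
Proof. by apply: gen_field_gen; exists a%:P; rewrite map_polyC hornerC. Qed.

Lemma gen_fieldV t x : gen_field t x -> gen_field t x^-1.
Proof.
move=> [a [b [b0 ->]]]; rewrite invf_div.
have [a0|a0] := eqVneq (map_poly rat_ev a).[t] 0; last by exists b, a.
rewrite a0 invr0 mulr0 -(rmorph0 rat_ev); exact: gen_field_rat.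
Qed.

Lemma gen_fieldX t x k : gen_field t x -> gen_field t (x ^+ k).
Proof.
move=> h; elim: k => [|k IH]; last by rewrite exprS; exact: gen_fieldM.
by rewrite expr0 -(rmorph1 rat_ev); exact: gen_field_rat.
Qed.

Lemma gen_fieldXz t x (k : int) : gen_field t x -> gen_field t (x ^ k).
Proof. by case: k => k h; [exact: gen_fieldX|exact/gen_fieldV/gen_fieldX]. Qed.

Lemma cancel_common (a b c d : K) : d != 0 -> b != 0 -> c != 0 ->
  a / (b * c) / (d / b) = a / d / c.
Proof. by move=> d0 b0 c0; field; rewrite d0 b0 c0. Qed.

Lemma quotient_order (u w : K) (E : nat) (m l : int) :
  (u ^+ E / eps ^ m) * (w ^+ E / eps ^ l)^-1 = (u / w) ^+ E / eps ^ (m - l).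
Proof.
rewrite expfzDr // -invr_expz exprMn exprVn !invfM !invrK.
by move: (u ^+ E) (w ^- E) (eps ^ m)^-1 (eps ^ l) => a b c d; ring.
Qed.

Lemma uniformizer t : algebraicOver rat_ev t -> exists pi : K,
  [/\ gen_field t pi, lim pi 0, pi != 0 &
   forall z, gen_field t z -> z != 0 -> exists i : int, unitp (z / pi ^ i)].
Proof.
move=> /integral_algebraic[q mq qt].
(* Each nonzero u in F[t] has a power u^k of integral order with 0 < k < [size q], and every such k
   divides this factorial. *)
pose E := ((size q)`!)%N.
have Egt0 : (0 < E)%N by rewrite fact_gt0.
have ordG (u : K) : in_gen rat_ev t u -> u != 0 -> exists m : int, unitp (u ^+ E / eps ^ m).
  move=> hu u0; have [chi [mchi sc rc]] := in_gen_charpoly mq qt hu.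
  have [k [k0 ks [m hm]]] := root_order mchi u0 rc.
  have kE : (k %| E)%N by rewrite dvdn_fact // k0 -sc ltnW.
  exists (m * (E %/ k)%N%:Z); have := unitpX plc (E %/ k) hm.
  by rewrite exprMn exprVn -exprM mulnC divnK // -exprz_exp -exprnP.
have ordF (z : K) : gen_field t z -> z != 0 -> exists m : int, unitp (z ^+ E / eps ^ m).
  move=> [a [b [b0 ->]]] z0.
  have a0 : (map_poly rat_ev a).[t] != 0 by apply: contra_neq z0 => ->; rewrite mul0r.
  have [m hm] := ordG _ (ex_intro _ a erefl) a0.
  have [l hl] := ordG _ (ex_intro _ b erefl) b0.
  by exists (m - l); rewrite -quotient_order; exact: (unitpM plc hm (unitpV plc hl)).
pose P n := `[< (0 < n)%N /\ exists z, [/\ gen_field t z, z != 0 & unitp (z ^+ E / eps ^ n%:Z)] >].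
have exP : exists n, P n.
  exists E; apply/asboolP; split => //; exists eps; split => //.
    by rewrite -rat_ev_X; exact: gen_field_rat.
  by rewrite -exprnP divff ?expf_neq0 //; exact: (unitp1 plc).
have [n0 /asboolP[n0gt0 [pi [gpi pi0 upi]]] minn] := ex_minnP exP.
exists pi; split => //.
  apply: (place_expr_eq0 plc Egt0).
  have [c _ hc] := upi; have := placeM plc hc (placeX plc n0 leps).
  by rewrite expr0n eqn0Ngt n0gt0 mulr0 -exprnP divfK // expf_neq0.
move=> z gz z0; have [m hm] := ordF z gz z0.
(* Euclidean division of the order of [z] by that of [pi]: the quotient leaves an element whose
   order is the remainder, which minimality of [n0] forces to be 0. *)
exists (m %/ n0)%Z.
have gz' : gen_field t (z / pi ^ (m %/ n0)%Z).
  by apply: gen_fieldM => //; apply: gen_fieldV; exact: gen_fieldXz.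
have z'0 : z / pi ^ (m %/ n0)%Z != 0 by rewrite mulf_neq0 ?invr_neq0 ?expfz_neq0.
have h1 : unitp ((z / pi ^ (m %/ n0)%Z) ^+ E / eps ^ (m %% n0)%Z).
  have := unitpM plc hm (unitpV plc (unitpXz plc (m %/ n0)%Z upi)); congr unitp.
  have e1 : (pi ^+ E) ^ (m %/ n0)%Z = (pi ^ (m %/ n0)%Z) ^+ E.
    by rewrite !exprnP !exprz_exp mulrC.
  have e2 : eps ^ m = (eps ^ n0) ^ (m %/ n0)%Z * eps ^ (m %% n0)%Z.
    by rewrite exprz_exp -expfzDr // mulrC -divz_eq.
  rewrite expfzMl e1 exprz_inv -invr_expz e2 exprMn exprVn.
  have p1 : (pi ^ (m %/ n0)%Z) ^+ E != 0 by rewrite expf_neq0 ?expfz_neq0.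
  have p2 : (eps ^ n0) ^ (m %/ n0)%Z != 0 by rewrite !expfz_neq0.
  have p3 : eps ^ (m %% n0)%Z != 0 by rewrite !expfz_neq0.
  exact: cancel_common p1 p2 p3.
have m0 : (m %% n0)%Z = 0.
  have := modz_ge0 m (_ : n0%:Z != 0); rewrite -lt0n => /(_ n0gt0).
  have := ltz_pmod m (_ : 0 < n0%:Z); rewrite ltz_nat => /(_ n0gt0).
  case: (modz m n0) h1 => // -[|r] h1 // rn _.
  have := minn r.+1; move: rn; rewrite ltz_nat ltnNge => /negP rn /(_ _)/rn []//.
  by apply/asboolP; split => //; exists (z / pi ^ (m %/ n0)%Z).
by move: h1; rewrite m0 expr0z divr1 => /(unitp_root plc Egt0).
Qed.

(** The residue field consists of the constants, so expansion coefficients are obtained by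
    repeatedly subtracting the residue and dividing by [pi]. *)
Lemma taylor_approx t pi : gen_field t pi -> lim pi 0 -> pi != 0 ->
  (forall z, gen_field t z -> z != 0 -> exists i : int, unitp (z / pi ^ i)) ->
  forall y, gen_field t y -> finp y ->
  forall Q, exists p g, [/\ gen_field t g, finp g & y = evp pi p + pi ^+ Q * g].
Proof.
move=> gpi lpi pi0 hord y gy fy; elim=> [|Q [p [g [gg fg yE]]]].
  by exists 0, y; rewrite rmorph0 add0r mul1r.
have [c lc] := fg.
have gc : gen_field t (iota c) by rewrite -rat_ev_const; exact: gen_field_rat.
have lgc : lim (g - iota c) 0.
  by have := placeB plc lc (place_const plc c); rewrite subrr.
exists (p + c%:P * 'X^Q), ((g - iota c) / pi); split.
- by apply: gen_fieldM; [exact: gen_fieldB|exact: gen_fieldV].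
- have [->|z0] := eqVneq (g - iota c) 0.
    by rewrite mul0r; exists 0; exact: (place0 plc).
  (* The residue of [g - iota c] is 0, which rules out order zero and negative orders; a positive
     order survives division by [pi]. *)
  have [[[|i]|i]] := hord _ (gen_fieldB gg gc) z0.
  + rewrite expr0z divr1 => -[b b0 /(place_uniq plc)/(_ lgc) b0'].
    by rewrite b0' eqxx in b0.
  + move=> h; have -> : (g - iota c) / pi = (g - iota c) / pi ^ i.+1%:Z * pi ^+ i.
      rewrite -exprnP exprS invfM mulrA -!mulrA [_ * pi ^+ i]mulVf ?mulr1 //.
      by rewrite expf_neq0.
    by apply: (finpM plc) (unitp_fin h) _; apply: (finpX plc); exists 0.
  + rewrite NegzE -invr_expz invrK -exprnP => -[b b0 h].
    have := placeM plc lgc (placeX plc i.+1 lpi); rewrite mul0r => h'.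
    by move: b0; rewrite (place_uniq plc h h') eqxx.
- rewrite yE rmorphD rmorphM rmorphXn /= evpX evpC exprSr -!mulrA.
  rewrite [pi * _]mulrC divfK // -addrA mulrBr; congr (_ + _).
  by rewrite [iota c * _]mulrC addrC subrK.
Qed.

Lemma laurent_approx (zs : seq K) : (forall z, z \in zs -> algebraicOver rat_ev z) ->
  exists pi B, [/\ lim pi 0, pi != 0 & forall Q z, z \in zs ->
    exists p g, finp g /\ z * pi ^+ B = evp pi p + pi ^+ Q * g].
Proof.
move=> halg; have [t at_ ht] := primitive_element charF halg.
have [pi [gpi lpi pi0 hord]] := uniformizer at_.
have [B hB] : exists B, forall z, z \in zs -> finp (z * pi ^+ B).
  have : forall z, z \in zs -> gen_field t z by move=> z /ht /gen_field_gen.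
  elim: zs {halg ht} => [|z zs IH] hg; first by exists 0%N.
  have [|B hB] := IH; first by move=> u us; apply: hg; rewrite inE us orbT.
  have fpi k : finp (pi ^+ k) by apply: (finpX plc); exists 0.
  have [b hb] : exists b, finp (z * pi ^+ b).
    have [->|z0] := eqVneq z 0; first by exists 0%N; rewrite mul0r; exists 0; exact: (place0 plc).
    have [[i|i] hi] := hord z (hg z (mem_head _ _)) z0.
      exists 0%N; rewrite expr0 mulr1 -[z](@divfK _ (pi ^ i)) ?expfz_neq0 //.
      by apply: (finpM plc) (unitp_fin hi) _; exact: fpi.
    exists i.+1; move: hi; rewrite NegzE -invr_expz invrK -exprnP.
    exact: unitp_fin.
  exists (b + B)%N => u; rewrite inE => /orP[/eqP->|/hB hu].
    by rewrite exprD mulrA; apply: (finpM plc).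
  by rewrite addnC exprD mulrA; apply: (finpM plc).
exists pi, B; split => // Q z zs_.
have gz : gen_field t (z * pi ^+ B).
  by apply: gen_fieldM; [exact/gen_field_gen/ht|exact: gen_fieldX].
have [p [g [_ fg e]]] := taylor_approx gpi lpi pi0 hord gz (hB z zs_) Q.
by exists p, g.
Qed.

End Laurent.

Lemma psumZ (A : comNzRingType) n d r (a : A) (Z : 'M[A]_(r, n)) :
  psum d (a *: Z) = a ^+ d *: psum d Z.
Proof.
rewrite /psum scaler_sumr; apply: eq_bigr => i _.
by rewrite -exprZn -lformZ; congr (_ ^+ _); apply: eq_lform => j; rewrite mxE.
Qed.

Lemma tofrac_psum (A : idomainType) (x h : A) B d r n (P : 'M[A]_(r, n)) m :
  x != 0 -> (psum d P)@_m = h * x ^+ (B * d) ->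
  (psum d ((FracField.tofrac x ^+ B)^-1 *: map_mx (@FracField.tofrac A) P))@_m =
  FracField.tofrac h.
Proof.
move=> x0 e; rewrite psumZ mcoeffZ -map_psum mcoeff_map_mpoly /= e.
rewrite rmorphM rmorphXn exprM exprVn mulrCA mulVf ?mulr1 //.
by rewrite !expf_neq0 // tofrac_eq0.
Qed.

Section FinitePolys.
Variables (C K : fieldType) (iota : {rmorphism C -> K}) (lim : K -> C -> Prop).
Hypothesis plc : is_place iota lim.
Variable n : nat.

Definition mfin (P : {mpoly K[n]}) := exists f, mlim lim P f.

Lemma mfinD P Q : mfin P -> mfin Q -> mfin (P + Q).
Proof. by move=> [f hf] [g hg]; exists (f + g); exact: (mlimD plc hf hg). Qed.
Lemma mfinM P Q : mfin P -> mfin Q -> mfin (P * Q).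
Proof. by move=> [f hf] [g hg]; exists (f * g); exact: (mlimM plc hf hg). Qed.
Lemma mfinZ a P : finp lim a -> mfin P -> mfin (a *: P).
Proof. by move=> [c hc] [g hg]; exists (c *: g); exact: (mlimZ plc hc hg). Qed.
Lemma mfin1 : mfin 1. Proof. by exists 1; exact: mlim1 plc _. Qed.
Lemma mfin0 : mfin 0. Proof. by exists 0; exact: mlim0 plc _. Qed.
Lemma mfin_sum (I : Type) (r : seq I) (F : I -> {mpoly K[n]}) :
  (forall i, mfin (F i)) -> mfin (\sum_(i <- r) F i).
Proof.
move=> h; elim: r => [|i r IH]; first by rewrite big_nil; exact: mfin0.
by rewrite big_cons; exact: mfinD.
Qed.
Lemma mfinX P k : mfin P -> mfin (P ^+ k).
Proof. by move=> [f hf]; exists (f ^+ k); exact: (mlimXn plc k hf). Qed.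
Lemma mfin_lform (c : 'I_n -> K) : (forall j, finp lim (c j)) -> mfin (lform c).
Proof.
by move=> h; have [g hg] := choice h; exists (lform g); exact: (mlim_lform plc hg).
Qed.

Lemma mfin_perturb_exp a U V d : finp lim a -> mfin U -> mfin V ->
  exists2 W, mfin W & (U + a *: V) ^+ d = U ^+ d + a *: W.
Proof.
move=> fa fU fV; elim: d => [|d [W fW e]].
  by exists 0; [exact: mfin0|rewrite !expr0 scaler0 addr0].
exists (V * U ^+ d + U * W + a *: (V * W)).
  apply: mfinD; last by apply: mfinZ => //; exact: mfinM.
  by apply: mfinD; apply: mfinM => //; exact: mfinX.
rewrite !exprS e -!mul_mpolyC; ring.
Qed.

Lemma psum_perturb d r a (X Y : 'M[K]_(r, n)) : finp lim a ->
  (forall i j, finp lim (X i j)) -> (forall i j, finp lim (Y i j)) ->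
  exists2 W, mfin W & psum d (X + a *: Y) = psum d X + a *: W.
Proof.
move=> fa fX fY.
have h i : exists W, mfin W /\ lform ((X + a *: Y) i) ^+ d = lform (X i) ^+ d + a *: W.
  have [W fW e] := mfin_perturb_exp d fa (mfin_lform (fX i)) (mfin_lform (fY i)).
  exists W; split=> //; rewrite -e -lformZ -lformD; congr (_ ^+ _).
  by apply: eq_lform => j; rewrite !mxE.
have [W hW] := choice h; exists (\sum_i W i).
  by apply: mfin_sum => i; have [] := hW i.
rewrite /psum scaler_sumr -big_split; apply: eq_bigr => i _.
by have [] := hW i.
Qed.

End FinitePolys.

(** * From algebraic coefficients to Laurent polynomials *)

Section LaurentCurve.
Variables (C K : fieldType) (iota : {rmorphism C -> K}) (lim : K -> C -> Prop).
Hypothesis plc : is_place iota lim.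
Hypothesis charC : [pchar C] =i pred0.
Variable eps : K.
Hypothesis eps0 : eps != 0.
Hypothesis leps : lim eps 0.

(** The order of G(pi) in [pi] is the multiplicity of 0 as a root of [G]. Hence a finite quotient by
    pi^D forces X^D to divide [G], and [pi] can be replaced by a formal variable. *)
Lemma curve_coef (pi : K) (D : nat) (G : {poly C}) (c : C) : lim pi 0 -> pi != 0 ->
  lim (evp iota pi G / pi ^+ D) c -> exists2 h, G = h * 'X^D & h.[0] = c.
Proof.
move=> lpi pi0 hG; have [G0|/polyX_factor[k [q [GE q0]]]] := eqVneq G 0.
  exists 0; first by rewrite mul0r.
  rewrite horner0; apply: (place_uniq plc) hG; rewrite G0 rmorph0 mul0r.
  exact: (place0 plc).
have evG : evp iota pi G = evp iota pi q * pi ^+ k.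
  by rewrite GE rmorphM rmorphXn /= evpX.
have lq := place_evp plc q lpi.
have [Dk|kD] := leqP D k.
  exists (q * 'X^(k - D)); first by rewrite -mulrA -exprD subnK.
  apply: (place_uniq plc) hG; rewrite evG -[X in pi ^+ X](subnK Dk) exprD mulrA mulfK ?expf_neq0 //.
  by have := place_evp plc (q * 'X^(k - D)) lpi; rewrite rmorphM rmorphXn /= evpX.
have := placeM plc hG (placeX plc (D - k) lpi).
rewrite expr0n subn_eq0 leqNgt kD mulr0 evG -[X in _ / pi ^+ X](subnK (ltnW kD)) exprD.
have cancel (x a b : K) : a != 0 -> b != 0 -> x * a / (b * a) * b = x.
  by move=> a0 b0; field; rewrite b0 a0.
rewrite cancel ?expf_neq0 // => h.
by move: q0; rewrite (place_uniq plc lq h) eqxx.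
Qed.

Lemma laurent_curve d r n (f : {mpoly C[n]}) (Z : 'M[K]_(r, n)) :
  (forall i j, algebraicOver (rat_ev iota eps) (Z i j)) -> mlim lim (psum d Z) f ->
  exists (B : nat) (P : 'M[{poly C}]_(r, n)), forall m,
    exists2 h, (psum d P)@_m = h * 'X^(B * d) & h.[0] = f@_m.
Proof.
move=> MZ hZ.
pose zs := [seq Z ij.1 ij.2 | ij <- enum {: 'I_r * 'I_n}].
have zsZ i j : Z i j \in zs by apply/mapP; exists (i, j); rewrite ?mem_enum.
have [|pi [B [lpi pi0 happ]]] := @laurent_approx _ _ _ _ plc charC eps eps0 leps zs.
  by move=> z /mapP[[i j] _ ->]; exact: MZ.
(* Truncating at this order changes the power sum by a multiple of pi^(Bd+1), which is still
   infinitesimal after division by pi^(Bd). *)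
pose Q := (B * d).+1.
have /choice[pg hpg] : forall ij : 'I_r * 'I_n, exists pg : {poly C} * K,
    finp lim pg.2 /\ Z ij.1 ij.2 * pi ^+ B = evp iota pi pg.1 + pi ^+ Q * pg.2.
  by move=> [i j]; have [p [g [h1 h2]]] := happ Q _ (zsZ i j); exists (p, g).
pose P : 'M[{poly C}]_(r, n) := \matrix_(i, j) (pg (i, j)).1.
pose Pe := map_mx (evp iota pi) P.
pose Y : 'M[K]_(r, n) := \matrix_(i, j) (pg (i, j)).2.
have ZE : pi ^+ B *: Z = Pe + pi ^+ Q *: Y.
  apply/matrixP => i j; rewrite !mxE mulrC.
  by have [_] := hpg (i, j).
have fpi k : finp lim (pi ^+ k) by apply: (finpX plc); exists 0.
have [||W fW WE] := psum_perturb plc d (fpi Q) (X := Pe) (Y := Y).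
- by move=> i j; rewrite !mxE; exists (pg (i, j)).1.[0]; exact: place_evp.
- by move=> i j; rewrite !mxE; have [] := hpg (i, j).
exists B, P => m; apply: (curve_coef lpi pi0).
have [w hw] := fW.
have := congr1 (mcoeff m) WE; rewrite -ZE psumZ mcoeffZ mcoeffD mcoeffZ -exprM.
move=> /eqP; rewrite -subr_eq -map_psum mcoeff_map_mpoly /= => /eqP <-.
rewrite mulrBl mulrAC divff ?expf_neq0 // mul1r.
rewrite [pi ^+ Q]exprS -!mulrA [_ * (W@_m / _)]mulrCA divff ?expf_neq0 // mulr1.
have := placeB plc (hZ m) (placeM plc lpi (hw m)).
by rewrite mul0r subr0.
Qed.

End LaurentCurve.

Section RatfunLim.
Variable R : realType.
Notation C := (CC R).

Lemma cvg_horner (F : set_system C) (FF : Filter F) (p : {poly C}) (a : C) :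
  F --> a -> p.[x] @[x --> F] --> p.[a].
Proof.
move=> Fa; elim/poly_ind: p => [|p c IH].
  rewrite horner0 (_ : (fun x => _) = fun=> 0); first exact: cvg_cst.
  by apply/funext => x; rewrite horner0.
rewrite hornerMXaddC (_ : (fun x => _) = fun x => p.[x] * x + c).
  have h1 := @cvgM _ _ F FF _ _ _ _ IH (Fa : (fun x => x) x @[x --> F] --> a).
  by have := @cvgD _ _ _ F FF _ _ _ _ h1 (cvg_cst c); apply.
by apply/funext => x; rewrite hornerMXaddC.
Qed.

Lemma near_horner_neq0 (p : {poly C}) : p != 0 -> \forall x \near (0 : C)^', p.[x] != 0.
Proof.
move=> /polyX_factor[k [q [-> q0]]]; have FF := dnbhs_filter (0 : C).
have hq : q.[x] @[x --> (0 : C)^'] --> q.[0] by apply: cvg_horner; exact: nbhs_dnbhs.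
have h1 : \forall x \near (0 : C)^', q.[x] != 0 := cvgr_neq0 _ hq q0.
have h2 : \forall x \near (0 : C)^', x != 0 := nbhs_dnbhs_neq _.
apply: (@filterS _ _ FF _ _ _ (@filterI _ _ FF _ _ (h1 FF) h2)) => x [qx x0].
by rewrite hornerM hornerXn mulf_neq0 ?expf_neq0.
Qed.

(** The chosen fraction may be unreduced, but its numerator is [h] times its denominator, so the
    quotient is [h] near 0 off the zeros of the denominator. *)
Lemma ratfun_eval_tofrac (h : {poly C}) :
  ratfun_eval (@FracField.tofrac _ h) e @[e --> (0 : C)^'] --> h.[0].
Proof.
set x := FracField.tofrac h.
have d0 := denom_ratioP (repr x).
have nd : \n_(repr x) = h * \d_(repr x).
  apply/eqP; rewrite -(@tofrac_eq _ (\n_(repr x))) rmorphM /= -/x.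
  by rewrite [in X in _ == X * _](frac_reprE x) divfK // tofrac_eq0.
have F0 : (0 : C)^' --> (0 : C) by exact: nbhs_dnbhs.
have : h.[x] @[x --> (0 : C)^'] --> h.[0] by apply: cvg_horner.
apply: cvg_trans; apply: near_eq_cvg.
have := near_horner_neq0 d0; apply: (@filterS _ _ (dnbhs_filter _)) => e de.
by rewrite /ratfun_eval nd hornerM mulfK.
Qed.

End RatfunLim.

Section HyperBorderWaring.
Variable R : realType.
Notation C := (CC R).
Notation K := (hyper R).

Lemma char_CC : [pchar C] =i pred0.
Proof. exact: pchar_num. Qed.

Let plc := hlim_place R.
Let eps : K := rcls (@inv_seq R).

Lemma eps_neq0 : eps != 0.
Proof.
apply/eqP; rewrite -(rmorph0 (@hcls R)) => /hcls_eq h.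
apply: (@filter_not_empty _ freeU); apply: filterS h => k /= /eqP.
by rewrite /rseq /inv_seq eq_complex /= invr_eq0 pnatr_eq0.
Qed.

Lemma eps_lim : hlim eps 0.
Proof.
suff h : @inv_seq R k @[k --> freeU] --> (0 : R).
  by apply/hlimE; exact: (cvg_real_complex h).
apply/cvgrPdist_lt => e e0.
have h := freeU_oo (near_infty_natSinv_lt (interval_inference.PosNum e0)).
by apply: filterS h => k /=; rewrite sub0r normrN /inv_seq gtr0_norm // invr_gt0 ltr0n.
Qed.

Lemma hyper_border_waring d r n (f : {mpoly C[n]}) (Z : 'M[K]_(r, n)) :
  mlim (@hlim R) (psum d Z) f -> border_waring_decomp d f r.
Proof.
move=> hZ; pose ev := rat_evR plc eps_neq0 eps_lim.
pose M x := algebraicOver ev x.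
have Mconst c : M (hconst c).
  by rewrite -(rat_ev_const plc eps_neq0 eps_lim); exact: (algebraic_id ev).
have [|||||Z' MZ' {}hZ] := power_sum_selection (M := M) _ _ _ _ _ hZ.
- exact: Mconst.
- by move=> x y; exact: algebraic_add.
- by move=> x y; exact: algebraic_mul.
- move=> p u p0 ru Mp; apply/integral_algebraic; apply: (integral_root p0 ru).
  by apply/integral_poly => i; apply/integral_algebraic; exact: Mp.
- by rewrite -[rcls _](rat_ev_X plc eps_neq0 eps_lim); exact: (algebraic_id ev).
have [B [P hPm]] := laurent_curve plc char_CC eps_neq0 eps_lim MZ' hZ.
have /choice[h hh] : forall m, exists h, (psum d P)@_m = h * 'X^(B * d) /\ h.[0] = f@_m.
  by move=> m; have [h] := hPm m; exists h.
have hP m := (hh m).1; have h0 m := (hh m).2.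
(* Dividing the polynomial forms by X^B cancels the factor X^(Bd) in the sum of their [d]-th
   powers. *)
exists (fun i => lform (((FracField.tofrac 'X ^+ B)^-1 *: map_mx (@FracField.tofrac {poly C}) P) i)).
split; first by move=> i; exact: lform_homog.
move=> m; rewrite -[\sum_(i < r) _]/(psum d _).
rewrite (tofrac_psum _ (hP m)) ?polyX_eq0 // -h0.
exact: ratfun_eval_tofrac.
Qed.

End HyperBorderWaring.

(** * Newton's identities and interpolation *)

Section Newton.
Variable A : comNzRingType.
Implicit Types (w : A) (ws : seq A).

(** Its coefficients are the elementary symmetric functions of [ws]. *)
Definition egen ws : {poly A} := \prod_(w <- ws) (1 + w%:P * 'X).
Definition psum_list ws k : A := \sum_(w <- ws) w ^+ k.

(** The series of w/(1 + wX), the logarithmic derivative of one factor of [egen], truncated at order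
    [N]. *)
Definition qgen N w : {poly A} := \sum_(k < N) ((-1) ^+ k * w ^+ k.+1)%:P * 'X^k.

Lemma qgenE N w : (1 + w%:P * 'X) * qgen N w = w%:P - w%:P * (- (w%:P * 'X)) ^+ N.
Proof.
have -> : qgen N w = w%:P * \sum_(k < N) (- (w%:P * 'X)) ^+ k.
  rewrite /qgen mulr_sumr; apply: eq_bigr => k _.
  rewrite (exprNn (w%:P * 'X)) exprMn polyCM !polyC_exp polyCN polyC1 exprS; ring.
have := subrX1 (- (w%:P * 'X)) N.
set S := \sum_(k < N) _; set x := (_ * 'X) => e.
have -> : (1 + x) * (w%:P * S) = - w%:P * ((- x - 1) * S) by ring.
by rewrite -e; ring.
Qed.

(* Newton's identities in generating-function form: E' = E * (sum of the
   logarithmic derivatives), truncated at order N. *)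
Lemma newton_gen N ws :
  exists r, deriv (egen ws) = egen ws * (\sum_(w <- ws) qgen N w) + 'X^N * r.
Proof.
elim: ws => [|w ws [r IH]].
  by exists 0; rewrite /egen !big_nil !mulr0 addr0 -polyC1 derivC.
rewrite /egen !big_cons -/(egen ws) derivM IH derivD derivM -polyC1 !derivC derivX mul0r.
rewrite !add0r mulr1 polyC1.
exists ((1 + w%:P * 'X) * r + w%:P * (- w%:P) ^+ N * egen ws).
have e := qgenE N w; rewrite mulrDr.
have -> : w%:P * egen ws = ((1 + w%:P * 'X) * qgen N w + w%:P * (- (w%:P * 'X)) ^+ N) * egen ws.
  by rewrite e subrK.
rewrite -mulNr exprMn; ring.
Qed.

Lemma coef_qsum N ws k : (k < N)%N ->
  (\sum_(w <- ws) qgen N w)`_k = (-1) ^+ k * psum_list ws k.+1.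
Proof.
move=> kN; rewrite coef_sum /psum_list mulr_sumr; apply: eq_bigr => w _.
rewrite /qgen coef_sum (bigD1 (Ordinal kN)) //= coefCM coefXn eqxx mulr1.
rewrite big1 ?addr0 // => i ik; rewrite coefCM coefXn.
by case: eqP => [e|_]; [move: ik; rewrite -val_eqE /= e eqxx|rewrite mulr0].
Qed.

Lemma newton ws j : (egen ws)`_j.+1 *+ j.+1 =
  \sum_(k < j.+1) (egen ws)`_(j - k) * ((-1) ^+ k * psum_list ws k.+1).
Proof.
have [r e] := newton_gen j.+1 ws.
rewrite -coef_deriv e coefD coefXnM ltnSn addr0 coefMr.
by apply: eq_bigr => k _; rewrite coef_qsum.
Qed.

Lemma egen0 ws : (egen ws)`_0 = 1.
Proof.
elim: ws => [|w ws IH]; first by rewrite /egen big_nil coef1.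
by rewrite /egen big_cons -/(egen ws) mulrDl mul1r coefD IH -mulrA coefCM coefXM mulr0 addr0.
Qed.
End Newton.

Lemma egen_homog (A : comNzRingType) n (ws : seq {mpoly A[n]}) j :
  (forall w, w \in ws -> w \is 1.-homog) -> (egen ws)`_j \is j.-homog.
Proof.
elim: ws j => [|w ws IH] j hw.
  by rewrite /egen big_nil coef1; case: eqP => [->|_]; [exact: dhomog1|exact: dhomog0].
have hws : forall v, v \in ws -> v \is 1.-homog by move=> v vs; apply: hw; rewrite inE vs orbT.
rewrite /egen big_cons -/(egen ws) mulrDl mul1r coefD -mulrA coefCM coefXM.
apply: rpredD; first exact: IH.
case: j => [|j] /=; first by rewrite mulr0; exact: dhomog0.
rewrite -add1n; apply: dhomogM; last exact: IH.
by apply: hw; rewrite mem_head.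
Qed.

Lemma pihomog_prod1 (A : comNzRingType) n (ws : seq {mpoly A[n]}) j :
  (forall w, w \in ws -> w \is 1.-homog) ->
  pihomog mdeg j (\prod_(w <- ws) (1 + w)) = (egen ws)`_j.
Proof.
move=> hw.
have -> : \prod_(w <- ws) (1 + w) = (egen ws).[1].
  rewrite /egen horner_prod; apply: eq_bigr => w _.
  by rewrite hornerD hornerM hornerX !hornerC mulr1.
rewrite horner_coef raddf_sum /=.
under eq_bigr do rewrite expr1n mulr1.
have z i : i != j -> pihomog mdeg j (egen ws)`_i = 0.
  by move=> ij; apply: pihomog_ne0 (egen_homog i hw).
have [js|js] := ltnP j (size (egen ws)).
  rewrite (bigD1 (Ordinal js)) //= pihomog_dE; last exact: egen_homog.
  by rewrite big1 ?addr0 // => i ij; apply: z.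
rewrite nth_default // big1 // => i _; apply: z.
by rewrite neq_ltn (leq_trans (ltn_ord i) js).
Qed.

Section Prod3.
Variable S : comNzRingType.
Variable d : nat.

Definition sel3 (c : nat) (x y z : S) : S := if c == 0%N then x else if c == 1%N then y else z.

Definition cnt (c : nat) (k : {ffun 'I_d -> 'I_3}) : nat := #|[pred i | k i == c :> nat]|.

(** In the expansion of a product of trinomials, [k] records which of its three summands each factor
    contributes. *)
Definition coef3 (a b z : 'I_d -> S) (k : {ffun 'I_d -> 'I_3}) : S :=
  \prod_i sel3 (k i) (a i) (b i) (z i).

Lemma cnt_sum k : (cnt 0 k + cnt 1 k + cnt 2 k)%N = d.
Proof.
have e c : cnt c k = (\sum_i (k i == c :> nat))%N.
  by rewrite /cnt -sum1_card big_mkcond; apply: eq_bigr => i _; rewrite inE; case: (_ == _).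
rewrite !e -!big_split /= -[RHS]card_ord -sum1_card; apply: eq_bigr => i _.
by case: (k i) => -[|[|[|]]].
Qed.

Lemma prod3 (a b z : 'I_d -> S) u v t :
  \prod_i (a i * u + b i * v + z i * t) =
  \sum_k coef3 a b z k * (u ^+ cnt 0 k * v ^+ cnt 1 k * t ^+ cnt 2 k).
Proof.
have -> : \prod_i (a i * u + b i * v + z i * t) =
    \prod_i \sum_(c : 'I_3) sel3 c (a i * u) (b i * v) (z i * t).
  by apply: eq_bigr => i _; rewrite !big_ord_recl big_ord0 addr0 addrA.
rewrite bigA_distr_bigA; apply: eq_bigr => k _.
have pw (x : S) c : x ^+ cnt c k = \prod_i (if k i == c :> nat then x else 1).
  by rewrite -big_mkcond prodr_const.
rewrite !pw /coef3 -!big_split; apply: eq_bigr => i _ /=.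
by case: (k i) => -[|[|[|]]] //= hi; rewrite /sel3 /= ?mulr1 ?mul1r.
Qed.
End Prod3.

Section Vandermonde.
Variable C : fieldType.

(** The weights are the rows of the inverse Vandermonde matrix; they read off one coefficient of a
    polynomial of degree at most [d] from its values at the nodes. *)
Lemma vandermonde_dual d (y : 'I_d.+1 -> C) : injective y ->
  exists lam : nat -> 'I_d.+1 -> C, forall b b', (b <= d)%N -> (b' <= d)%N ->
    \sum_s lam b s * y s ^+ b' = (b == b')%:R.
Proof.
move=> yinj; pose V : 'M[C]_d.+1 := \matrix_(s, b) y s ^+ b.
have uV : V \in unitmx.
  rewrite -unitmx_tr.
  have -> : V^T = Vandermonde d.+1 (\row_s y s).
    by apply/matrixP => i j; rewrite !mxE.
  rewrite unitmxE det_Vandermonde unitfE; apply/prodf_neq0 => i _.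
  apply/prodf_neq0 => j ij; rewrite !mxE subr_eq0; apply/eqP => /yinj e.
  by rewrite e ltnn in ij.
exists (fun b s => invmx V (inord b) s) => b b' bd b'd.
have := mulVmx uV => /matrixP/(_ (inord b) (inord b')); rewrite !mxE => e.
transitivity ((inord b == inord b' :> 'I_d.+1)%:R : C); last first.
  by rewrite -val_eqE /= !inordK.
by rewrite -e; apply: eq_bigr => s _; rewrite !mxE inordK.
Qed.

Lemma many_nonroots (p : {poly C}) N : [pchar C] =i pred0 -> p != 0 ->
  exists2 y : 'I_N -> C, injective y & forall s, p.[y s] != 0.
Proof.
move=> ch p0.
pose l := [seq (k%:R : C) | k <- iota 0 (N + size p)].
have ul : uniq l.
  rewrite map_inj_in_uniq ?iota_uniq // => i j _ _.
  wlog ij : i j / (i <= j)%N.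
    by move=> h; case: (leqP i j) => [/h|/ltnW/h h' e]; [|symmetry; exact: h'].
  move=> e; apply/eqP; rewrite eqn_leq ij /= -subn_eq0.
  by move/pcharf0P : ch => <-; rewrite natrB // e subrr.
pose g := [seq x <- l | ~~ root p x].
have sg : (N <= size g)%N.
  have : (size (seq.filter (root p) l) < size p)%N.
    apply: max_poly_roots => //; first exact: filter_all.
    exact: filter_uniq.
  have : size l = (N + size p)%N by rewrite size_map size_iota.
  have := count_predC (root p) l; rewrite -!size_filter /g.
  rewrite (_ : seq.filter (predC (root p)) l = g) //.
  move: (size g) (size l) (size _) (size _) => n1 n2 n3 n4; lia.
exists (fun s => nth 0 g s).
  move=> s t /eqP; rewrite nth_uniq ?filter_uniq //; last 2 first.
  - exact: leq_trans (ltn_ord s) sg.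
  - exact: leq_trans (ltn_ord t) sg.
  by move/eqP/val_inj.
move=> s; have : nth 0 g s \in g by rewrite mem_nth // (leq_trans (ltn_ord s) sg).
by rewrite mem_filter => /andP[].
Qed.

End Vandermonde.

Section Interpolation.
Variables (K : fieldType) (n d : nat).
Notation A := {mpoly K[n]}.
Variables (y : 'I_d.+1 -> K) (lam : nat -> 'I_d.+1 -> K).
Hypothesis lamP : forall b b', (b <= d)%N -> (b' <= d)%N ->
    \sum_s lam b s * y s ^+ b' = (b == b')%:R.

Lemma cnt_le c (k : {ffun 'I_d -> 'I_3}) : (cnt c k <= d)%N.
Proof. by rewrite -[X in (_ <= X)%N]card_ord; exact: max_card. Qed.

Lemma coef3_homog (a b : 'I_d -> K) (z : 'I_d -> A) k : (forall i, z i \is 1.-homog) ->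
  coef3 (fun i => (a i)%:MP) (fun i => (b i)%:MP) z k \is (cnt 2 k).-homog.
Proof.
move=> hz.
have -> : cnt 2 k = (\sum_(i < d) (k i == 2%N :> nat))%N.
  by rewrite /cnt -sum1_card big_mkcond; apply: eq_bigr => i _; rewrite inE; case: (_ == _).
have hC (c : K) : (c%:MP : A) \is 0.-homog.
  have -> : c%:MP = c *: 1 :> A by rewrite -mul_mpolyC mulr1.
  by apply: dhomogZ; exact: dhomog1.
rewrite /coef3; elim/big_rec2: _ => [|i x1 x2 _ IH]; first exact: dhomog1.
by apply: dhomogM => //; case: (k i) => -[|[|[|]]] //= hi; rewrite /sel3 /=.
Qed.

(* The graded pieces of the product, evaluated on d+1 points of the line
   through U and V, determine the product. *)
Lemma interpolation (a b : 'I_d -> K) (z : 'I_d -> A) (u v : A) :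
  (forall i, z i \is 1.-homog) ->
  \prod_i (a i *: u + b i *: v + z i) =
  \sum_(j < d.+1) \sum_(e < d.+1 | (e + j <= d)%N) u ^+ (d - j - e) * v ^+ e *
    \sum_s lam e s *: pihomog mdeg j (\prod_i ((a i + b i * y s)%:MP + z i)).
Proof.
move=> hz; pose co := coef3 (fun i => (a i)%:MP_[n]) (fun i => (b i)%:MP) z.
have -> : \prod_i (a i *: u + b i *: v + z i) =
    \sum_k co k * (u ^+ cnt 0 k * v ^+ cnt 1 k).
  transitivity (\prod_i ((a i)%:MP * u + (b i)%:MP * v + z i * 1)).
    by apply: eq_bigr => i _; rewrite !mul_mpolyC mulr1.
  by rewrite prod3; apply: eq_bigr => k _; rewrite expr1n mulr1.
have pj s (j : nat) : pihomog mdeg j (\prod_i ((a i + b i * y s)%:MP + z i)) =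
    \sum_(k | cnt 2 k == j) (y s ^+ cnt 1 k) *: co k.
  have -> : \prod_i ((a i + b i * y s)%:MP + z i) = \sum_k (y s ^+ cnt 1 k) *: co k.
    transitivity (\prod_i ((a i)%:MP * 1 + (b i)%:MP * (y s)%:MP + z i * 1)).
      by apply: eq_bigr => i _; rewrite !mulr1 mpolyCD mpolyCM.
    rewrite prod3; apply: eq_bigr => k _.
    by rewrite !expr1n mulr1 mul1r -rmorphXn /= mulrC mul_mpolyC.
  rewrite raddf_sum (bigID (fun k => cnt 2 k == j)) /= [X in _ + X]big1 ?addr0.
    apply: eq_bigr => k /eqP <-; rewrite linearZ /= pihomog_dE //.
    exact: coef3_homog.
  move=> k kj; rewrite linearZ /= (pihomog_ne0 _ (coef3_homog _ _ _ hz)) ?scaler0 //.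
(* The degree singles out the choices with [j] factors contributing [z]; the weights then single out
   those with [e] factors contributing [b]. *)
have sj (j e : 'I_d.+1) : \sum_s lam e s *: pihomog mdeg j (\prod_i ((a i + b i * y s)%:MP + z i)) =
    \sum_(k | (cnt 2 k == j) && (cnt 1 k == e)) co k.
  under eq_bigr do rewrite pj scaler_sumr.
  rewrite exchange_big /= big_mkcondr /=; apply: eq_bigr => k _.
  under eq_bigr do rewrite scalerA.
  rewrite -scaler_suml lamP ?cnt_le -1?ltnS //.
  by rewrite eq_sym; case: eqP => _; rewrite ?scale1r ?scale0r.
under [RHS]eq_bigr do under eq_bigr do rewrite sj mulr_sumr big_mkcond.
under [RHS]eq_bigr do rewrite exchange_big.
rewrite exchange_big; apply: eq_bigr => k _.
have c2 := cnt_le 2 k; have c1 := cnt_le 1 k; have cs := cnt_sum k.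
rewrite -ltnS in c1; rewrite -ltnS in c2.
rewrite (bigD1 (Ordinal c2)) //= [X in _ + X]big1 ?addr0; last first.
  move=> j jk; rewrite big1 // => e _; case: ifP => // /andP[/eqP e1 _].
  by case/negP: jk; apply/eqP/val_inj.
rewrite (bigD1 (Ordinal c1)) /=; last by lia.
rewrite !eqxx /= [X in _ + X]big1 ?addr0; last first.
  move=> e /andP[_ ek]; case: ifP => // /eqP e1.
  by case/negP: ek; apply/eqP/val_inj.
by rewrite mulrC; congr (_ ^+ _ * _ * _); lia.
Qed.

Lemma extract_power (X Y : A) m c : (c <= m)%N -> (m <= d)%N ->
  \sum_t lam c t *: (X + y t *: Y) ^+ m = (X ^+ (m - c) * Y ^+ c) *+ 'C(m, c).
Proof.
move=> cm md.
transitivity (\sum_t \sum_(i < m.+1) (lam c t * y t ^+ i) *: ((X ^+ (m - i) * Y ^+ i) *+ 'C(m, i))).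
  apply: eq_bigr => t _; rewrite exprDn scaler_sumr; apply: eq_bigr => i _.
  by rewrite exprZn -scalerAr scalerMnr scalerA.
rewrite exchange_big /= (bigD1 (inord c)) //= inordK ?ltnS //.
rewrite -scaler_suml lamP ?(leq_trans cm) // eqxx scale1r big1 ?addr0 // => i ic.
rewrite -scaler_suml lamP ?(leq_trans cm) //; last by apply: leq_trans md; rewrite -ltnS.
have -> : (c == i) = false.
  apply: contraNF ic => /eqP ci; apply/eqP/val_inj; rewrite /= inordK //; by rewrite ltnS.
by rewrite scale0r.
Qed.

Definition lf (c : 'rV[K]_n) : A := lform (c 0).
Lemma lfD c c' : lf (c + c') = lf c + lf c'.
Proof. by rewrite /lf -lformD; apply: eq_lform => j; rewrite mxE. Qed.
Lemma lfZ a c : lf (a *: c) = a *: lf c.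
Proof. by rewrite /lf -lformZ; apply: eq_lform => j; rewrite mxE. Qed.

(** Scalar coefficients make this class stable under scaling over any field; they are absorbed later
    through [d]-th roots. *)
Definition psums (r : nat) (F : A) := exists2 s : seq (K * 'rV[K]_n), (size s <= r)%N &
  F = \sum_(x <- s) x.1 *: lf x.2 ^+ d.

Lemma psums0 : psums 0 0.
Proof. by exists [::]; rewrite ?big_nil. Qed.
Lemma psums_pow c : psums 1 (lf c ^+ d).
Proof. by exists [:: (1, c)]; rewrite ?big_seq1 ?scale1r. Qed.
Lemma psumsD r1 r2 F G : psums r1 F -> psums r2 G -> psums (r1 + r2) (F + G).
Proof.
move=> [s ss ->] [t st ->]; exists (s ++ t); first by rewrite size_cat leq_add.
by rewrite big_cat.
Qed.
Lemma psumsZ r a F : psums r F -> psums r (a *: F).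
Proof.
move=> [s ss ->]; exists [seq (a * x.1, x.2) | x <- s]; first by rewrite size_map.
by rewrite big_map scaler_sumr; apply: eq_bigr => x _; rewrite scalerA.
Qed.
Lemma psums_le r r' F : (r <= r')%N -> psums r F -> psums r' F.
Proof. by move=> rr [s ss ->]; exists s => //; exact: leq_trans ss rr. Qed.
Lemma psums_sum (I : finType) (P : pred I) r (F : I -> A) : (forall i, P i -> psums r (F i)) ->
  psums (#|I| * r) (\sum_(i | P i) F i).
Proof.
move=> h; rewrite big_mkcond -big_enum cardE.
elim: (enum I) => [|i l IH]; first by rewrite big_nil; exact: psums0.
rewrite big_cons /= mulSn; apply: psumsD => //; case: ifP => [/h//|_].
exact: psums_le psums0.
Qed.

Hypothesis char0 : [pchar K] =i pred0.

(** Polarization carried out twice: one interpolation isolates w^c in a [d]-th power, a second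
    isolates v^b in what remains. The binomial coefficients are invertible in characteristic 0. *)
Lemma psums_monomial a b c (u v w : 'rV[K]_n) : (a + b + c)%N = d ->
  psums (d.+1 * (d.+1 * 1)) (lf u ^+ a * lf v ^+ b * lf w ^+ c).
Proof.
move=> abc.
have nC m k : (k <= m)%N -> ('C(m, k)%:R : K) != 0.
  by move=> km; have /pcharf0P -> := char0; rewrite -lt0n bin_gt0.
have cd : (c <= d)%N by lia.
have e1 t := extract_power (lf u + y t *: lf v) (lf w) cd (leqnn d).
have e2 : \sum_t lam b t *: (lf u + y t *: lf v) ^+ (d - c) =
    (lf u ^+ a * lf v ^+ b) *+ 'C(d - c, b).
  by rewrite extract_power; [congr (_ ^+ _ * _ *+ _)|..]; lia.
have h1 : 'C(d, c)%:R != 0 :> K by exact: nC.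
have h2 : 'C(d - c, b)%:R != 0 :> K by apply: nC; lia.
have -> : lf u ^+ a * lf v ^+ b * lf w ^+ c =
   ('C(d, c)%:R * 'C(d - c, b)%:R)^-1 *: \sum_t lam b t *: \sum_s lam c s *: (lf u + y t *: lf v + y s *: lf w) ^+ d.
  under eq_bigr do rewrite e1 -scaler_nat scalerA mulrC -scalerA scalerAl.
  rewrite -scaler_sumr -mulr_suml e2 -scaler_nat -!scalerAl !scalerA -[X in _ = X *: _]mulrA.
  by rewrite mulVf ?scale1r ?mulf_neq0.
apply: psumsZ; rewrite -[X in (X * _)%N]card_ord.
apply: psums_sum => t _; apply: psumsZ; rewrite -[X in (X * _)%N]card_ord.
apply: psums_sum => s _; apply: psumsZ.
by rewrite -!lfZ -!lfD; exact: psums_pow.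
Qed.

End Interpolation.

(** * Divergent products *)

Section Divergent.
Variables (C K : fieldType) (iota : {rmorphism C -> K}) (lim : K -> C -> Prop).
Hypothesis plc : is_place iota lim.
Hypothesis charC : [pchar C] =i pred0.

Lemma charK : [pchar K] =i pred0.
Proof.
apply/pcharf0P => m; rewrite -(rmorph_nat iota) fmorph_eq0.
by move/pcharf0P : charC => ->.
Qed.

Lemma mlim_small n (P Q : {mpoly K[n]}) : mlim lim P 0 -> mfin lim Q -> mlim lim (P * Q) 0.
Proof. by move=> h [g hg]; have := mlimM plc h hg; rewrite mul0r. Qed.

Lemma mlim_sum0 n (I : finType) (F : I -> {mpoly K[n]}) :
  (forall i, mlim lim (F i) 0) -> mlim lim (\sum_i F i) 0.
Proof.
move=> h; have h0 : mlim lim (\sum_i F i) (\sum_(i : I) 0) by apply: (mlim_sum plc).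
by move: h0; rewrite big1_eq.
Qed.

(** As g e_j is finite and g infinite, every e_j is infinitesimal. So in g times Newton's identity
    each mixed product e_i p_k is infinitesimal, and only the pure power sum remains. *)
Lemma newton_place n (g : K) (ws : seq {mpoly K[n]}) : g != 0 -> lim g^-1 0 ->
  (forall j, mfin lim (g *: (egen ws)`_j.+1)) ->
  forall j, mlim lim (g *: ((egen ws)`_j.+1 - ((-1) ^+ j / j.+1%:R) *: psum_list ws j.+1)) 0.
Proof.
move=> g0 lg hfin.
have fsign j : finp lim ((-1) ^+ j).
  by exists ((-1) ^+ j); have := place_const plc ((-1) ^+ j); rewrite rmorphXn rmorphN rmorph1.
have e0 j : mlim lim (egen ws)`_j.+1 0.
  have [f hf] := hfin j; have := mlimZ plc lg hf.
  by rewrite scalerA mulVf // scale1r scale0r.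
suff h j : mfin lim (g *: psum_list ws j.+1) /\
    mlim lim (g *: ((egen ws)`_j.+1 *+ j.+1 - (-1) ^+ j *: psum_list ws j.+1)) 0.
  move=> j; have [_ hj] := h j.
  have lj : lim (j.+1%:R^-1) (j.+1%:R^-1).
    by have := place_const plc (j.+1%:R^-1); rewrite fmorphV rmorph_nat.
  have j0 : (j.+1%:R : K) != 0 by move/pcharf0P : charK => ->.
  have := mlimZ plc lj hj; rewrite scaler0; congr mlim.
  rewrite !scalerBr -scaler_nat !scalerA; move: ((-1) ^+ j) (j.+1%:R) j0 => s N N0.
  by congr (_ *: _ - _ *: _); field.
have [m] := ubnP j; elim: m j => // m IH j; rewrite ltnS => jm.
have sgnE k (P : {mpoly K[n]}) : (-1) ^+ k * P = (-1) ^+ k *: P.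
  by rewrite -mul_mpolyC rmorphXn rmorphN1.
have hd : mlim lim (g *: ((egen ws)`_j.+1 *+ j.+1 - (-1) ^+ j *: psum_list ws j.+1)) 0.
  rewrite newton big_ord_recr /= subnn egen0 mul1r sgnE addrK scaler_sumr.
  apply: mlim_sum0 => k; have [fk _] := IH k (leq_trans (ltn_ord k) jm).
  rewrite scalerAr sgnE scalerA [g * _]mulrC -scalerA.
  apply: mlim_small; last exact: (mfinZ plc).
  by rewrite -(subnSK (ltn_ord k)); exact: e0.
split=> //.
have [f hf] := hfin j.
have -> : g *: psum_list ws j.+1 = (-1) ^+ j *: (j.+1%:R *: (g *: (egen ws)`_j.+1) -
   g *: ((egen ws)`_j.+1 *+ j.+1 - (-1) ^+ j *: psum_list ws j.+1)).
  rewrite -[(egen ws)`_j.+1 *+ _]scaler_nat [g *: (_ - _)]scalerBr !scalerA [_%:R * g]mulrC.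
  by rewrite opprB addrC subrK scalerA mulrCA -expr2 sqrr_sign mulr1.
apply: (mfinZ plc) => //; exists (j.+1%:R *: f - 0); apply: (mlimB plc) => //.
apply: (mlimZ plc) => //.
by have := place_const plc (j.+1%:R); rewrite rmorph_nat.
Qed.

(** [al] reads the largest entry of [a], and [u] is [a] divided by that entry. *)
Lemma adapt1 n (a : 'rV[K]_n) : exists (al : 'cV[K]_n) (u : 'rV[K]_n),
  [/\ forall i j, finp lim (al i j), forall i j, finp lim (u i j) & a = (a *m al) *m u].
Proof.
have f0 : finp lim 0 by exists 0; exact: (place0 plc).
have f1 : finp lim 1 by exists 1; exact: (place1 plc).
have [a0|[k ak hk]] := place_max plc (fun j => a 0 j).
  exists 0, 0; split; try by move=> i j; rewrite mxE.
  by apply/rowP => j; rewrite a0 mulmx0 mxE.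
exists (delta_mx k 0), (\row_j (a 0 j / a 0 k)); split.
- by move=> i j; rewrite mxE; case: (_ && _).
- by move=> i j; rewrite mxE.
apply/rowP => j; rewrite !mxE big_ord1 !mxE.
have -> : \sum_(j0 < n) a 0 j0 * (delta_mx k 0 : 'cV[K]_n) j0 0 = a 0 k.
  rewrite (bigD1 k) //= mxE !eqxx mulr1 big1 ?addr0 // => i ik.
  by rewrite mxE (negPf ik) mulr0.
by rewrite mulrC divfK.
Qed.

Lemma finp_mulmx m n p (X : 'M[K]_(m, n)) (Y : 'M[K]_(n, p)) :
  (forall i j, finp lim (X i j)) -> (forall i j, finp lim (Y i j)) ->
  forall i j, finp lim ((X *m Y) i j).
Proof.
move=> hX hY i j; rewrite mxE.
have h k : exists c, lim (X i k * Y k j) c by exact: (finpM plc).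
by have [c hc] := choice h; exists (\sum_k c k); apply: (place_sum plc).
Qed.

Lemma finpB x y : finp lim x -> finp lim y -> finp lim (x - y).
Proof. by move=> [a xa] [b yb]; exists (a - b); exact: (placeB plc). Qed.

(* Coordinates adapted to the span of a and b, over the valuation ring. *)
Lemma adapt2 n (a b : 'rV[K]_n) : exists (al be : 'cV[K]_n) (u v : 'rV[K]_n),
  [/\ forall i j, finp lim (al i j), forall i j, finp lim (be i j),
      forall i j, finp lim (u i j), forall i j, finp lim (v i j) &
      a = (a *m al) *m u + (a *m be) *m v /\ b = (b *m al) *m u + (b *m be) *m v].
Proof.
have [al [u [fal fu ea]]] := adapt1 a.
pose b' := b - (b *m al) *m u.
have [be [v [fbe fv eb]]] := adapt1 b'.
(* [be] is meant for the remainder [b'], so it is preceded by removal of the [u] component; the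
   resulting functional vanishes on [a]. *)
exists al, ((1%:M - al *m u) *m be), u, v.
have f1 i j : finp lim ((1%:M : 'M[K]_n) i j).
  rewrite mxE; case: (i == j); first by exists 1; exact: (place1 plc).
  by exists 0; exact: (place0 plc).
split => //.
  apply: finp_mulmx => // i j; rewrite !mxE; apply: finpB => //.
    by have := f1 i j; rewrite mxE.
  by have := finp_mulmx fal fu i j; rewrite mxE.
have E c : c *m ((1%:M - al *m u) *m be) = (c - (c *m al) *m u) *m be.
  by rewrite mulmxA mulmxBr mulmx1 mulmxA.
split; rewrite E; first by rewrite -ea subrr !mul0mx addr0.
by rewrite -/b' -eb /b' addrC subrK.
Qed.

End Divergent.

Lemma mcoeff_prod1 (A : comNzRingType) n (ws : seq {mpoly A[n]}) m :
  (forall w, w \in ws -> w \is 1.-homog) ->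
  (\prod_(w <- ws) (1 + w))@_m = ((egen ws)`_(mdeg m))@_m.
Proof.
move=> hw.
have -> : \prod_(w <- ws) (1 + w) = (egen ws).[1].
  rewrite /egen horner_prod; apply: eq_bigr => w _.
  by rewrite hornerD hornerM hornerX !hornerC mulr1.
rewrite horner_coef raddf_sum /=.
under eq_bigr do rewrite expr1n mulr1.
have z i : i != mdeg m -> ((egen ws)`_i)@_m = 0.
  by move=> im; apply: dhomog_nemf_coeff (egen_homog i hw) _; rewrite eq_sym.
have [js|js] := ltnP (mdeg m) (size (egen ws)).
  by rewrite (bigD1 (Ordinal js)) //= big1 ?addr0 // => i ij; apply: z.
rewrite [in RHS]nth_default // mcoeff0 big1 // => i _; apply: z.
by rewrite neq_ltn (leq_trans (ltn_ord i) js).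
Qed.

Lemma lform_comp (A : comNzRingType) n p (c : 'I_n -> A) (t : 'I_n -> {mpoly A[p]}) :
  lform c \mPo [tuple t i | i < n] = \sum_j c j *: t j.
Proof.
rewrite /lform raddf_sum; apply: eq_bigr => j _.
by rewrite /= comp_mpolyZ comp_mpolyXU -tnth_nth tnth_mktuple.
Qed.

Section Divergent2.
Variables (C K : fieldType) (iota : {rmorphism C -> K}) (lim : K -> C -> Prop).
Hypothesis plc : is_place iota lim.
Hypothesis charC : [pchar C] =i pred0.

Lemma mfin_prod n (I : Type) (r : seq I) (F : I -> {mpoly K[n]}) :
  (forall i, mfin lim (F i)) -> mfin lim (\prod_(i <- r) F i).
Proof.
move=> h; elim: r => [|i r IH]; first by rewrite big_nil; exact: (mfin1 plc).
by rewrite big_cons; exact: (mfinM plc).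
Qed.

Lemma mfin_X n (m : 'X_{1..n}) : mfin lim 'X_[m].
Proof.
exists 'X_[m] => k; rewrite !mcoeffX.
by case: eqP => _; [exact: (place1 plc)|exact: (place0 plc)].
Qed.

Lemma mfin_coef n (P : {mpoly K[n]}) : (forall m, finp lim P@_m) -> mfin lim P.
Proof.
move=> h; rewrite (mpolyE P); apply: (mfin_sum plc) => m.
by apply: (mfinZ plc) => //; exact: mfin_X.
Qed.

Lemma mfin_comp n p (F : {mpoly K[n]}) (t : 'I_n -> {mpoly K[p]}) :
  mfin lim F -> (forall i, mfin lim (t i)) -> mfin lim (F \mPo [tuple t i | i < n]).
Proof.
move=> [f hf] ht; rewrite comp_mpolyE; apply: (mfin_sum plc) => m.
apply: (mfinZ plc); first by exists f@_m.
by apply: mfin_prod => i; apply: (mfinX plc); rewrite tnth_mktuple.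
Qed.

Lemma mfinC n c : finp lim c -> mfin lim (c%:MP_[n]).
Proof. by move=> [x hx]; exists x%:MP; exact: (mlimC plc). Qed.

Section Main.
Variables (d n : nat) (g : K) (l : 'I_d -> 'rV[K]_n) (l0 : 'I_d -> 'rV[C]_n).
Variables (a b : 'rV[K]_n) (f : {mpoly C[n]}).
Hypothesis d0 : (0 < d)%N.
Hypothesis g0 : g != 0.
Hypothesis lg : lim g^-1 0.
Hypothesis hl : forall i j, lim (l i 0 j) (l0 i 0 j).
Hypothesis l0n : forall i, l0 i != 0.
Let F := g *: \prod_i lf (l i) + lf a ^+ d + lf b ^+ d.
Hypothesis hF : mlim lim F f.

Let M := (d.+1 * (d.+1 * 1))%N.

(** The bound counts the degree [j], the exponent [e], the node [s] and the [d] summands of a power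
    sum; [M] is the cost of polarizing one monomial, and the last 2 accounts for the powers of [a]
    and [b]. *)
Lemma divergent_case :
  exists2 F', psums d (d.+1 * (d.+1 * (d.+1 * (d * M))) + 2) F' & mlim lim F' f.
Proof.
have [al [be [u [v [fal fbe fu fv [ea eb]]]]]] := adapt2 plc a b.
pose rho : 'M[K]_n := 1%:M - al *m u - be *m v.
have frho i j : finp lim (rho i j).
  have fm (X : 'cV[K]_n) (Y : 'rV[K]_n) : (forall i j, finp lim (X i j)) ->
     (forall i j, finp lim (Y i j)) -> finp lim (- (X *m Y) i j).
    move=> hX hY; have := finp_mulmx plc hX hY i j => -[c hc].
    by exists (- c); exact: (placeN plc).
  have f1 : finp lim ((1%:M : 'M[K]_n) i j).
    rewrite mxE; case: (i == j); first by exists 1; exact: (place1 plc).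
    by exists 0; exact: (place0 plc).
  have [x hx] := fm al u fal fu; have [y hy] := fm be v fbe fv; have [z hz] := f1.
  have -> : rho i j = (1%:M : 'M[K]_n) i j + (- (al *m u) i j) + (- (be *m v) i j) by rewrite !mxE.
  by exists (z + x + y); apply: (placeD plc) => //; apply: (placeD plc).
pose Ac (c : 'rV[K]_n) := (c *m al) 0 0.
pose Bc (c : 'rV[K]_n) := (c *m be) 0 0.
have decomp c : c = Ac c *: u + Bc c *: v + c *m rho.
  rewrite /rho mulmxBr mulmxBr mulmx1 !mulmxA.
  rewrite [c *m al]mx11_scalar [c *m be]mx11_scalar !mul_scalar_mx -/(Ac c) -/(Bc c).
  by rewrite addrC -addrA [- (Bc c *: v) + _]addrC addrK subrK.
have rho0 c : c = (c *m al) *m u + (c *m be) *m v -> c *m rho = 0.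
  move=> e; apply/eqP; rewrite /rho mulmxBr mulmxBr mulmx1 !mulmxA -addrA -opprD subr_eq0.
  exact/eqP.
(* The substitution that sets u to 1 and v to [y]. Since [rho] kills [a] and [b], it turns both
   powers into constants. *)
pose sub (y : K) (k : 'I_n) : {mpoly K[n]} := (al k 0 + be k 0 * y)%:MP + lf (row k rho).
have lf_sub y c : lf c \mPo [tuple sub y i | i < n] = (Ac c + Bc c * y)%:MP + lf (c *m rho).
  rewrite lform_comp /sub; under eq_bigr do rewrite scalerDr -lfZ.
  rewrite big_split /=; congr (_ + _).
    under eq_bigr do rewrite -mul_mpolyC -mpolyCM.
    rewrite -raddf_sum; congr (_%:MP); rewrite /Ac /Bc !mxE mulr_suml -big_split.
    by apply: eq_bigr => k _ /=; rewrite mulrDr mulrA.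
  rewrite mulmx_sum_row; elim/big_rec2: _ => [|i x1 x2 _ ->]; last by rewrite -lfD.
  by rewrite -[LHS](scale0r (lf 0)) -lfZ scale0r.
pose N y := \prod_i ((Ac (l i) + Bc (l i) * y)%:MP + lf (l i *m rho)).
have NE y : F \mPo [tuple sub y i | i < n] =
   g *: N y + ((Ac a + Bc a * y) ^+ d + (Ac b + Bc b * y) ^+ d)%:MP.
  rewrite /F !comp_mpolyD comp_mpolyZ rmorph_prod !rmorphXn /= !lf_sub.
  have z0 : lf (0 : 'rV[K]_n) = 0 by rewrite -[LHS]scale1r -[0](scale0r (0 : 'rV[K]_n)) lfZ scale0r scaler0.
  rewrite !rho0 // z0 !addr0 -!rmorphXn -addrA -rmorphD /=; congr (_ *: _ + _).
  by apply: eq_bigr => i _; rewrite lf_sub.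
have fsub y k : mfin lim (sub (iota y) k).
  apply: (mfinD plc).
    apply: mfinC; have [x1 h1] := fal k 0; have [x2 h2] := fbe k 0.
    exists (x1 + x2 * y); apply: (placeD plc) => //; apply: (placeM plc) => //.
    exact: (place_const plc).
  by apply: (mfin_lform plc) => j; rewrite mxE.
(* Only the product contributes to nonconstant coefficients, so finiteness of [F] passes to them;
   dividing by the infinite [g] then makes the limit [N0] constant. *)
have fN y m : m != 0%MM -> finp lim (g * (N (iota y))@_m).
  move=> m0; have [G hG] : mfin lim (F \mPo [tuple sub (iota y) i | i < n]).
    by apply: mfin_comp => //; exists f.
  exists G@_m; have := hG m; rewrite NE mcoeffD mcoeffC (negPf m0) mulr0 addr0.
  by rewrite mcoeffZ.
have /choice[A0 hA0] : forall i, exists x, lim (Ac (l i)) x.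
  move=> i; apply: (finp_mulmx plc (X := l i)) => // i' j; rewrite ord1.
  by exists (l0 i 0 j).
have /choice[B0 hB0] : forall i, exists x, lim (Bc (l i)) x.
  move=> i; apply: (finp_mulmx plc (X := l i)) => // i' j; rewrite ord1.
  by exists (l0 i 0 j).
have /choice[r0 hr0] : forall ij : 'I_d * 'I_n, exists x, lim ((l ij.1 *m rho) 0 ij.2) x.
  move=> [i j]; apply: (finp_mulmx plc (X := l i)) => // i' j'; rewrite ord1.
  by exists (l0 i 0 j').
pose N0 y := \prod_i ((A0 i + B0 i * y)%:MP + lform (fun j => r0 (i, j))).
have lAB i y : lim (Ac (l i) + Bc (l i) * iota y) (A0 i + B0 i * y).
  by apply: (placeD plc) => //; apply: (placeM plc) => //; exact: (place_const plc).
have lN y : mlim lim (N (iota y)) (N0 y).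
  apply: (mlim_prod plc) => i _; apply: (mlimD plc); first exact: (mlimC plc).
  by apply: (mlim_lform plc) => j; exact: (hr0 (i, j)).
have N0c y m : m != 0%MM -> (N0 y)@_m = 0.
  move=> m0; have [x hx] := fN y m m0.
  have := placeM plc lg hx; rewrite mulKf // mul0r => h.
  exact: (place_uniq plc (lN y m) h).
have nz i : A0 i != 0 \/ B0 i != 0 \/ exists j, r0 (i, j) != 0.
  have [A00|] := eqVneq (A0 i) 0; last by left.
  have [B00|] := eqVneq (B0 i) 0; last by right; left.
  right; right; have [//|nr] := pselect (exists j, r0 (i, j) != 0).
  case/negP: (l0n i); apply/eqP/rowP => j; rewrite mxE.
  apply: (place_uniq plc (hl i j)).
  have -> : l i 0 j = Ac (l i) * u 0 j + Bc (l i) * v 0 j + (l i *m rho) 0 j.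
    have := congr1 (fun w : 'rV[K]_n => w 0 j) (decomp (l i)).
    by rewrite mxE [(_ *: u + _) 0 j]mxE [(_ *: u) 0 j]mxE [(_ *: v) 0 j]mxE.
  have [cu hu] := fu 0 j; have [cv hv] := fv 0 j.
  have := placeD plc (placeD plc (placeM plc (hA0 i) hu) (placeM plc (hB0 i) hv)) (hr0 (i, j)).
  rewrite A00 B00 !mul0r !add0r; congr lim; apply/eqP/negPn/negP => h.
  by apply: nr; exists j.
(* The nodes avoid the zeros of all affine functions A0 + B0 y that are not identically 0, so that
   no factor of [N0] vanishes there. *)
have [y yinj hy] : exists2 y : 'I_d.+1 -> C, injective y &
    forall i s, (A0 i != 0) || (B0 i != 0) -> A0 i + B0 i * y s != 0.
  pose p := \prod_(i | (A0 i != 0) || (B0 i != 0)) ((A0 i)%:P + (B0 i)%:P * 'X).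
  have p0 : p != 0.
    rewrite /p; apply/prodf_neq0 => i /orP[h|h]; apply/eqP => /polyP.
      by move=> /(_ 0%N); rewrite coefD coefC coefCM coefX mulr0 addr0 coef0 => e; rewrite e eqxx in h.
    by move=> /(_ 1%N); rewrite coefD coefC coefCM coefX mulr1 add0r coef0 => e; rewrite e eqxx in h.
  have [y yinj py] := many_nonroots d.+1 charC p0; exists y => // i s hi.
  move: (py s); rewrite /p horner_prod => /prodf_neq0/(_ i hi).
  by rewrite hornerD hornerM !hornerC hornerX.
have c0l (h : 'I_n -> C) : (lform h)@_0%MM = 0.
  rewrite (dhomog_nemf_coeff (lform_homog h)) //= mdeg0 //.
have cUl (c : C) (h : 'I_n -> C) j : (c%:MP + lform h)@_U_(j) = h j.
  by rewrite mcoeffD mcoeffC mnm1_eq0 mulr0 add0r mcoeff_lform1.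
have fac0 i s : (A0 i + B0 i * y s)%:MP + lform (fun j => r0 (i, j)) != 0 :> {mpoly C[n]}.
  have hAB : (A0 i != 0) || (B0 i != 0) -> (A0 i + B0 i * y s)%:MP + lform (fun j => r0 (i, j)) != 0 :> {mpoly C[n]}.
    move=> h; apply/eqP => /(congr1 (mcoeff 0%MM)).
    rewrite mcoeffD mcoeffC eqxx mulr1 c0l addr0 mcoeff0 => e.
    by have := hy i s h; rewrite e eqxx.
  case: (nz i) => [h|[h|[j h]]]; [by apply: hAB; rewrite h|by apply: hAB; rewrite h orbT|].
  apply/eqP => /(congr1 (mcoeff U_(j)%MM)); rewrite cUl mcoeff0 => e.
  by rewrite e eqxx in h.
(* The factors of a nonzero constant polynomial are constant: the limit forms have no component on
   the complement, and their values at the nodes are therefore units. *)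
have r00 i j : r0 (i, j) = 0.
  pose s0 : 'I_d.+1 := ord0.
  pose fac k := (A0 k + B0 k * y s0)%:MP + lform (fun j => r0 (k, j)) : {mpoly C[n]}.
  have NF : N0 (y s0) = fac i * \prod_(k | k != i) fac k by rewrite /N0 (bigD1 i).
  have R0 : \prod_(k | k != i) fac k != 0 by apply/prodf_neq0 => k _; exact: fac0.
  have s1 : msize (N0 (y s0)) = 1%N.
    have e : N0 (y s0) = ((N0 (y s0))@_0%MM)%:MP.
      apply/mpolyP => m; rewrite mcoeffC; case: eqP => [->|/eqP m0]; first by rewrite mulr1.
      by rewrite mulr0 N0c.
    have : N0 (y s0) != 0 by rewrite NF mulf_neq0 ?fac0.
    by rewrite e msizeC mpolyC_eq0 => ->.
  move: s1; rewrite NF msizeM ?fac0 // => s1.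
  have f1 : (msize (fac i) <= 1)%N.
    have h1 : msize (fac i) != 0%N by rewrite msize_poly_eq0 fac0.
    have h2 : msize (\prod_(k | k != i) fac k) != 0%N by rewrite msize_poly_eq0.
    by move: s1 h1 h2; case: (msize _) => [|[|x]] //; case: (msize _) => [|z] //=; lia.
  rewrite -(cUl (A0 i + B0 i * y s0) (fun j => r0 (i, j))) -/(fac i).
  by apply: memN_msupp_eq0; apply: msize_mdeg_ge; rewrite mdeg1.
have qn i s : A0 i + B0 i * y s != 0.
  apply: hy; case: (nz i) => [->//|[->|[j]]]; first by rewrite orbT.
  by rewrite r00 eqxx.
pose yK s := iota (y s).
pose q i s := Ac (l i) + Bc (l i) * yK s.
have uq i s : unitp lim (q i s) by exists (A0 i + B0 i * y s); [exact: qn|exact: lAB].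
have q0 i s : q i s != 0 := unitp_neq0 plc (uq i s).
pose W s := [seq (q i s)^-1 *: lf (l i *m rho) | i <- enum 'I_d].
pose Q s := \prod_i q i s.
have uQ s : unitp lim (Q s).
  rewrite /Q; elim/big_rec: _ => [|i x _]; first exact: (unitp1 plc).
  exact: (unitpM plc (uq i s)).
have Q0 s : Q s != 0 := unitp_neq0 plc (uQ s).
have hW s w : w \in W s -> w \is 1.-homog.
  by case/mapP => i _ ->; apply: dhomogZ; exact: lform_homog.
have NW s : N (yK s) = Q s *: \prod_(w <- W s) (1 + w).
  rewrite /W big_map big_enum -mul_mpolyC rmorph_prod -big_split /=.
  apply: eq_bigr => i _; rewrite mulrDr mulr1 mul_mpolyC scalerA divff ?scale1r //.
have hfin s j : mfin lim (g *: (egen (W s))`_j.+1).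
  apply: mfin_coef => m; rewrite mcoeffZ.
  have [mj|mj] := eqVneq (mdeg m) j.+1.
    have m0 : m != 0%MM by apply/eqP => e; rewrite e mdeg0 in mj.
    have -> : g * ((egen (W s))`_j.+1)@_m = (Q s)^-1 * (g * (N (yK s))@_m).
      by rewrite NW mcoeffZ (mcoeff_prod1 _ (@hW s)) mj mulrCA mulKf.
    by apply: (finpM plc) (unitp_fin (unitpV plc (uQ s))) (fN _ _ m0).
  rewrite (dhomog_nemf_coeff (egen_homog j.+1 (@hW s))) ?mulr0 //.
  by exists 0; exact: (place0 plc).
have hnew s := newton_place plc charC g0 lg (hfin s).
have [lam0 lamP0] := vandermonde_dual yinj.
pose lam e s := iota (lam0 e s).
have lamP e e' : (e <= d)%N -> (e' <= d)%N -> \sum_s lam e s * yK s ^+ e' = (e == e')%:R.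
  move=> h1 h2; rewrite -(rmorph_nat iota) -(lamP0 _ _ h1 h2) rmorph_sum.
  by apply: eq_bigr => s _; rewrite rmorphM rmorphXn.
(* The Newton substitute for g times the degree [j] part: a multiple of a power sum for positive
   [j], and the part itself for [j] = 0, where it is a scalar. *)
pose T s (j : nat) : {mpoly K[n]} :=
  if j is j'.+1 then (g * Q s * ((-1) ^+ j' / j'.+1%:R)) *: psum_list (W s) j'.+1
  else g *: pihomog mdeg 0 (N (yK s)).
pose F' := \sum_(j < d.+1) \sum_(e < d.+1 | (e + j <= d)%N)
   lf u ^+ (d - j - e) * lf v ^+ e * \sum_s lam e s *: T s j.
have prodE : \prod_i lf (l i) = \prod_i (Ac (l i) *: lf u + Bc (l i) *: lf v + lf (l i *m rho)).
  by apply: eq_bigr => i _; rewrite {1}(decomp (l i)) !lfD !lfZ.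
have lz i : lf (l i *m rho) \is 1.-homog by exact: lform_homog.
have intE := interpolation lamP (fun i => Ac (l i)) (fun i => Bc (l i)) (lf u) (lf v) lz.
have dT s (j : nat) : mlim lim (g *: pihomog mdeg j (N (yK s)) - T s j) 0.
  case: j => [|j] /=; first by rewrite subrr; exact: (mlim0 plc).
  have -> : g *: pihomog mdeg j.+1 (N (yK s)) = Q s *: (g *: (egen (W s))`_j.+1).
    by rewrite NW linearZ /= pihomog_prod1 ?scalerA 1?mulrC //; exact: hW.
  have [c _ hc] := uQ s; have := mlimZ plc hc (hnew s j); rewrite scaler0; congr mlim.
  by rewrite !scalerBr !scalerA; congr (_ - _ *: _); ring.
have fu' : mfin lim (lf u) by apply: (mfin_lform plc).
have fv' : mfin lim (lf v) by apply: (mfin_lform plc).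
exists (F' + lf a ^+ d + lf b ^+ d); last first.
  have -> : F' + lf a ^+ d + lf b ^+ d = F - (g *: \prod_i lf (l i) - F').
    by rewrite /F; move: (g *: _) (lf a ^+ d) (lf b ^+ d) => P1 P2 P3; ring.
  rewrite -[f]subr0; apply: (mlimB plc) => //.
  rewrite prodE intE scaler_sumr /F' -sumrB; apply: (mlim_sum0 plc) => // j.
  rewrite scaler_sumr -sumrB big_mkcond; apply: (mlim_sum0 plc) => // e; case: ifP => _; last exact: (mlim0 plc).
  rewrite scalerAr -mulrBr mulrC; apply: (mlim_small plc) => //; last first.
    by apply: (mfinM plc); apply: (mfinX plc).
  rewrite scaler_sumr -sumrB; apply: (mlim_sum0 plc) => // s.
  rewrite scalerA mulrC -scalerA -scalerBr.
  by have := mlimZ plc (place_const plc (lam0 e s)) (dT s j); rewrite scaler0.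
have chK := charK iota charC.
have mon (x e c : nat) (w : 'rV[K]_n) : (x + e + c)%N = d -> psums d M (lf u ^+ x * lf v ^+ e * lf w ^+ c).
  exact: (psums_monomial lamP chK u v w).
rewrite -addrA; apply: psumsD; last first.
  by apply: (psumsD (r1 := 1) (r2 := 1)); exact: psums_pow.
rewrite /F' -[X in (X * _)%N]card_ord; apply: psums_sum => j _.
rewrite -[X in (X * _)%N]card_ord; apply: psums_sum => e ej.
rewrite mulr_sumr -[X in (X * _)%N]card_ord; apply: psums_sum => s _.
rewrite -scalerAr; apply: psumsZ.
case: (nat_of_ord j) ej => [|j'] ej.
  rewrite -scalerAr; apply: psumsZ; apply: (@psums_le _ _ _ M); first by rewrite leq_pmull.
  have -> : pihomog mdeg 0 (N (yK s)) = ((pihomog mdeg 0 (N (yK s)))@_0%MM)%:MP.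
    apply/mpolyP => m; rewrite mcoeffC; case: eqP => [->|/eqP m0]; first by rewrite mulr1.
    by rewrite mulr0 (dhomog_nemf_coeff (pihomogP _ _ _)) // mdeg_eq0.
  rewrite mulrC mul_mpolyC; apply: psumsZ; rewrite subn0.
  have := mon (d - e)%N e 0%N 0; rewrite expr0 mulr1; apply.
  by rewrite addn0 in ej; rewrite addn0 subnK.
rewrite -scalerAr; apply: psumsZ; rewrite /psum_list big_map big_enum mulr_sumr.
rewrite -[X in (X * _)%N]card_ord; apply: psums_sum => i _.
rewrite -lfZ; apply: mon; lia.
Qed.

End Main.
End Divergent2.

(** * Sums of two powers *)

Lemma lf_eq0 (F : fieldType) n (c : 'rV[F]_n) : (lf c == 0) = (c == 0).
Proof.
apply/eqP/eqP => [h|->]; last by rewrite -(scale0r (0 : 'rV[F]_n)) lfZ scale0r.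
by apply/rowP => j; rewrite mxE -(mcoeff_lform1 (c 0) j) -/(lf c) h mcoeff0.
Qed.

Lemma lf_inj (F : fieldType) n : injective (@lf F n).
Proof.
move=> c c' h; apply/eqP; rewrite -subr_eq0 -lf_eq0 -scaleN1r lfD lfZ h scaleN1r.
by rewrite subrr.
Qed.

(** In the fraction field the quotient of the two forms is a root of X^d + 1; this polynomial splits
    over the constants, so the quotient is a constant. *)
Lemma sum_powers_eq0 (C : closedFieldType) n d (a c : 'rV[C]_n) : (0 < d)%N -> a != 0 ->
  lf a ^+ d + lf c ^+ d = 0 -> exists2 th, th ^+ d = -1 & a = th *: c.
Proof.
move=> d0 a0 h.
have c0 : c != 0.
  apply: contra_neq a0 => c0; move: h; rewrite c0.
  have /eqP -> : lf (0 : 'rV[C]_n) == 0 by rewrite lf_eq0.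
  rewrite expr0n eqn0Ngt d0 addr0 => /eqP; rewrite expf_eq0 d0 lf_eq0 => /eqP //.
have [s ps] := closed_field_poly_normal ('X^d + 1 : {poly C}).
have lc : lead_coef ('X^d + 1 : {poly C}) = 1 by rewrite -[1]polyC1 lead_coefXnaddC.
rewrite lc scale1r in ps.
pose tf : {rmorphism {mpoly C[n]} -> {fraction {mpoly C[n]}}} := @FracField.tofrac {mpoly C[n]}.
pose phi : {rmorphism C -> {fraction {mpoly C[n]}}} := tf \o @mpolyC n C.
have v0 : tf (lf c) != 0 by rewrite tofrac_eq0 lf_eq0.
pose t := tf (lf a) / tf (lf c).
have td : t ^+ d = -1.
  apply/eqP; rewrite /t expr_div_n -!rmorphXn -subr_eq0 opprK.
  have vd : tf (lf c ^+ d) != 0 by rewrite rmorphXn expf_neq0.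
  by rewrite -[1](divff vd) -mulrDl -rmorphD h rmorph0 mul0r.
have : (map_poly phi ('X^d + 1)).[t] = 0.
  by rewrite rmorphD /= map_polyXn rmorph1 hornerD hornerXn hornerC td addNr.
rewrite ps rmorph_prod horner_prod => /eqP; rewrite prodf_seq_eq0 => /hasP[z zs /=].
rewrite map_polyXsubC hornerXsubC subr_eq0 => /eqP tz.
have ac : a = z *: c.
  apply: (@lf_inj C); apply/eqP; rewrite -(@tofrac_eq {mpoly C[n]}) lfZ -mul_mpolyC.
  rewrite -[X in X == _]/(tf (lf a)) -[X in _ == X]/(tf _) rmorphM /=.
  by rewrite -[tf z%:MP]/(phi z) -tz /t divfK.
exists z => //.
have : root ('X^d + 1) z by rewrite ps root_prod_XsubC.
by rewrite /root hornerD hornerXn hornerC addr_eq0 => /eqP.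
Qed.

Section TwoPowers.
Variables (C : closedFieldType) (K : fieldType) (iota : {rmorphism C -> K}).
Variable lim : K -> C -> Prop.
Hypothesis plc : is_place iota lim.
Hypothesis charC : [pchar C] =i pred0.

Lemma scale_finp n x (P : {mpoly K[n]}) p : mlim lim P p -> p != 0 ->
  mfin lim (x *: P) -> finp lim x.
Proof.
move=> hP p0 [f hf].
have [m pm] : exists m, p@_m != 0.
  have [//|nm] := pselect (exists m, p@_m != 0).
  case/eqP: p0; apply/mpolyP => m; rewrite mcoeff0; apply/eqP/negPn/negP => pm.
  by apply: nm; exists m.
have Pm0 : P@_m != 0 by apply: (unitp_neq0 plc); exists p@_m.
exists (f@_m / p@_m); have := placeM plc (hf m) (place_inv plc pm (hP m)).
by rewrite mcoeffZ mulfK.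
Qed.

Lemma mlim_lf n (c : 'rV[K]_n) (c0 : 'rV[C]_n) :
  (forall j, lim (c 0 j) (c0 0 j)) -> mlim lim (lf c) (lf c0).
Proof. by move=> h; exact: (mlim_lform plc). Qed.

Lemma row_limit n (c : 'rV[K]_n) : (forall j, finp lim (c 0 j)) ->
  exists c0 : 'rV[C]_n, forall j, lim (c 0 j) (c0 0 j).
Proof.
move=> h; have [c0 hc] := choice h; exists (\row_j c0 j) => j; rewrite mxE.
exact: hc.
Qed.

Lemma primitive_row n (c : 'rV[K]_n) : c != 0 ->
  exists (x : K) (c' : 'rV[K]_n) (c0 : 'rV[C]_n),
    [/\ x != 0, c = x *: c', c0 != 0 & forall j, lim (c' 0 j) (c0 0 j)].
Proof.
move=> cn0; have [c0|[k ck hk]] := place_max plc (fun j => c 0 j).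
  by case/eqP: cn0; apply/rowP => j; rewrite c0 mxE.
have h j : finp lim (((c 0 k)^-1 *: c) 0 j) by rewrite mxE mulrC; exact: hk.
have [c0 hc0] := row_limit h.
exists (c 0 k), ((c 0 k)^-1 *: c), c0; split => //.
  by rewrite scalerA divff // scale1r.
apply/eqP => e; have := hc0 k; rewrite e !mxE mulVf // => h1.
by have := place_uniq plc h1 (place1 plc) => /eqP; rewrite eq_sym oner_eq0.
Qed.

Lemma second_order_step0 (A : comNzRingType) (U V W X : A) :
  (U + X * V) * (U ^+ 0 + X * ((U ^+ 0 * V) *+ 0 + X * W)) =
  U ^+ 1 + X * ((U ^+ 0 * V) *+ 1 + X * (U * W + (V * (U ^+ 0 * V)) *+ 0 + X * (V * W))).
Proof. by rewrite !mulr0n !mulr1n !expr0 expr1; ring. Qed.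

Lemma second_order_step (A : comNzRingType) (U V W X : A) d :
  (U + X * V) * (U ^+ d.+1 + X * ((U ^+ d * V) *+ d.+1 + X * W)) =
  U ^+ d.+2 + X * ((U ^+ d.+1 * V) *+ d.+2 +
    X * (U * W + (V * (U ^+ d * V)) *+ d.+1 + X * (V * W))).
Proof.
have id3 (Y k : A) : (U + X * V) * (U * Y + X * (k * (Y * V) + X * W)) =
    U * (U * Y) + X * ((k + 1) * (U * Y * V) + X * (U * W + k * (V * (Y * V)) + X * (V * W))).
  by ring.
have := id3 (U ^+ d) d.+1%:R; rewrite natr1 !mulr_natl !exprS; exact.
Qed.

Lemma exp_second_order n x (U V : {mpoly K[n]}) d : finp lim x -> mfin lim U -> mfin lim V ->
  exists2 W, mfin lim W &
   (U + x *: V) ^+ d = U ^+ d + x *: ((U ^+ d.-1 * V) *+ d + x *: W).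
Proof.
move=> fx fU fV; elim: d => [|d [W fW e]].
  by exists 0; [exact: (mfin0 plc)|rewrite !expr0 mulr0n scaler0 add0r scaler0 addr0].
exists (U * W + (V * (U ^+ d.-1 * V)) *+ d + x *: (V * W)).
  apply: (mfinD plc); last by apply: (mfinZ plc) => //; exact: (mfinM plc).
  apply: (mfinD plc); first exact: (mfinM plc).
  rewrite -scaler_nat; apply: (mfinZ plc).
    by exists d%:R; have := place_const plc d%:R; rewrite rmorph_nat.
  by do !apply: (mfinM plc) => //; exact: (mfinX plc).
rewrite exprS e -!mul_mpolyC; move: (x%:MP) => X.
(* The exponent [d.-1] is truncated at 0, hence the separate first step. *)
by case: d {e} => [|d] /=; [exact: second_order_step0|exact: second_order_step].
Qed.

Definition two_power_form n d (f : {mpoly C[n]}) :=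
  (exists a b : 'rV[C]_n, f = lf a ^+ d + lf b ^+ d) \/
  (exists s t : 'rV[C]_n, f = lf s ^+ d.-1 * lf t).

(** After division by the infinite x^d the residues cancel, so c is a' + [de] up to a root of -1,
    with [de] = k de' infinitesimal. The sum becomes -x^d k times (d a'^(d-1) de' + O(k)); the
    bracket has a nonzero limit, so the scalar is finite. *)
Lemma two_powers_core n d (f : {mpoly C[n]}) (a' c : 'rV[K]_n) (a0 : 'rV[C]_n) x :
  (0 < d)%N -> x != 0 -> lim x^-1 0 -> (forall j, lim (a' 0 j) (a0 0 j)) -> a0 != 0 ->
  (forall j, finp lim (c 0 j)) ->
  mlim lim (x ^+ d *: (lf a' ^+ d + lf c ^+ d)) f -> two_power_form d f.
Proof.
move=> d0 x0 lx ha a0n fc hf.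
have [c0 hc] := row_limit fc.
have la := mlim_lf ha; have lc := mlim_lf hc.
have h0 : lf a0 ^+ d + lf c0 ^+ d = 0.
  have h1 := mlimZ plc (placeX plc d lx) hf.
  rewrite scalerA exprVn mulVf ?expf_neq0 // scale1r expr0n eqn0Ngt d0 scale0r in h1.
  exact: (mlim_uniq plc (mlimD plc (mlimXn plc d la) (mlimXn plc d lc)) h1).
have [th thd ea] := sum_powers_eq0 d0 a0n h0.
pose de := iota th *: c - a'.
have lde j : lim (de 0 j) 0.
  have := placeB plc (placeM plc (place_const plc th) (hc j)) (ha j).
  by rewrite ea !mxE subrr.
have cE : lf c ^+ d = - (lf a' + lf de) ^+ d.
  rewrite -lfD /de addrC subrK lfZ exprZn -rmorphXn thd rmorphN1 scaleN1r.
  by rewrite opprK.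
rewrite cE in hf.
have [de0|den0] := eqVneq de 0.
  left; exists 0, 0; rewrite de0 in hf.
  have /eqP z0 : lf (0 : 'rV[K]_n) == 0 by rewrite lf_eq0.
  have /eqP z0' : lf (0 : 'rV[C]_n) == 0 by rewrite lf_eq0.
  rewrite z0 addr0 subrr scaler0 in hf.
  rewrite z0' expr0n eqn0Ngt d0 addr0; exact (mlim_uniq plc hf (@mlim0 _ _ _ _ plc n)).
have [k [de' [d0' [k0 deE d0'n hde]]]] := primitive_row den0.
have lk : lim k 0.
  have [j dj] : exists j, d0' 0 j != 0.
    have [//|nj] := pselect (exists j, d0' 0 j != 0).
    case/eqP: d0'n; apply/rowP => j; rewrite mxE; apply/eqP/negPn/negP => h.
    by apply: nj; exists j.
  have dj0 : de' 0 j != 0 by apply: (unitp_neq0 plc); exists (d0' 0 j).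
  have := placeM plc (lde j) (place_inv plc dj (hde j)).
  by rewrite mul0r deE mxE mulfK.
have fk : finp lim k by exists 0.
have lv := mlim_lf hde.
have [W [w hW] e] := exp_second_order d fk (ex_intro _ _ la) (ex_intro _ _ lv).
pose P := (lf a' ^+ d.-1 * lf de') *+ d + k *: W.
pose p := (lf a0 ^+ d.-1 * lf d0') *+ d.
have hP : mlim lim P p.
  rewrite /p -[X in mlim _ _ X]addr0; apply: (mlimD plc).
    rewrite -!scaler_nat; apply: (mlimZ plc).
      by have := place_const plc d%:R; rewrite rmorph_nat.
    by apply: (mlimM plc) => //; exact: (mlimXn plc).
  by have := mlimZ plc lk hW; rewrite scale0r.
have p0 : p != 0.
  rewrite /p -scaler_nat -mul_mpolyC mulf_neq0 ?mpolyC_eq0 //.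
    by move/pcharf0P : charC => ->; rewrite -lt0n.
  by rewrite mulf_neq0 ?expf_neq0 ?lf_eq0.
have hfP : mlim lim ((- (x ^+ d * k)) *: P) f.
  move: hf; congr mlim; rewrite deE lfZ e opprD addrA subrr add0r scalerN scalerA.
  by rewrite scaleNr.
have [z hz] := scale_finp hP p0 (ex_intro _ _ hfP).
right; exists a0, ((z * d%:R) *: d0').
rewrite (mlim_uniq plc hfP (mlimZ plc hz hP)) /p lfZ -scaler_nat scalerA.
by rewrite scalerAr.
Qed.

Lemma two_powers n d (a b : 'rV[K]_n) (f : {mpoly C[n]}) : (0 < d)%N ->
  mlim lim (lf a ^+ d + lf b ^+ d) f -> two_power_form d f.
Proof.
move=> d0 hf.
have scale (c : 'rV[K]_n) : (forall j, finp lim (c 0 j)) \/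
   exists (x : K) (c' : 'rV[K]_n) (c0 : 'rV[C]_n), [/\ x != 0, c = x *: c', c0 != 0,
     forall j, lim (c' 0 j) (c0 0 j) & lim x^-1 0].
  have [->|cn0] := eqVneq c 0.
    by left => j; rewrite mxE; exists 0; exact: (place0 plc).
  have [x [c' [c0 [x0 e c0n h]]]] := primitive_row cn0.
  have [[z hz]|hx] := place_dich plc x; last by right; exists x, c', c0.
  left => j; rewrite e mxE; exists (z * c0 0 j); exact: (placeM plc).
have core (a1 b1 : 'rV[K]_n) (x : K) (a' : 'rV[K]_n) (a0 : 'rV[C]_n) : mlim lim (lf a1 ^+ d + lf b1 ^+ d) f ->
    x != 0 -> a1 = x *: a' -> a0 != 0 -> (forall j, lim (a' 0 j) (a0 0 j)) -> lim x^-1 0 ->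
    (forall j, finp lim (x^-1 * b1 0 j)) -> two_power_form d f.
  move=> h x0 e a0n ha lx fb.
  refine (two_powers_core (c := x^-1 *: b1) d0 x0 lx ha a0n _ _).
    by move=> j; rewrite mxE.
  by move: h; rewrite e lfZ lfZ !exprZn scalerDr scalerA -exprMn divff // expr1n scale1r.
have [fa|[x [a' [a0 [x0 ea a0n ha lx]]]]] := scale a;
  have [fb|[z [b' [b0 [z0 eb b0n hb lz]]]]] := scale b.
- have [a0 ha] := row_limit fa; have [b0 hb] := row_limit fb.
  left; exists a0, b0; apply: (mlim_uniq plc hf).
  by apply: (mlimD plc); apply: (mlimXn plc); exact: mlim_lf.
- apply: (core b a z b' b0) => //; first by rewrite addrC.
  by move=> j; have [w hw] := fa j; exists (0 * w); exact: (placeM plc).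
- apply: (core a b x a' a0) => //.
  by move=> j; have [w hw] := fb j; exists (0 * w); exact: (placeM plc).
(* When both forms are infinite, the larger scale is factored out. *)
have [[r hr]|[r hr]] := place_finite_div plc z x.
  apply: (core a b x a' a0) => // j; exists (r * b0 0 j).
  by rewrite eb mxE mulrA [x^-1 * z]mulrC; exact: (placeM plc).
apply: (core b a z b' b0) => //; first by rewrite addrC.
move=> j; exists (r * a0 0 j).
by rewrite ea mxE mulrA [z^-1 * x]mulrC; exact: (placeM plc).
Qed.

End TwoPowers.

(** * Degenerations *)

Lemma linsubst_X (A : comNzRingType) n N (M : 'M[A]_(N, n)) i :
  linsubst 'X_i M = lform (M i).
Proof. by rewrite /linsubst comp_mpolyXU -tnth_nth tnth_mktuple. Qed.

Section Substitution.
Variable A : comNzRingType.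

Lemma linsubst_P12 d n (M : 'M[A]_(d + 2, n)) :
  linsubst (P12 A d) M = \prod_(i < d) lform (M (lshift 2 i)) +
    lform (M (rshift d 0)) ^+ d + lform (M (rshift d 1)) ^+ d.
Proof.
rewrite /linsubst /P12 !comp_mpolyD rmorph_prod !rmorphXn /= -!/(linsubst _ M) !linsubst_X.
by congr (_ + _ + _); apply: eq_bigr => i _; rewrite -/(linsubst _ M) linsubst_X.
Qed.

Lemma linsubst_tangent d n (M : 'M[A]_(d.+2, n)) :
  linsubst (prod_plus_tangent A d) M = \prod_(1 <= i < d.+1) lform (M (inord i)) +
    lform (M (inord 0)) ^+ d.-1 * lform (M (inord d.+1)).
Proof.
rewrite /linsubst /prod_plus_tangent !comp_mpolyD rmorph_prod rmorphM rmorphXn /=.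
rewrite -!/(linsubst _ M) !linsubst_X.
by congr (_ + _); apply: eq_bigr => i _; rewrite -/(linsubst _ M) linsubst_X.
Qed.

Lemma projection_P12 d n (l : 'I_d -> 'I_n -> A) a b :
  projection (\prod_i lform (l i) + lform a ^+ d + lform b ^+ d) (P12 A d).
Proof.
exists (\matrix_(i, j) match fintype.split i with
  | inl k => l k j | inr k => if k == 0 then a j else b j end).
rewrite linsubst_P12; congr (_ + _ ^+ d + _ ^+ d).
- apply: eq_bigr => i _; apply: eq_lform => j; rewrite mxE.
  by rewrite -[lshift 2 i]/(unsplit (inl i)) unsplitK.
- by apply: eq_lform => j; rewrite mxE -[rshift d 0]/(unsplit (inr 0)) unsplitK.
- by apply: eq_lform => j; rewrite mxE -[rshift d 1]/(unsplit (inr 1)) unsplitK.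
Qed.

Lemma projection_tangent d n (l : 'I_d -> 'I_n -> A) s t :
  projection (\prod_i lform (l i) + lform s ^+ d.-1 * lform t) (prod_plus_tangent A d).
Proof.
(* Row 0 is [s] and rows 1 to [d] are the [l]; at row [d.+1] the index [d] is out of range, so
   [insub] fails and the default [t] is taken. *)
exists (\matrix_(i < d.+2, j < n) if i == 0 then s j else
  oapp (fun k => l k j) (t j) (insub i.-1)).
rewrite linsubst_tangent; congr (_ + _ ^+ _ * _).
- rewrite big_add1 big_mkord; apply: eq_bigr => i _; apply: eq_lform => j.
  have hi : (i.+1 < d.+2)%N by rewrite !ltnS ltnW.
  by rewrite mxE -val_eqE /= inordK //= (valK i).
- by apply: eq_lform => j; rewrite mxE -val_eqE /= inordK.
by apply: eq_lform => j; rewrite mxE -val_eqE /= inordK //= insubF // ltnn.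
Qed.

End Substitution.

Lemma map_linsubst_P12 (A B : comNzRingType) (g : {rmorphism A -> B}) d n
    (M : 'M[A]_(d + 2, n)) :
  map_mpoly g (linsubst (P12 A d) M) = linsubst (P12 B d) (map_mx g M).
Proof.
have e i : map_mpoly g (lform (M i)) = lform (map_mx g M i).
  by rewrite map_lform; apply: eq_lform => j; rewrite /= mxE.
rewrite !linsubst_P12 !rmorphD !rmorphXn rmorph_prod /= !e.
by congr (_ + _ + _); apply: eq_bigr => i _.
Qed.

Section Degeneration.
Variable R : realType.
Notation C := (CC R).
Notation K := (hyper R).

(** A single [k] bounds both degree and error: finitely many coefficients are constrained, which
    gives a neighbourhood in the product topology, yet every coefficient is constrained for large
    [k]. *)
Lemma degeneration_approx n N (f : {mpoly C[n]}) (g : {mpoly C[N]}) (k : nat) :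
  degeneration f g -> exists M : 'M[C]_(N, n),
    forall m, (mdeg m <= k)%N -> nsq ((linsubst g M)@_m - f@_m) < inv_seq R k.
Proof.
move=> fg.
pose ms := [seq val m | m <- enum {: 'X_{1..n < k.+1}}].
have e0 : (0 : R) < inv_seq R k by rewrite /inv_seq invr_gt0.
suff nb : nbhs (coefs f : prod_topology (fun _ : 'X_{1..n} => C))
    [set h : prod_topology (fun _ : 'X_{1..n} => C) |
       {in ms, forall m, nsq (h m - f@_m) < inv_seq R k}].
  have [_ [[M _ <-] hM]] := fg _ nb; exists M => m mk; apply: hM.
  have mlt : (mdeg m < k.+1)%N by [].
  by apply/mapP; exists (BMultinom mlt); rewrite ?mem_enum.
elim: ms => [|m l IH]; first by apply: filterS filterT.
have nm : nbhs (coefs f : prod_topology (fun _ : 'X_{1..n} => C))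
    [set h : prod_topology (fun _ : 'X_{1..n} => C) | nsq (h m - f@_m) < inv_seq R k].
  apply: (@proj_continuous _ (fun _ : 'X_{1..n} => C) m (coefs f)
     [set z : C | nsq (z - f@_m) < inv_seq R k]).
  apply/nbhs_ballP; exists ((Num.min (inv_seq R k) 1)%:C)%C => [|z].
    by rewrite /= ltcR lt_min e0 ltr01.
  exact: nsq_lt.
apply: filterS (filterI nm IH) => h /= [h1 h2] m'.
by rewrite inE => /orP[/eqP->|/h2].
Qed.

Lemma degeneration_place d n (f : {mpoly C[n]}) : degeneration f (P12 C d) ->
  exists M : 'M[K]_(d + 2, n), mlim (@hlim R) (linsubst (P12 K d) M) f.
Proof.
move=> fg; have [s hs] := choice (fun k => degeneration_approx k fg).
pose Ms : 'M[nat -> C]_(d + 2, n) := \matrix_(i, j) (fun k => s k i j).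
exists (map_mx (@hcls R) Ms) => m.
rewrite -map_linsubst_P12 mcoeff_map_mpoly; apply: nsq_hlim.
have : freeU [set k | (mdeg m <= k)%N] by apply: freeU_oo; exact: nbhs_infty_ge.
apply: filterS => k /= mk; have := hs k m mk.
have -> : s k = map_mx (ev_seq k) Ms by apply/matrixP => i j; rewrite !mxE.
by rewrite -map_linsubst_P12 mcoeff_map_mpoly.
Qed.

End Degeneration.

(** * The three cases and the bound *)

Section Trichotomy.
Variables (C : closedFieldType) (K : fieldType) (iota : {rmorphism C -> K}).
Variable lim : K -> C -> Prop.
Hypothesis plc : is_place iota lim.
Hypothesis charC : [pchar C] =i pred0.

Lemma convergent_case d n (p : 'I_d -> 'rV[C]_n) (P : {mpoly K[n]}) a b (f : {mpoly C[n]}) :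
  (0 < d)%N -> mlim lim P (\prod_i lf (p i)) -> mlim lim (P + lf a ^+ d + lf b ^+ d) f ->
  projection f (P12 C d) \/ projection f (prod_plus_tangent C d).
Proof.
move=> d0 hP hf.
have h : mlim lim (lf a ^+ d + lf b ^+ d) (f - \prod_i lf (p i)).
  have := mlimB plc hf hP; congr mlim.
  by rewrite addrC -addrA addKr.
have [[s [t e]]|[s [t e]]] := two_powers plc charC d0 h.
  by left; rewrite -(subrK (\prod_i lf (p i)) f) e addrC addrA; exact: projection_P12.
by right; rewrite -(subrK (\prod_i lf (p i)) f) e addrC; exact: projection_tangent.
Qed.

Lemma trichotomy d n (l : 'I_d -> 'rV[K]_n) a b (f : {mpoly C[n]}) : (0 < d)%N ->
  mlim lim (\prod_i lf (l i) + lf a ^+ d + lf b ^+ d) f ->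
  [\/ projection f (P12 C d), projection f (prod_plus_tangent C d)
    | exists2 F : {mpoly K[n]},
        psums d (d.+1 * (d.+1 * (d.+1 * (d * (d.+1 * (d.+1 * 1))))) + 2) F & mlim lim F f].
Proof.
move=> d0 hf; pose i0 := Ordinal d0.
set far := exists2 F, _ & _; have conv p : mlim lim (\prod_i lf (l i)) (\prod_(i < d) lf (p i)) ->
    [\/ projection f (P12 C d), projection f (prod_plus_tangent C d) | far].
  by move=> h; have [] := convergent_case d0 h hf; [constructor 1|constructor 2].
have [[i li0]|nl0] := pselect (exists i, l i = 0).
  (* With a zero factor the product is 0, which is again a product of [d] forms because [d] is
     positive. *)
  apply: (conv (fun _ => 0)).
  have z (F : fieldType) : lf (0 : 'rV[F]_n) = 0 by apply/eqP; rewrite lf_eq0.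
  rewrite (bigD1 i) //= li0 z mul0r (bigD1 i0) //= z mul0r.
  exact (@mlim0 _ _ _ _ plc n).
have /choice[q hq] : forall i, exists q : K * ('rV[K]_n * 'rV[C]_n),
    [/\ q.1 != 0, l i = q.1 *: q.2.1, q.2.2 != 0 & forall j, lim (q.2.1 0 j) (q.2.2 0 j)].
  move=> i; have li0 : l i != 0 by apply/eqP => h; apply: nl0; exists i.
  have [x [c' [c0 [h1 h2 h3 h4]]]] := primitive_row plc li0.
  by exists (x, (c', c0)).
pose g := \prod_i (q i).1.
have g0 : g != 0 by apply/prodf_neq0 => i _; have [] := hq i.
have lE : \prod_i lf (l i) = g *: \prod_i lf (q i).2.1.
  rewrite /g -mul_mpolyC rmorph_prod -big_split /=; apply: eq_bigr => i _.
  by have [_ -> _ _] := hq i; rewrite lfZ mul_mpolyC.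
have lim2 i : forall j, lim ((q i).2.1 0 j) ((q i).2.2 0 j) by have [] := hq i.
have [[z hz]|hg] := place_dich plc g.
  (* The limit of the finite scalar [g] is put into one of the factors. *)
  apply: (conv (fun i => (if i == i0 then z else 1) *: (q i).2.2)).
  have -> : \prod_(i < d) lf ((if i == i0 then z else 1) *: (q i).2.2) =
      z *: \prod_i lf (q i).2.2.
    rewrite (bigD1 i0) //= lfZ [in RHS](bigD1 i0) //= scalerAl; congr (_ * _).
    by apply: eq_bigr => i /negPf ->; rewrite scale1r.
  rewrite lE; apply: (mlimZ plc) => //; apply: (mlim_prod plc) => i _.
  exact: (mlim_lf plc).
constructor 3; rewrite lE in hf.
by apply: (divergent_case plc charC d0 g0 hg lim2 _ hf) => i; have [] := hq i.
Qed.

(** In degree 0 every substitution gives the constant 3: an empty product and two zeroth powers. *)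
Lemma mlim_P12_0 n (M : 'M[K]_(0 + 2, n)) N : mlim lim (linsubst (P12 K 0) M) (linsubst (P12 C 0) N).
Proof.
rewrite !linsubst_P12 !big_ord0 !expr0; have h := @mlim1 _ _ _ _ plc n.
by do !apply: (mlimD plc).
Qed.

Lemma trichotomy_P12 d n (M : 'M[K]_(d + 2, n)) (f : {mpoly C[n]}) : (0 < d)%N ->
  mlim lim (linsubst (P12 K d) M) f ->
  [\/ projection f (P12 C d), projection f (prod_plus_tangent C d)
    | exists2 F : {mpoly K[n]},
        psums d (d.+1 * (d.+1 * (d.+1 * (d * (d.+1 * (d.+1 * 1))))) + 2) F & mlim lim F f].
Proof.
pose row_of (i : 'I_(d + 2)) : 'rV[K]_n := \row_j M i j.
have rE i : lform (M i) = lf (row_of i) by apply: eq_lform => j; rewrite mxE.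
rewrite linsubst_P12 !rE; under eq_bigr do rewrite rE.
exact: trichotomy.
Qed.

End Trichotomy.

Lemma psums_psum (K : fieldType) d n r (F : {mpoly K[n]}) :
  (forall x : K, exists y, y ^+ d = x) -> psums d r F ->
  exists2 s, (s <= r)%N & exists Z : 'M[K]_(s, n), F = psum d Z.
Proof.
move=> /choice[rt hrt] [s sr ->]; exists (size s) => //.
exists (\matrix_(i < size s, j < n)
   (rt (tnth (in_tuple s) i).1 * (tnth (in_tuple s) i).2 0 j)).
rewrite /psum big_tnth; apply: eq_bigr => i _; rewrite (@eq_lform _ _ _ _ (fun j => mxE _ _ _ j)).
move: (tnth _ i) => x; rewrite lformZ exprZn hrt.
by [].
Qed.

(** As d + 1 is at most 2d, the product is at most 32 d^6, hence at most 32 d^8; doubling the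
    constant absorbs the additional 2. *)
Lemma bound_d8 d : (0 < d)%N ->
  (d.+1 * (d.+1 * (d.+1 * (d * (d.+1 * (d.+1 * 1))))) + 2 <= 64 * d ^ 8)%N.
Proof.
move=> d0; have h1 : (d.+1 <= 2 * d)%N by lia.
have h5 : (d.+1 * (d.+1 * (d.+1 * (d * (d.+1 * (d.+1 * 1))))) <= 32 * d ^ 6)%N.
  have -> : (32 * d ^ 6 = 2 * d * (2 * d * (2 * d * (d * (2 * d * (2 * d * 1))))))%N.
    by rewrite !expnS expn0; lia.
  by rewrite !leq_mul.
have h6 : (d ^ 6 <= d ^ 8)%N by rewrite leq_pexp2l.
have h8 : (0 < d ^ 8)%N by rewrite expn_gt0 d0.
lia.
Qed.

Theorem mainTheorem7 (R : realType) :
  exists C : nat, forall (d n : nat) (f : {mpoly (CC R)[n]}),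
    f \is d.-homog ->
    degeneration f (P12 (CC R) d) ->
    [\/ projection f (P12 (CC R) d),
        projection f (prod_plus_tangent (CC R) d)
      | exists r : nat, is_border_waring_rank d f r /\ (r <= C * d ^ 8)%N].
Proof.
exists 64%N => d n f _ /degeneration_place[M hM].
have [d0|d0] := posnP d.
  constructor 1; exists 0; apply: (mlim_uniq (hlim_place R) hM).
  subst d; exact: (mlim_P12_0 (hlim_place R)).
have [|p1|p2|[F hF lF]] := trichotomy_P12 (hlim_place R) _ d0 hM.
- exact: char_CC.
- by constructor 1.
- by constructor 2.
constructor 3.
have [s sb [Z FZ]] := psums_psum (fun x => hyper_root x d0) hF.
(* The decomposition found shows that some length occurs; the rank is then the least such length. *)
have ex : exists r, `[< border_waring_decomp d f r >].
  by exists s; apply/asboolP; rewrite FZ in lF; exact: hyper_border_waring lF.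
have [r /asboolP hr hmin] := ex_minnP ex; exists r; split.
  by split => // t ht; apply: hmin; apply/asboolP.
apply: leq_trans (bound_d8 d0); apply: leq_trans sb; apply: hmin.
by apply/asboolP; rewrite FZ in lF; exact: hyper_border_waring lF.
Qed.
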